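(* Let $A$ be an Artinian local ring, let $B$ be a finitely generated standard $\mathbb{N}^r$-graded $A$-algebra, and let $M$ be a finitely generated $\mathbb{Z}^r$-graded $B$-module. Let $d_{++}=\dim(\mathrm{Supp}_{++}(M))$ and let $\mathbf n\in\mathbb{N}^r$ with $|\mathbf n|=d_{++}$. For $1\le i\le r$, let $\mathbf z_i=z_{i,1},\ldots,z_{i,n_i}\in[B]_{\mathbf e_i}$. Suppose that $\mathbf z_1,\ldots,\mathbf z_r$ is a filter-regular sequence on $M$. Let $E$ be the singly graded module $$E=\left(\frac{M/(\mathbf z_1,\ldots,\mathbf z_r)M}{\mathrm{H}^0_{\mathfrak N}\big(M/(\mathbf z_1,\ldots,\mathbf z_r)M\big)}\right)^{\mathrm{gr}}.$$ Then $$e(\mathbf n;M)=\begin{cases}e(E)&\text{if }\dim(E)=r,\\0&\text{otherwise.}\end{cases}$$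
   Context: $\mathbb{N}=\{0,1,2,\ldots\}$, $r\ge1$. Standard means that $[B]_{\mathbf 0}=A$ and $B$ is generated over $A$ by finitely many elements of degrees $\mathbf e_1,\ldots,\mathbf e_r$ (standard basis vectors). $|\mathbf n|=n_1+\cdots+n_r$. Conventions: $\dim(0)=\dim(\emptyset)=-\infty$. $\mathfrak N=\bigoplus_{\nu_1>0,\ldots,\nu_r>0}[B]_\nu$ is the irrelevant ideal, $\mathrm{H}^0_{\mathfrak N}(L)=\{m\in L:\mathfrak N^km=0\text{ for some }k\}$, $\mathrm{MultiProj}(B)$ is the space of graded primes of $B$ not containing $\mathfrak N$, and $\mathrm{Supp}_{++}(M)=\mathrm{Supp}(M)\cap\mathrm{MultiProj}(B)$ with its topological dimension. A homogeneous element $z\in B$ is filter-regular on $M$ if $z\notin\mathfrak p$ for all $\mathfrak p\in\mathrm{Ass}(M)$ with $\mathfrak p\not\supseteq\mathfrak N$. A sequence of homogeneous elements $z_1,\ldots,z_m$ is filter-regular on $M$ if $z_j$ is filter-regular on $M/(z_1,\ldots,z_{j-1})M$ for all $1\le j\le m$. Mixed multiplicity via Hilbert polynomial: the function $\mathrm{length}_A([M]_\nu)$ agrees for $\nu\gg\mathbf 0$ with a polynomial $P_M(X_1,\ldots,X_r)\in\mathbb{Q}[X_1,\ldots,X_r]$ of total degree $d_{++}$; writing $P_M=\sum_{n_1,\ldots,n_r\ge0}e(n_1,\ldots,n_r)\binom{X_1+n_1}{n_1}\cdots\binom{X_r+n_r}{n_r}$, set $e(\mathbf n;M)=e(n_1,\ldots,n_r)$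 for $|\mathbf n|=d_{++}$. For a $\mathbb{Z}^r$-graded module $L$, $L^{\mathrm{gr}}=\bigoplus_{n\in\mathbb{Z}}\big(\bigoplus_{|\nu|=n}[L]_\nu\big)$, a singly graded module over the standard graded $A$-algebra $B^{\mathrm{gr}}$ (defined the same way). For a finitely generated graded $B^{\mathrm{gr}}$-module $E$ of Krull dimension $s$, its multiplicity is $e(E)=Q(1)$ where $\sum_n\mathrm{length}_A([E]_n)t^n=Q(t)/(1-t)^s$ with $Q\in\mathbb{Z}[t,t^{-1}]$. *)

(* Defs.v *)
From HB Require Import structures.
From mathcomp Require Import all_boot all_order all_algebra.
From mathcomp Require Import boolp classical_sets mpoly.

Set Implicit Arguments.
Unset Strict Implicit.
Unset Printing Implicit Defensive.

Import Order.TTheory GRing.Theory Num.Theory.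

Local Open Scope ring_scope.
Local Open Scope classical_set_scope.
Local Open Scope quotient_scope.

(* Subsets of rings and modules are boolean predicates [{pred _}], as in      *)
(* MathComp's closedness predicates; arbitrary propositions are turned into   *)
(* booleans with the classical [`[< _ >]].                                    *)

Section ChainHeight.
Variables (T : Type) (lt : T -> T -> Prop) (D : set T).

Definition strict_chain (l : nat) (c : nat -> T) : Prop :=
  (forall i, (i <= l)%N -> D (c i)) /\
  (forall i, (i < l)%N -> lt (c i) (c i.+1)).

(* The supremum of the lengths of strict chains in D is the natural number d. *)
(* It fails for every d when D is empty (supremum -oo) and when the lengths   *)
(* are unbounded (supremum +oo).                                              *)
Definition chain_height (d : nat) : Prop :=
  (exists c, strict_chain d c) /\
  (forall l c, strict_chain l c -> (l <= d)%N).

End ChainHeight.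

Definition pred_proper (T : Type) (P Q : {pred T}) : Prop :=
  {subset P <= Q} /\ ~ {subset Q <= P}.

Section Span.
Variables (R : pzRingType) (V : lmodType R).

Definition submod_span (S : set V) : {pred V} := fun v =>
  `[< forall N : {pred V}, GRing.submod_closed N ->
        (forall x, S x -> x \in N) -> v \in N >].

Lemma submod_span_closed S : GRing.submod_closed (submod_span S).
Proof.
split=> [|a u v /asboolP hu /asboolP hv]; apply/asboolP => N hN SN.
  by case: hN.
by case: (hN) => _ hl; apply: hl; [apply: hu | apply: hv].
Qed.

HB.instance Definition _ S :=
  GRing.isSubmodClosed.Build R V (submod_span S) (submod_span_closed S).

Definition fin_gen_module : Prop :=
  exists s : seq V, forall v, v \in submod_span [set x | x \in s].

End Span.

Section QuotientModule.
Variables (R : pzRingType) (V : lmodType R) (N : submodClosed V).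

Definition submod_zmod : {pred V} := N.

Lemma submod_zmod_closed : zmod_closed submod_zmod.
Proof.
split=> [|u v uN vN]; first exact: (rpred0 N).
by rewrite -scaleN1r; apply: (rpredD (S := N)); rewrite ?rpredZ.
Qed.

HB.instance Definition _ :=
  GRing.isZmodClosed.Build V submod_zmod submod_zmod_closed.

Definition quot_mod : Type := Quotient.quot submod_zmod.

HB.instance Definition _ := Choice.on quot_mod.
HB.instance Definition _ := EqQuotient.on quot_mod.
HB.instance Definition _ := GRing.Zmodule.on quot_mod.

Definition quot_pi (x : V) : quot_mod := \pi x.

Definition quot_scale (a : R) (x : quot_mod) : quot_mod :=
  quot_pi (a *: repr x).

Lemma quot_piP (x y : V) : reflect (quot_pi x = quot_pi y) (x - y \in N).
Proof.
by rewrite [_ \in N](Quotient.idealrBE submod_zmod x y); apply: eqP.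
Qed.

Lemma quot_pi_repr (x : quot_mod) : quot_pi (repr x) = x.
Proof. exact: reprK. Qed.

Lemma quot_pi_surj (x : quot_mod) : exists y, x = quot_pi y.
Proof. by exists (repr x); rewrite quot_pi_repr. Qed.

Lemma quot_piD (x y : V) : quot_pi (x + y) = quot_pi x + quot_pi y.
Proof. exact: (Quotient.pi_add submod_zmod). Qed.

Lemma quot_scaleE a (x : V) : quot_scale a (quot_pi x) = quot_pi (a *: x).
Proof.
apply/quot_piP; rewrite -scalerBr rpredZ //; apply/quot_piP.
exact: quot_pi_repr.
Qed.

Lemma quot_scalerA a b x :
  quot_scale a (quot_scale b x) = quot_scale (a * b) x.
Proof. by have [y ->] := quot_pi_surj x; rewrite !quot_scaleE scalerA. Qed.

Lemma quot_scale1r : left_id 1 quot_scale.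
Proof.
by move=> x; have [y ->] := quot_pi_surj x; rewrite quot_scaleE scale1r.
Qed.

Lemma quot_scalerDr : right_distributive quot_scale +%R.
Proof.
move=> a x x'; have [y ->] := quot_pi_surj x; have [y' ->] := quot_pi_surj x'.
by rewrite -quot_piD !quot_scaleE scalerDr quot_piD.
Qed.

Lemma quot_scalerDl x : {morph quot_scale^~ x : a b / a + b}.
Proof.
by move=> a b; have [y ->] := quot_pi_surj x; rewrite !quot_scaleE scalerDl
  quot_piD.
Qed.

HB.instance Definition _ := GRing.Zmodule_isLmodule.Build R quot_mod
  quot_scalerA quot_scale1r quot_scalerDr quot_scalerDl.

End QuotientModule.

Section Ideals.
Variable R : comNzRingType.

Definition prime_ideal (P : {pred R}) : Prop :=
  idealr_closed P /\ prime_idealr_closed P.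

Definition maximal_ideal (m : {pred R}) : Prop :=
  idealr_closed m /\
  forall J : {pred R}, idealr_closed J -> {subset m <= J} -> {subset J <= m}.

Definition local_ring : Prop :=
  exists2 m : {pred R}, maximal_ideal m &
    forall m' : {pred R}, maximal_ideal m' -> m' =i m.

(* the submodules of R^o are the ideals of R *)
Definition artinian_ring : Prop :=
  forall J : nat -> {pred R^o}, (forall k, GRing.submod_closed (J k)) ->
    (forall k, {subset J k.+1 <= J k}) ->
  exists k, forall l, (k <= l)%N -> J l =i J k.

Definition ideal_pow (I : {pred R}) (k : nat) : {pred R^o} :=
  submod_span [set b : R^o | exists s : seq R,
    [/\ size s = k, {subset s <= I} & b = \prod_(x <- s) x]].

Lemma ideal_pow_le (I : {pred R}) k l :
  {subset ideal_pow I (k + l) <= ideal_pow I k}.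
Proof.
move=> b /asboolP hb; apply: hb; first exact: submod_span_closed.
move=> _ [s [sz sI ->]]; rewrite -(cat_take_drop k s) big_cat /= mulrC.
apply: (@rpredZ R R^o (ideal_pow I k)); apply/asboolP => N _; apply.
exists (take k s); split=> //; first by rewrite size_takel // sz leq_addr.
by move=> x /mem_take /sI.
Qed.

End Ideals.

Section ModuleNotions.
Variables (B : comNzRingType) (M : lmodType B).

Definition assoc_prime (P : {pred B}) : Prop :=
  prime_ideal P /\ exists m : M, forall b, b \in P <-> b *: m = 0.

(* The localization of M at P is nonzero: m/1 <> 0 in it for some m in M,     *)
(* that is, no s outside P kills m.                                           *)
Definition in_supp (P : {pred B}) : Prop :=
  prime_ideal P /\ exists m : M, forall s, s \notin P -> s *: m <> 0.

(* dim M = d, as the Krull dimension of B / Ann(M), whose primes are the      *)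
(* primes of B containing Ann(M).                                             *)
Definition krull_dim (d : nat) : Prop :=
  chain_height (@pred_proper B)
    [set P | prime_ideal P /\ forall b, (forall m : M, b *: m = 0) -> b \in P]
    d.

(* (zs)M, for the ideal (zs) of B generated by zs *)
Definition seq_submod (zs : seq B) : {pred M} :=
  submod_span [set x : M | exists2 z, z \in zs & exists m : M, x = z *: m].

HB.instance Definition _ zs := GRing.SubmodClosed.on (seq_submod zs).

(* H^0_I(M), the elements of M killed by some power of the ideal I *)
Definition torsion (I : {pred B}) : {pred M} := fun m =>
  `[< exists k, forall b : B, b \in ideal_pow I k -> b *: m = 0 >].

Lemma torsion_closed I : GRing.submod_closed (torsion I).
Proof.
split=> [|a u v /asboolP[k hk] /asboolP[l hl]]; apply/asboolP.
  by exists 0%N => b _; rewrite scaler0.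
exists (k + l)%N => b hb; rewrite scalerDr scalerA mulrC -scalerA.
rewrite hk ?hl ?scaler0 ?addr0 //; first by apply: (@ideal_pow_le _ _ l k); rewrite addnC.
exact: (@ideal_pow_le _ _ k l).
Qed.

HB.instance Definition _ I :=
  GRing.isSubmodClosed.Build B M (torsion I) (torsion_closed I).

End ModuleNotions.

Arguments seq_submod {B} M zs.
Arguments torsion {B} M I.

Section Gradings.
Variables (G : eqType) (V : zmodType).

Definition family_sum (F : G -> {pred V}) : {pred V} := fun v =>
  `[< exists (s : seq G) (f : G -> V),
      [/\ uniq s, forall g, g \in s -> f g \in F g & v = \sum_(g <- s) f g] >].

Definition grading (F : G -> {pred V}) : Prop :=
  [/\ forall g, zmod_closed (F g),
      forall v, v \in family_sum F &
      forall (s : seq G) (f : G -> V), uniq s ->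
        (forall g, g \in s -> f g \in F g) -> \sum_(g <- s) f g = 0 ->
        forall g, g \in s -> f g = 0].

Definition homogeneous (F : G -> {pred V}) (P : {pred V}) : Prop :=
  {subset P <= family_sum (fun g => [predI F g & P])}.

End Gradings.

(* N^r is the type ['X_{1..r}] of multinomials, with e_i = U_(i) and          *)
(* |n| = mdeg n; Z^r is [{ffun 'I_r -> int}].                                 *)
Section Multigraded.
Variable r : nat.

Definition degZ (mu : 'X_{1..r}) : {ffun 'I_r -> int} :=
  [ffun i => (mu i)%:Z].

Definition total_deg (nu : {ffun 'I_r -> int}) : int := \sum_i nu i.

Definition graded_ring (B : comNzRingType) (BB : 'X_{1..r} -> {pred B}) :=
  [/\ grading BB, 1 \in BB 0%MM &
      forall mu nu x y, x \in BB mu -> y \in BB nu -> x * y \in BB (mu + nu)%MM].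

Definition graded_module (B : comNzRingType) (BB : 'X_{1..r} -> {pred B})
    (M : lmodType B) (MM : {ffun 'I_r -> int} -> {pred M}) : Prop :=
  grading MM /\
  forall mu nu b m, b \in BB mu -> m \in MM nu -> b *: m \in MM (degZ mu + nu).

Definition standard_graded (A : comNzRingType) (B : comAlgType A)
    (BB : 'X_{1..r} -> {pred B}) : Prop :=
  [/\ graded_ring BB,
      injective (fun a : A => a%:A : B),
      forall b : B, b \in BB 0%MM <-> exists a : A, b = a%:A &
      exists s : seq B,
        (forall x, x \in s -> exists i : 'I_r, x \in BB U_(i)%MM) /\
        (forall S : {pred B}, GRing.subalg_closed S -> {subset s <= S} ->
           forall b, b \in S)].

Section MultiProj.
Variables (B : comNzRingType) (BB : 'X_{1..r} -> {pred B}).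

Definition irrelevant : {pred B} :=
  family_sum (fun nu : 'X_{1..r} => [pred b in BB nu | [forall i, 0 < nu i]%N]).

Definition multiproj : set {pred B} :=
  [set P | [/\ prime_ideal P, homogeneous BB P & ~ {subset irrelevant <= P}]].

Variable M : lmodType B.

Definition supp_pp : set {pred B} := @in_supp B M `&` multiproj.

(* closed subsets of Supp_{++}(M), for the topology induced by the Zariski    *)
(* topology of MultiProj(B)                                                   *)
Definition supp_pp_closed (Z : set {pred B}) : Prop :=
  exists J : {pred B^o}, [/\ GRing.submod_closed J, homogeneous BB J &
    Z = supp_pp `&` [set P | {subset J <= P}]].

Definition supp_pp_irreducible (Z : set {pred B}) : Prop :=
  [/\ supp_pp_closed Z, Z !=set0 &
      forall Z1 Z2, supp_pp_closed Z1 -> supp_pp_closed Z2 ->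
        Z `<=` Z1 `|` Z2 -> Z `<=` Z1 \/ Z `<=` Z2].

Definition dim_supp_pp (d : nat) : Prop :=
  chain_height (fun Z1 Z2 => Z1 `<` Z2) supp_pp_irreducible d.

Definition filter_regular (z : B) : Prop :=
  forall P, assoc_prime M P -> ~ {subset irrelevant <= P} -> z \notin P.

End MultiProj.

Definition filter_regular_seq (B : comNzRingType) (BB : 'X_{1..r} -> {pred B})
    (M : lmodType B) (zs : seq B) : Prop :=
  forall j, (j < size zs)%N ->
    filter_regular BB (quot_mod (seq_submod M (take j zs))) zs`_j.

Definition quot_grading (B : comNzRingType) (M : lmodType B)
    (MM : {ffun 'I_r -> int} -> {pred M}) (N : submodClosed M)
    (nu : {ffun 'I_r -> int}) : {pred quot_mod N} := fun y =>
  `[< exists2 x, x \in MM nu & y = quot_pi N x >].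

(* the degree n component of M^gr *)
Definition total_component (B : comNzRingType) (M : lmodType B)
    (MM : {ffun 'I_r -> int} -> {pred M}) (n : int) : {pred M} :=
  family_sum (fun nu => [pred m in MM nu | total_deg nu == n]).

End Multigraded.

Arguments quot_grading {r B M} MM N nu.

Section Multiplicities.
Variables (A : comNzRingType) (B : comAlgType A) (M : lmodType B).

Definition base_submodule (N : {pred M}) : Prop :=
  0 \in N /\
  forall a : A, {in N &, forall u v, (a%:A : B) *: u + v \in N}.

(* length_A(V) = l, for an A-submodule V of M *)
Definition base_length (V : {pred M}) (l : nat) : Prop :=
  chain_height (@pred_proper M)
    [set N | base_submodule N /\ {subset N <= V}] l.

Variables (r : nat) (MM : {ffun 'I_r -> int} -> {pred M}).

Definition hilbert_poly (P : {mpoly rat[r]}) : Prop :=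
  exists c : int, forall nu : {ffun 'I_r -> int}, (forall i, c <= nu i) ->
    exists2 l, base_length (MM nu) l &
      P.@[fun i => (nu i)%:~R] = l%:R.

(* binomial(X_i + k, k) = (X_i + 1) ... (X_i + k) / k! *)
Definition binomX (i : 'I_r) (k : nat) : {mpoly rat[r]} :=
  (k`!%:R : rat)^-1 *: \prod_(j < k) ('X_i + (j.+1)%:R).

(* e(n; M) = e, for any n in N^r: e is the coefficient c n of P_M in the      *)
(* basis of products of binomials.                                            *)
Definition mixed_multiplicity (n : 'X_{1..r}) (e : rat) : Prop :=
  exists (P : {mpoly rat[r]}) (s : seq 'X_{1..r}) (c : 'X_{1..r} -> rat),
    [/\ hilbert_poly P, uniq s, forall k, k \notin s -> c k = 0,
        P = \sum_(k <- s) c k *: \prod_(i < r) binomX i (k i) & e = c n].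

(* e(M^gr) = e. The numerator is Q(t) = t^(-k) q(t), and the identity         *)
(* (1 - t)^d * sum_n length([M^gr]_n) t^n = Q(t) of Laurent series is read    *)
(* off coefficientwise at t^(m - k).  B^gr has the same underlying ring as B  *)
(* and M^gr the same underlying module as M, so dim M^gr is krull_dim M.      *)
Definition total_multiplicity (e : int) : Prop :=
  exists (d : nat) (h : int -> nat) (k : nat) (q : {poly int}),
    [/\ krull_dim M d,
        forall n, base_length (total_component MM n) (h n),
        forall n, n < - k%:Z -> h n = 0%N,
        forall m : nat,
          \sum_(i < d.+1) ((1 - 'X) ^+ d : {poly int})`_i *
             (h (m%:Z - k%:Z - i%:Z))%:Z = q`_m &
        e = q.[1]].

End Multiplicities.

(* Main.v *)
Require Import Defs.
From HB Require Import structures.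
From mathcomp Require Import all_boot all_order all_algebra.
From mathcomp Require Import boolp classical_sets mpoly.
From mathcomp Require Import zify.

Set Implicit Arguments.
Unset Strict Implicit.
Unset Printing Implicit Defensive.

Import Order.TTheory GRing.Theory Num.Theory.

Local Open Scope ring_scope.
Local Open Scope classical_set_scope.

(** Everything takes place among the submodules N of the fixed module M. Write
    h_N(nu) for the length of (M/N)_nu; for x homogeneous of degree delta,
    h_N(nu) = h_{N+xM}(nu) + h_{(N:x)}(nu - delta).

    If some t-fold differences of h_N do not vanish eventually, enlarge N to a
    maximal graded submodule with this property. By additivity a homogeneous x
    either kills M/N or acts injectively on it, so the annihilator P of M/N is
    a graded prime, and it does not contain the irrelevant ideal. For x of
    degree e_i outside P, h_{N+xM} is the i-th difference of h_N, and induction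
    on t gives a chain of t+1 primes in Supp_++. Hence all (d_++ + 1)-fold
    differences of h_0 vanish eventually. By Newton interpolation P_M exists,
    has degree at most d_++, and e(n; M) is the eventual value of the n-th
    difference of h_0.

    If z has degree e_i and is filter-regular on M/N, then (N : z)/N is torsion
    for the irrelevant ideal, so h_{N+zM} is eventually the i-th difference of
    h_N. Therefore e(n; M) is the eventual value c of the Hilbert function of E.

    As E has no torsion, its Hilbert function is bounded, and the length of the
    part of E of total degree n is c binom(n+r-1, r-1) + O(n^(r-2)). This length
    is also a polynomial for large n, so its (r-1)-st difference is eventually
    c. If c <> 0, there is a graded prime P in the support of E that does not
    contain the irrelevant ideal, and killing the coordinate directions of B/P
    one after the other gives dim E >= r. Finally dim E <= r by comparing the
    growth of B/Ann(E) with that of B/P along a chain of primes, as for the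
    Gelfand-Kirillov dimension. *)

(** * Length *)

(** Quotients are hardly ever formed: M/N is handled through N, and its lengths through [rlen N].
    Noetherian induction on submodules of one module then replaces prime filtrations; the quotient
    types of the statement return only at the end, through one surjection M -> E whose kernel T is
    the torsion closure of the submodule generated by the sequence.

    The obstacle is that e(n; M) only sees degrees large in every coordinate, whereas a total degree
    of E^gr also collects degrees near the coordinate hyperplanes, where the Hilbert function of E
    need not be c. Dividing by the torsion bounds it there: multiplication by the generators of
    degree e_i embeds E_nu in finitely many copies of E_(nu + e_i), so every degree is compared with
    one where the value is c. Only O(n^(r-2)) degrees are exceptional, too few to affect the leading
    term. Such an estimate alone does not determine differences, hence the separate argument that
    the length is eventually polynomial. The exponent r - 1 is the order of growth of the number of
    monomials of degree n in r variables. *)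

Section Length.
Variables (A : comNzRingType) (B : comAlgType A).

(* [bsub]: submodules over the base ring A; [msub] and [gsub] below are the
   B-submodules and the graded B-submodules. *)
Definition bsub (M : lmodType B) (U : set M) : Prop :=
  U 0 /\ forall (a : A) u v, U u -> U v -> U ((a%:A : B) *: u + v).

Definition blen (M : lmodType B) (U : set M) : nat -> Prop :=
  chain_height (fun X Y : set M => X `<` Y) [set X | bsub X /\ X `<=` U].

Definition fin_len (M : lmodType B) (U : set M) : Prop :=
  bsub U /\ exists n, forall l c,
    strict_chain (fun X Y : set M => X `<` Y) [set X | bsub X /\ X `<=` U] l c
    -> (l <= n)%N.

(** The value 0 also stands for infinite length, so [len] is meaningful only under [fin_len]. *)
Definition len (M : lmodType B) (U : set M) : nat := xget 0%N (blen U).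

Definition blin (M M' : lmodType B) (f : M -> M') : Prop :=
  forall b u v, f (b *: u + v) = b *: f u + f v.

Definition sumset (M : lmodType B) (U V : set M) : set M :=
  [set m | exists u v, [/\ U u, V v & m = u + v]].

Lemma blin0 (M M' : lmodType B) (f : M -> M') : blin f -> f 0 = 0.
Proof. by move=> fl; have := fl (-1) 0 0; rewrite !scaleN1r !addNr. Qed.

Lemma blinD (M M' : lmodType B) (f : M -> M') u v :
  blin f -> f (u + v) = f u + f v.
Proof. by move=> fl; have := fl 1 u v; rewrite !scale1r. Qed.

Lemma blinZ (M M' : lmodType B) (f : M -> M') b u :
  blin f -> f (b *: u) = b *: f u.
Proof. by move=> fl; have := fl b u 0; rewrite (blin0 fl) !addr0. Qed.

Lemma blinB (M M' : lmodType B) (f : M -> M') u v :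
  blin f -> f (u - v) = f u - f v.
Proof.
by move=> fl; rewrite blinD // -scaleN1r blinZ // scaleN1r.
Qed.

Lemma bsubD (M : lmodType B) (U : set M) u v : bsub U -> U u -> U v -> U (u + v).
Proof. by case=> _ UU Uu Uv; have := UU 1 u v Uu Uv; rewrite !scale1r. Qed.

Lemma bsubZ (M : lmodType B) (U : set M) (a : A) u :
  bsub U -> U u -> U ((a%:A : B) *: u).
Proof. by case=> U0 UU Uu; have := UU a u 0 Uu U0; rewrite addr0. Qed.

Lemma bsubN (M : lmodType B) (U : set M) u : bsub U -> U u -> U (- u).
Proof. by move=> /bsubZ/[apply]-/(_ (-1)); rewrite scaleNr !scale1r scaleN1r. Qed.

Lemma bsubB (M : lmodType B) (U : set M) u v : bsub U -> U u -> U v -> U (u - v).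
Proof. by move=> Us Uu Uv; apply: bsubD => //; apply: bsubN. Qed.

Lemma bsub0 (M : lmodType B) : bsub [set 0 : M].
Proof. by split=> // a u v -> ->; rewrite scaler0 addr0. Qed.

Lemma bsubT (M : lmodType B) : bsub [set: M].
Proof. by []. Qed.

Lemma bsubI (M : lmodType B) (U V : set M) : bsub U -> bsub V -> bsub (U `&` V).
Proof.
move=> [U0 UU] [V0 VV]; split=> // a u v [Uu Vu] [Uv Vv].
by split; [exact: UU | exact: VV].
Qed.

Lemma bsub_sum (M : lmodType B) (U V : set M) :
  bsub U -> bsub V -> bsub (sumset U V).
Proof.
move=> [U0 UU] [V0 VV]; split; first by exists 0, 0; rewrite addr0.
move=> a _ _ [u [v [Uu Vv ->]]] [u' [v' [Uu' Vv' ->]]].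
exists ((a%:A : B) *: u + u'), ((a%:A : B) *: v + v').
by split; [exact: UU | exact: VV | rewrite scalerDr addrACA].
Qed.

Lemma bsub_image (M M' : lmodType B) (f : M -> M') U :
  blin f -> bsub U -> bsub (f @` U).
Proof.
move=> fl [U0 UU]; split; first by exists 0 => //; exact: blin0.
by move=> a _ _ [u Uu <-] [v Uv <-]; exists (a%:A *: u + v); [exact: UU|].
Qed.

Lemma bsub_preimage (M M' : lmodType B) (f : M -> M') U :
  blin f -> bsub U -> bsub (f @^-1` U).
Proof.
move=> fl [U0 UU]; split; first by rewrite /= blin0.
by move=> a u v /= Uu Uv; rewrite fl; exact: UU.
Qed.

Lemma sumsetl (M : lmodType B) (U V : set M) : bsub V -> U `<=` sumset U V.
Proof. by move=> [V0 _] u Uu; exists u, 0; rewrite addr0. Qed.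

Lemma sumsetr (M : lmodType B) (U V : set M) : bsub U -> V `<=` sumset U V.
Proof. by move=> [U0 _] v Vv; exists 0, v; rewrite add0r. Qed.

Lemma sumset_sub (M : lmodType B) (U V W : set M) :
  bsub W -> U `<=` W -> V `<=` W -> sumset U V `<=` W.
Proof.
by move=> Ws UW VW _ [u [v [/UW Wu /VW Wv ->]]]; exact: bsubD.
Qed.

Section FiniteLength.
Variable M : lmodType B.
Implicit Types U V N : set M.

Lemma blen_uniq U k l : blen U k -> blen U l -> k = l.
Proof.
move=> [[c hc] hk] [[c' hc'] hl]; apply/eqP; rewrite eqn_leq.
by rewrite (hl _ _ hc) (hk _ _ hc').
Qed.

Lemma blenE U l : blen U l -> len U = l.
Proof. by move=> h; apply: (blen_uniq _ h); exact: (xgetI 0%N h). Qed.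

Lemma len_blen U : fin_len U -> blen U (len U).
Proof.
move=> [Us [n hn]].
pose P l := `[< exists c, strict_chain (fun X Y : set M => X `<` Y)
  [set X | bsub X /\ X `<=` U] l c >].
have P0 : exists l, P l.
  by exists 0%N; apply/asboolP; exists (fun=> U); split=> // i _; split.
have Pn l : P l -> (l <= n)%N by move=> /asboolP[c]; exact: hn.
suff h : blen U (ex_maxn P0 Pn) by rewrite (blenE h).
case: ex_maxnP => l /asboolP Pl lmax; split=> // k c hc.
by apply: lmax; apply/asboolP; exists c.
Qed.

Lemma fin_len_bsub U : fin_len U -> bsub U. Proof. by case. Qed.

Lemma len_chain U l c : fin_len U ->
  strict_chain (fun X Y : set M => X `<` Y) [set X | bsub X /\ X `<=` U] l c
  -> (l <= len U)%N.
Proof. by move=> /len_blen[_]; exact. Qed.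

Lemma fin_len_sub U V : bsub U -> U `<=` V -> fin_len V -> fin_len U.
Proof.
move=> Us UV [Vs [n hn]]; split=> //; exists n => l c [h1 h2]; apply: (hn l c).
by split=> // i /h1 [? h]; split=> //; exact: (subset_trans h UV).
Qed.

(** A longest chain below U, prolonged by V, is a chain below V. *)
Lemma len_lt U V : bsub U -> fin_len V -> U `<` V -> (len U < len V)%N.
Proof.
move=> Us Vf UV; have Uf := fin_len_sub Us (proj1 UV) Vf.
have [[c [h1 h2]] _] := len_blen Uf.
apply: (len_chain (c := fun i => if (i <= len U)%N then c i else V) Vf).
split=> i hi.
  case: ifP => [/h1 [? h]|_]; first by split=> //; exact: (subset_trans h (proj1 UV)).
  by split=> //; exact: fin_len_bsub.
move: hi; rewrite ltnS => hi; rewrite hi.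
case: ltnP => [|h]; first exact: h2.
have -> : i = len U by apply/eqP; rewrite eqn_leq hi.
have [_ h'] := h1 _ (leqnn _).
split; first exact: (subset_trans h' (proj1 UV)).
by move=> h''; apply: (proj2 UV); exact: (subset_trans h'' h').
Qed.

Lemma subset_eq_or_proper U V : U `<=` V -> U = V \/ U `<` V.
Proof.
move=> UV; have [VU|nVU] := pselect (V `<=` U); first by left; apply/seteqP.
by right.
Qed.

Lemma len_le U V : bsub U -> fin_len V -> U `<=` V -> (len U <= len V)%N.
Proof.
by move=> Us Vf /subset_eq_or_proper[->//|/(len_lt Us Vf)/ltnW].
Qed.

Lemma len_eq U V : bsub U -> fin_len V -> U `<=` V -> len V = len U -> U = V.
Proof.
by move=> Us Vf /subset_eq_or_proper[//|/(len_lt Us Vf)] + e; rewrite e ltnn.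
Qed.

Lemma fin_len0 : fin_len [set 0 : M].
Proof.
split; first exact: bsub0.
exists 0%N => -[//|l] c [h1 h2].
have [_ h] := h2 0%N isT; case: h.
have [[c00 _] _] := h1 0%N isT; have [_ c10] := h1 1%N isT.
by move=> x /c10 /= ->.
Qed.

Lemma len0 : len [set 0 : M] = 0%N.
Proof.
apply: blenE; split.
  by exists (fun=> [set 0]); split=> // i _; split=> //; exact: bsub0.
move=> [//|l] c [h1 h2].
have [_ h] := h2 0%N isT; case: h.
have [[c00 _] _] := h1 0%N isT; have [_ c10] := h1 1%N isT.
by move=> x /c10 /= ->.
Qed.

End FiniteLength.

(** * Additivity of length along a linear map *)

Section Additivity.
Variables (M M' : lmodType B) (f : M -> M').
Hypothesis fl : blin f.
Implicit Types U : set M.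

Let K : set M := [set m | f m = 0].

Lemma bsub_ker : bsub K.
Proof.
by split=> [|a u v /= fu fv]; rewrite /K /= ?blin0 // fl fu fv scaler0 addr0.
Qed.

(** A five lemma for nested submodules: a strict inclusion must be visible in the kernel or in the
    image. *)
Lemma ker_image_eq U V : bsub U -> bsub V -> U `<=` V ->
  V `&` K `<=` U -> f @` V `<=` f @` U -> V `<=` U.
Proof.
move=> Us Vs UV VK fVU v Vv.
have [u Uu fuv] : (f @` U) (f v) by apply: fVU; exists v.
have : U (v - u).
  apply: VK; split; last by rewrite /K /= blinB // fuv subrr.
  by apply: bsubB => //; exact: UV.
by move=> h; rewrite -(subrK u v); apply: bsubD.
Qed.

Lemma fin_len_ker_image U : bsub U ->
  fin_len (U `&` K) -> fin_len (f @` U) ->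
  fin_len U /\ (len U <= len (U `&` K) + len (f @` U))%N.
Proof.
move=> Us Kf If.
have H l c : strict_chain (fun X Y : set M => X `<` Y)
    [set X | bsub X /\ X `<=` U] l c ->
    (l <= len (U `&` K) + len (f @` U))%N.
  move=> [h1 h2].
  have Hf i : (i <= l)%N -> fin_len (c i `&` K) /\ fin_len (f @` c i).
    move=> /h1[cs cU]; split.
      by apply: fin_len_sub Kf; [exact: bsubI bsub_ker | exact: setSI].
    by apply: fin_len_sub If; [exact: bsub_image | exact: image_subset].
  (* Each strict step of the chain raises at least one of the two lengths, by [ker_image_eq]. *)
  have Hi i : (i <= l)%N -> (i <= len (c i `&` K) + len (f @` c i))%N.
    elim: i => // i IH hi; have := IH (ltnW hi); have [cc ncc] := h2 _ hi.
    have [Hk Hm] := Hf _ hi; have [Hk' Hm'] := Hf _ (ltnW hi).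
    have [cs cU] := h1 _ hi; have [cs' cU'] := h1 _ (ltnW hi).
    have h3 : (len (c i `&` K) <= len (c i.+1 `&` K))%N.
      by apply: len_le => //; [exact: fin_len_bsub | exact: setSI].
    have h4 : (len (f @` c i) <= len (f @` c i.+1))%N.
      by apply: len_le => //; [exact: fin_len_bsub | exact: image_subset].
    have [e1|ne1] := pselect (c i `&` K = c i.+1 `&` K); last first.
      have : (len (c i `&` K) < len (c i.+1 `&` K))%N.
        apply: len_lt => //; first exact: fin_len_bsub.
        have hK : c i `&` K `<=` c i.+1 `&` K by exact: setSI.
        by case: (subset_eq_or_proper hK).
      lia.
    have [e2|ne2] := pselect (f @` c i = f @` c i.+1); last first.
      have : (len (f @` c i) < len (f @` c i.+1))%N.
        apply: len_lt => //; first exact: fin_len_bsub.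
        have hf : f @` c i `<=` f @` c i.+1 by exact: image_subset.
        by case: (subset_eq_or_proper hf).
      lia.
    exfalso; apply: ncc; apply: (ker_image_eq cs' cs cc).
      by rewrite -e1; exact: subIsetl.
    by rewrite e2.
  apply: (leq_trans (Hi _ (leqnn l))); have [Hk Hm] := Hf _ (leqnn l).
  have [cs cU] := h1 _ (leqnn l).
  apply: leq_add.
    by apply: len_le => //; [exact: fin_len_bsub | exact: setSI].
  by apply: len_le => //; [exact: fin_len_bsub | exact: image_subset].
have Uf : fin_len U by split=> //; exists (len (U `&` K) + len (f @` U))%N.
by split=> //; have [[c hc] _] := len_blen Uf; exact: H hc.
Qed.

Lemma fin_len_image U : fin_len U -> fin_len (f @` U).
Proof.
move=> [Us [n hn]]; split; first exact: bsub_image.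
exists n => l c [h1 h2]; apply: (hn l (fun i => U `&` f @^-1` c i)).
split=> i hi.
  have [cs cU] := h1 _ hi; split; last exact: subIsetl.
  by apply: bsubI => //; exact: bsub_preimage.
have [cc ncc] := h2 _ hi; split; first by apply: setIS; exact: preimage_subset.
move=> h; apply: ncc => y cy; have [_ cU] := h1 _ hi.
by have [x Ux xy] := cU _ cy; rewrite -xy in cy *; case: (h x).
Qed.

(** The missing inequality: the preimages in U of a longest chain of the image start above the
    kernel part, and each strict step adds at least 1 to the length. *)
Lemma len_ker_image U : fin_len U -> len U = (len (U `&` K) + len (f @` U))%N.
Proof.
move=> Uf; have Us := fin_len_bsub Uf; have If := fin_len_image Uf.
have Kf : fin_len (U `&` K).
  by apply: fin_len_sub Uf; [exact: bsubI bsub_ker | exact: subIsetl].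
apply/eqP; rewrite eqn_leq (fin_len_ker_image Us Kf If).2 /=.
have [[c [h1 h2]] _] := len_blen If.
suff H j : (j <= len (f @` U))%N ->
    (len (U `&` K) + j <= len (U `&` f @^-1` c j))%N.
  apply: leq_trans (H _ (leqnn _)) _.
  apply: len_le => //.
  apply: bsubI => //; apply: bsub_preimage => //.
  by have [] := h1 _ (leqnn _).
have Cf i : (i <= len (f @` U))%N -> fin_len (U `&` f @^-1` c i).
  move=> /h1[cs _]; apply: fin_len_sub Uf; last exact: subIsetl.
  by apply: bsubI => //; exact: bsub_preimage.
elim: j => [|j IH] hj.
  rewrite addn0; apply: len_le; [exact: fin_len_bsub | exact: Cf|].
  by apply: setIS => m /= ->; case: (h1 _ hj) => -[].
rewrite addnS; apply: leq_ltn_trans (IH (ltnW hj)) _.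
apply: len_lt; [exact: fin_len_bsub (Cf _ (ltnW hj)) | exact: Cf|].
have [cc ncc] := h2 _ hj; split; first by apply: setIS; exact: preimage_subset.
move=> h; apply: ncc => y cy; have [_ cU] := h1 _ hj.
by have [x Ux xy] := cU _ cy; rewrite -xy in cy *; case: (h x).
Qed.

Lemma len_inj_image U : fin_len U -> (forall u, U u -> f u = 0 -> u = 0) ->
  len (f @` U) = len U.
Proof.
move=> Uf inj; rewrite (len_ker_image Uf).
suff -> : U `&` K = [set 0] by rewrite len0.
apply/seteqP; split=> [u [Uu /(inj _ Uu)]//|_ ->].
by split; [case: (fin_len_bsub Uf) | exact: blin0].
Qed.

Lemma fin_len_inj U : bsub U -> fin_len (f @` U) ->
  (forall u, U u -> f u = 0 -> u = 0) -> fin_len U.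
Proof.
move=> Us If inj; apply: (fin_len_ker_image Us _ If).1.
suff -> : U `&` K = [set 0] by exact: fin_len0.
apply/seteqP; split=> [u [Uu /(inj _ Uu)]//|_ ->].
by split; [case: Us | exact: blin0].
Qed.

End Additivity.

(** * Sums, intersections and lengths modulo a submodule *)

Section Sums.
Variable M : lmodType B.
Implicit Types U V N : set M.

Lemma fin_len_prod U V : fin_len U -> fin_len V ->
  fin_len ([set p | U p.1 /\ V p.2] : set (M * M)%type) /\
  len ([set p | U p.1 /\ V p.2] : set (M * M)%type) = (len U + len V)%N.
Proof.
move=> Uf Vf; have [U0 UU] := fin_len_bsub Uf; have [V0 VV] := fin_len_bsub Vf.
set W := [set p | _].
have Ws : bsub W.
  by split=> //= a [u v] [u' v'] /= [? ?] [? ?]; split; [exact: UU | exact: VV].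
have l1 : blin (fst : (M * M)%type -> M) by [].
have l2 : blin (snd : (M * M)%type -> M) by [].
set W0 := W `&` [set p | p.2 = 0].
have W0s : bsub W0 by apply: bsubI => //; exact: bsub_ker l2.
have e1 : fst @` W0 = U.
  apply/seteqP; split=> [_ [p [[? _] _] <-//]|u Uu].
  by exists (u, 0).
have e2 : snd @` W = V.
  apply/seteqP; split=> [_ [p [? ?] <-//]|v Vv].
  by exists (0, v).
have W0f : fin_len W0.
  apply: (fin_len_inj l1) => //; first by rewrite e1.
  by move=> [u v] [_ /= ->] /= ->.
have Wf : fin_len W.
  by apply: (fin_len_ker_image l2 Ws W0f _).1; rewrite e2.
split=> //; rewrite (len_ker_image l2 Wf) e2; congr addn.
rewrite -(len_inj_image l1 W0f) ?e1 //.
by move=> [u v] [_ /= ->] /= ->.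
Qed.

Let subp : (M * M)%type -> M := fun p => p.1 - p.2.

Let subp_lin : blin subp.
Proof.
by move=> b [u v] [u' v']; rewrite /subp /= opprD addrACA scalerBr.
Qed.

Lemma subp_image U V : bsub V ->
  subp @` [set p | U p.1 /\ V p.2] = sumset U V.
Proof.
move=> Vs; apply/seteqP; split=> [_ [[u v] [/= Uu Vv] <-]|_ [u [v [Uu Vv ->]]]].
  by exists u, (- v); split=> //; exact: bsubN.
by exists (u, - v); rewrite /subp /= ?opprK //; split=> //; exact: bsubN.
Qed.

Lemma fin_len_sum U V : fin_len U -> fin_len V -> fin_len (sumset U V).
Proof.
move=> Uf Vf; have [Wf _] := fin_len_prod Uf Vf.
rewrite -subp_image; last exact: fin_len_bsub.
exact: fin_len_image.
Qed.

(** Additivity for the difference map U x V -> U + V, whose kernel is the diagonal copy of the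
    intersection. *)
Lemma len_sum U V : fin_len U -> fin_len V ->
  (len (sumset U V) + len (U `&` V) = len U + len V)%N.
Proof.
move=> Uf Vf; have [Wf <-] := fin_len_prod Uf Vf.
have Us := fin_len_bsub Uf; have Vs := fin_len_bsub Vf.
rewrite (len_ker_image subp_lin Wf) (subp_image U Vs) addnC; congr addn.
set W := (X in _ = len X).
have l1 : blin (fst : (M * M)%type -> M) by [].
have Wf' : fin_len W.
  apply: (fin_len_sub _ _ Wf); last exact: subIsetl.
  apply: bsubI; first exact: fin_len_bsub Wf.
  exact: bsub_ker.
rewrite -(len_inj_image l1 Wf').
  congr len; apply/seteqP; split=> [m [Um Vm]|_ [[u v] [[/= Uu Vv] /subr0_eq/= uv] <-]].
    by exists (m, m) => //; split=> //; rewrite /subp /= subrr.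
  by split=> //=; rewrite uv.
by move=> [u v] [_ /subr0_eq /= <-] /= ->.
Qed.

(* For finite [len U], this is the length of (U + N)/N. *)
Definition rlen N U : nat := (len U - len (U `&` N))%N.

Lemma fin_lenI U N : bsub N -> fin_len U -> fin_len (U `&` N).
Proof.
move=> Ns Uf; apply: (fin_len_sub _ _ Uf) => //.
by apply: bsubI => //; exact: fin_len_bsub.
Qed.

Lemma rlenD N U : bsub N -> fin_len U -> (rlen N U + len (U `&` N) = len U)%N.
Proof.
move=> Ns Uf; rewrite subnK //; apply: len_le => //.
exact: fin_len_bsub (fin_lenI Ns Uf).
Qed.

(** The inclusion induces an injection (U + N)/N -> (V + N)/N; in terms of submodules of M, this is
    [len_sum] for U and the trace of N on V. *)
Lemma rlen_le N U V : bsub N -> bsub U -> fin_len V -> U `<=` V ->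
  (rlen N U <= rlen N V)%N.
Proof.
move=> Ns Us Vf UV; have Uf := fin_len_sub Us UV Vf.
have VNf := fin_lenI Ns Vf.
have := len_sum Uf VNf.
have -> : U `&` (V `&` N) = U `&` N.
  by rewrite setIA; congr (_ `&` _); apply/setIidPl.
have : (len (sumset U (V `&` N)) <= len V)%N.
  apply: len_le => //; first by apply: bsub_sum => //; exact: fin_len_bsub.
  by apply: sumset_sub => //; exact: fin_len_bsub.
have := rlenD Ns Uf; have := rlenD Ns Vf; lia.
Qed.

Lemma rlen_eq N U V : bsub N -> bsub U -> fin_len V -> U `<=` V ->
  V `<=` sumset U N -> rlen N V = rlen N U.
Proof.
move=> Ns Us Vf UV VUN; have Uf := fin_len_sub Us UV Vf.
have VNf := fin_lenI Ns Vf.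
have := len_sum Uf VNf.
have -> : U `&` (V `&` N) = U `&` N.
  by rewrite setIA; congr (_ `&` _); apply/setIidPl.
have -> : sumset U (V `&` N) = V.
  apply/seteqP; split.
    by apply: sumset_sub => //; exact: fin_len_bsub.
  move=> v Vv; have [u [n [Uu Nn e]]] := VUN _ Vv.
  exists u, n; split=> //; split=> //.
  have -> : n = v - u by rewrite e addrC addKr.
  by apply: bsubB => //; [exact: fin_len_bsub | exact: UV].
have := rlenD Ns Uf; have := rlenD Ns Vf; lia.
Qed.

(** The last hypothesis makes N split along U and V, as a homogeneous submodule does along
    components; the trace of N on U + V is then the sum of its traces. *)
Lemma rlen_direct N U V : bsub N -> fin_len U -> fin_len V ->
  U `&` V `<=` [set 0] ->
  (forall u v, U u -> V v -> N (u + v) -> N u) ->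
  rlen N (sumset U V) = (rlen N U + rlen N V)%N.
Proof.
move=> Ns Uf Vf UV0 split_N; have UVf := fin_len_sum Uf Vf.
have UNf := fin_lenI Ns Uf; have VNf := fin_lenI Ns Vf.
have [Us Vs] := (fin_len_bsub Uf, fin_len_bsub Vf).
have h1 := len_sum Uf Vf; have h2 := len_sum UNf VNf.
have e1 : U `&` V = [set 0].
  by apply/seteqP; split=> // _ ->; split; [case: Us | case: Vs].
have e2 : U `&` N `&` (V `&` N) = [set 0].
  apply/seteqP; split=> [m [[? _] [? _]]|_ ->]; first exact: UV0.
  by case: Us => U0 _; case: Vs => V0 _; case: Ns => N0 _.
have e3 : sumset (U `&` N) (V `&` N) = sumset U V `&` N.
  apply/seteqP; split=> [_ [u [v [[Uu Nu] [Vv Nv] ->]]]|_ [[u [v [Uu Vv ->]]] Nuv]].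
    by split; [exists u, v | exact: bsubD].
  have Nu := split_N _ _ Uu Vv Nuv.
  exists u, v; split=> //; split=> //.
  have -> : v = (u + v) - u by rewrite addrC addKr.
  exact: bsubB.
have := rlenD Ns Uf; have := rlenD Ns Vf; have := rlenD Ns UVf.
rewrite -e3; rewrite e2 len0 in h2; rewrite e1 len0 in h1; lia.
Qed.

Lemma rlen_trans N N' U : bsub N -> bsub N' -> fin_len U -> N `<=` N' ->
  rlen N U = (rlen N' U + rlen N (U `&` N'))%N.
Proof.
move=> Ns Ns' Uf NN'; have UNf := fin_lenI Ns' Uf.
have := rlenD Ns Uf; have := rlenD Ns' Uf; have := rlenD Ns UNf.
by rewrite -setIA (setIidr NN'); lia.
Qed.

Lemma rlen_eq0 N U : bsub N -> fin_len U -> rlen N U = 0%N <-> U `<=` N.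
Proof.
move=> Ns Uf; have h := rlenD Ns Uf; split=> [h0|UN].
  have : U `&` N = U.
    apply: len_eq => //; first exact: fin_len_bsub (fin_lenI Ns Uf).
    by rewrite -h h0.
  by move/setIidPl.
by move: h; rewrite (setIidl UN); lia.
Qed.

End Sums.

(** Additivity is applied to U and to the part of U lying over N; both have the same kernel, which
    cancels. *)
Lemma rlen_image (M M' : lmodType B) (f : M -> M') (N : set M') (U : set M) :
  blin f -> bsub N -> fin_len U -> rlen N (f @` U) = rlen (f @^-1` N) U.
Proof.
move=> fl Ns Uf; have Us := fin_len_bsub Uf.
have Ns' := bsub_preimage fl Ns.
have If := fin_len_image fl Uf.
have Uf' := fin_lenI Ns' Uf.
have h1 := len_ker_image fl Uf; have h2 := len_ker_image fl Uf'.
have e1 : f @` (U `&` f @^-1` N) = f @` U `&` N.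
  apply/seteqP; split=> [_ [u [Uu Nu] <-]|_ [[u Uu <-] Nu]]; last by exists u.
  by split=> //; exists u.
have e2 : U `&` f @^-1` N `&` [set m | f m = 0] = U `&` [set m | f m = 0].
  apply/seteqP; split=> [m [[? ?] ?]//|m [? /= e]].
  by split=> //; split=> //=; rewrite e; case: Ns.
rewrite e1 e2 in h2; have := rlenD Ns If; have := rlenD Ns' Uf; lia.
Qed.

End Length.

(** * Chain conditions *)

Lemma dependent_choice T (F : set T) (R : T -> T -> Prop) x0 : F x0 ->
  (forall x, F x -> exists y, F y /\ R x y) ->
  exists c : nat -> T, forall i, F (c i) /\ R (c i) (c i.+1).
Proof.
move=> Fx0 step.
have [|g hg] := @choice {x | F x} {x | F x} (fun x y => R (sval x) (sval y)).
  by move=> [x Fx]; have [y [Fy Rxy]] := step x Fx; exists (exist _ y Fy).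
exists (fun i => sval (iter i g (exist _ x0 Fx0))) => i.
by split; [case: (iter i g _) | rewrite iterS; exact: hg].
Qed.

Section Artinian.
Variables (A : comNzRingType) (B : comAlgType A).

Definition line (M : lmodType B) (m : M) : set M :=
  [set u | exists a : A, u = (a%:A : B) *: m].

Lemma bsub_line (M : lmodType B) (m : M) : bsub (line m).
Proof.
split; first by exists 0; rewrite !scale0r.
move=> a _ _ [b ->] [c ->]; exists (a * b + c).
by rewrite scalerA -scalerDl -scalerAl mul1r scalerA -scalerDl.
Qed.

Lemma blin_scale (M : lmodType B) (b : B) : blin ( *:%R b : M -> M).
Proof. by move=> c u v; rewrite scalerDr !scalerA mulrC. Qed.

Lemma blin_act (M : lmodType B) (m : M) :
  blin (fun b : (B^o : lmodType B) => (b : B) *: m : M).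
Proof. by move=> c u v; rewrite scalerDl -scalerA. Qed.

(** Every cyclic A-submodule is an image of A 1, so finite length need only be proved for A 1. *)
Lemma line_image (M : lmodType B) (m : M) :
  (fun b : (B^o : lmodType B) => (b : B) *: m) @` line (1 : B^o) = line m.
Proof.
apply/seteqP; split=> [_ [_ [a ->] <-]|_ [a ->]].
  by exists a; rewrite -[_ *: (1 : B^o)]/(_ * _) mulr1.
by exists (a%:A : B) => //; exists a; rewrite -[_ *: (1 : B^o)]/(_ * _) mulr1.
Qed.

Hypothesis hA : artinian_ring A.
Let V : set (B^o : lmodType B) := line (1 : B^o).

Lemma line1E (a : A) : V (a%:A : B).
Proof. by exists a; rewrite -[_ *: (1 : B^o)]/(_ * _) mulr1. Qed.

(** Pulled back along a |-> a 1, the chain becomes a descending chain of ideals of A. *)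
Lemma dcc_line1 (J : nat -> set (B^o : lmodType B)) :
  (forall k, bsub (J k)) -> (forall k, J k `<=` V) ->
  (forall k, J k.+1 `<=` J k) ->
  exists k, forall l, (k <= l)%N -> J k `<=` J l.
Proof.
move=> Js JV Jdec.
have [||k hk] := hA (J := fun k : nat => (fun a : A^o => `[< J k (a%:A : B) >])).
- move=> k; have [J0 JJ] := Js k; split; first by apply/asboolP; rewrite scale0r.
  move=> a u v /asboolP Ju /asboolP Jv; apply/asboolP.
  suff -> : ((a : A) * u + v)%:A = (a%:A : B) * u%:A + v%:A :> B by exact: JJ.
  by rewrite scalerDl -scalerAl mul1r scalerA.
- by move=> k a /asboolP h; apply/asboolP; exact: Jdec.
exists k => l kl b Jb; have [a e] := JV _ _ Jb.
rewrite -[_ *: (_ : B^o)]/(_ * _) mulr1 in e; rewrite {}e in Jb *.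
apply/asboolP; have := hk l kl a; rewrite -!topredE /= => ->.
exact/asboolP.
Qed.

Lemma minimal_line1 (F : set (set (B^o : lmodType B))) X0 :
  (forall X, F X -> bsub X /\ X `<=` V) -> F X0 ->
  exists X, F X /\ forall Y, F Y -> Y `<=` X -> X `<=` Y.
Proof.
move=> FV FX0; apply: contrapT => nmin.
have [X FX|c hc] := dependent_choice (R := fun X Y => Y `<` X) FX0.
  apply: contrapT => nY; apply: nmin; exists X; split=> // Y FY YX.
  by apply: contrapT => nXY; apply: nY; exists Y.
have [k|k|k|k hk] := @dcc_line1 c.
- by have [/FV[]] := hc k.
- by have [/FV[]] := hc k.
- by have [_ []] := hc k.
by have [_ [_]] := hc k; apply; exact: hk.
Qed.

(* Let J be minimal among the submodules of A that are not of finite length.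
   Every scalar acts on J as zero or invertibly, so J is a vector space whose
   proper subspaces are finite-dimensional. A subspace maximal for not
   containing a given nonzero vector is a hyperplane, a contradiction. *)
Lemma artinian_fin_len : fin_len V.
Proof.
apply: contrapT => nV.
have [|//|J [[Js JV nJ] minJ]] :=
  @minimal_line1 [set X | [/\ bsub X, X `<=` V & ~ fin_len X]] V.
- by move=> X [].
- by split=> //; exact: bsub_line.
have properJ X : bsub X -> X `<=` J -> ~ (J `<=` X) -> fin_len X.
  move=> Xs XJ; apply: contra_notP => nX; apply: minJ => //; split=> //.
  exact: subset_trans JV.
(* If a J and the kernel of a on J were both proper in J, they would have finite length by
   minimality, and so would J. *)
have dich (a : A) : J `<=` *:%R (a%:A : B) @` J \/
    forall v, J v -> (a%:A : B) *: v = 0.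
  have [|nJa] := pselect (J `<=` *:%R (a%:A : B) @` J); first by left.
  right; have fl := @blin_scale B^o (a%:A : B).
  have If : fin_len ( *:%R (a%:A : B) @` J).
    apply: properJ => //; first exact: bsub_image.
    by move=> _ [v Jv <-]; exact: bsubZ.
  have Ks : bsub (J `&` [set v | (a%:A : B) *: v = 0]).
    by apply: bsubI => //; exact: (bsub_ker fl).
  have [JK v Jv|nJK] := pselect (J `<=` J `&` [set v | (a%:A : B) *: v = 0]).
    by have [] := JK v Jv.
  have Kf := properJ _ Ks (@subIsetl _ _ _) nJK.
  by case: nJ; exact: (fin_len_ker_image fl Js Kf If).1.
(* The powers a^k A 1 stabilize, so a^k = a^(k+1) c in B for some c; as J = a^k J, this c inverts a
   on J. *)
have unit (a : A) : (forall v, J v -> (a%:A : B) *: v = 0) \/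
    exists b : A, forall v, J v -> (a%:A : B) *: ((b%:A : B) *: v) = v.
  have [Ja|] := dich a; last by left.
  right; have powJ k v : J v -> exists2 w, J w & v = ((a ^+ k)%:A : B) *: w.
    elim: k v => [|k IH] v Jv; first by exists v; rewrite // expr0 !scale1r.
    have [w Jw ->] := IH v Jv; have [w' Jw' <-] := Ja w Jw.
    by exists w' => //; rewrite scalerA -scalerAl mul1r scalerA -exprSr.
  have [k|k|k|k /(_ k.+1 (leqnSn k)) hk] :=
      @dcc_line1 (fun k => *:%R ((a ^+ k)%:A : B) @` V).
  - by apply: bsub_image; [exact: blin_scale | exact: bsub_line].
  - by move=> _ [v Vv <-]; apply: bsubZ => //; exact: bsub_line.
  - move=> _ [_ [c ->] <-]; exists ((a * c)%:A : B); first exact: line1E.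
    rewrite -![_ *: (_ : B^o)]/(_ * _) mulr1.
    by rewrite -!scalerAl !mul1r !scalerA exprS mulrA [a ^+ k * a]mulrC.
  have [|_ [c ->] e] := hk (((a ^+ k)%:A : B)).
    exists 1; last by rewrite -![_ *: (_ : B^o)]/(_ * _) mulr1.
    by exists 1; rewrite -![_ *: (_ : B^o)]/(_ * _) mulr1 scale1r.
  rewrite -![_ *: (_ : B^o)]/(_ * _) mulr1 in e.
  exists c => v /(powJ k)[w Jw ->].
  have hm x y : (x * y)%:A = x%:A * y%:A :> B.
    by rewrite -scalerAl mul1r scalerA.
  rewrite !scalerA; congr (_ *: _).
  by rewrite -[RHS]e exprS hm mulrAC.
have [v0 [Jv0 v00]] : exists v, J v /\ v <> 0.
  apply: contrapT => h; apply: nJ.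
  suff -> : J = [set 0] by exact: fin_len0.
  apply/seteqP; split=> [v Jv|_ ->]; last by case: Js.
  by apply: contrapT => v0; apply: h; exists v.
pose P X := X = set0 \/ [/\ bsub X, X `<=` J & ~ X v0].
have [|H [PH maxH]] := @Zorn_bigcup _ P.
  move=> F FP Ftot.
  have [[X [FX X0]]|nX] := pselect (exists X, F X /\ X !=set0); last first.
    left; apply/seteqP; split=> // x [X FX Xx].
    by apply: nX; exists X; split=> //; exists x.
  have FP' Y : F Y -> Y !=set0 -> [/\ bsub Y, Y `<=` J & ~ Y v0].
    by move=> /FP[->[]//|].
  have [[X00 _] _ _] := FP' X FX X0.
  right; split; first last.
  - move=> [Y FY Yv0]; have [//|_ _] := FP' Y FY _; first by exists v0.
    exact.
  - by move=> x [Y FY Yx]; have [|_ YJ _] := FP' Y FY _; [exists x | exact: YJ].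
  split; first by exists X.
  move=> a u v [Y FY Yu] [Z FZ Zv].
  have [|[_ YY] _ _] := FP' Y FY _; first by exists u.
  have [|[_ ZZ] _ _] := FP' Z FZ _; first by exists v.
  have [YZ|ZY] := Ftot Y Z FY FZ.
    by exists Z => //; apply: ZZ => //; exact: YZ.
  by exists Y => //; apply: YY => //; exact: ZY.
have {PH} [Hs HJ Hv0] : [/\ bsub H, H `<=` J & ~ H v0].
  case: PH => // H0; exfalso; apply: (maxH [set 0]).
    by rewrite H0; split=> // /(_ 0 erefl).
  right; split; [exact: bsub0 | by move=> _ ->; case: Js | exact: v00].
have Hf : fin_len H by apply: properJ => // /(_ _ Jv0).
(* Scalars act on J as 0 or invertibly, so a nonzero submodule of A v0 contains v0. *)
have Lf : fin_len (line v0).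
  split; first exact: bsub_line.
  exists 1%N => -[|[|l]] // c [h1 h2].
  have [[[c00 _] _] [[_ _] c1L]] := (h1 0%N isT, h1 1%N isT).
  have [_ c2L] := h1 2%N isT.
  have [_ nc01] := h2 0%N isT; have [_ nc12] := h2 1%N isT.
  exfalso; apply: nc12 => _ /c2L[a ->].
  suff h : c 1%N v0 by apply: bsubZ h; case: (h1 1%N isT).
  apply: contrapT => nc1; apply: nc01 => u cu; have [b e] := c1L u cu.
  have [kill|[b' hb']] := unit b; first by rewrite e kill.
  exfalso; apply: nc1; rewrite -(hb' _ Jv0) scalerA mulrC -scalerA -e.
  by apply: bsubZ cu; case: (h1 1%N isT).
(* J is contained in H + A v0: for u outside H, maximality puts v0 in H + A u, and the scalar of u
   there acts invertibly because v0 is not in H. *)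
apply: nJ; apply: (fin_len_sub Js _ (fin_len_sum Hf Lf)) => u Ju.
have [Hu|nHu] := pselect (H u); first exact: (sumsetl (bsub_line v0)).
have Hus := bsub_sum Hs (bsub_line u).
have : ~ P (sumset H (line u)).
  apply: maxH; split; first exact: sumsetl (bsub_line u).
  move=> h; apply: nHu; apply: h; apply: (sumsetr Hs).
  by exists 1; rewrite !scale1r.
move=> nP; have : sumset H (line u) v0.
  apply: contrapT => nv0; apply: nP; right; split=> //.
  by apply: sumset_sub => // _ [a ->]; exact: bsubZ.
move=> [h [_ [Hh [a ->] e]]].
have [kill|[b hb]] := unit a.
  by exfalso; apply: Hv0; rewrite e kill // addr0.
exists (- ((b%:A : B) *: h)), ((b%:A : B) *: v0); split.
- by apply: bsubN => //; exact: bsubZ.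
- by exists b.
by rewrite e scalerDr addKr scalerA mulrC -scalerA hb.
Qed.

Lemma fin_len_line (M : lmodType B) (m : M) : fin_len (line m).
Proof.
rewrite -line_image; apply: fin_len_image; first exact: blin_act.
exact: artinian_fin_len.
Qed.

End Artinian.

(** * Hilbert's basis theorem and maximal submodules *)

Section Noetherian.
Variables (A : comNzRingType) (B : comAlgType A) (M : lmodType B).
Implicit Types (U V N : set M) (X : seq B).

Definition msub U : Prop := U 0 /\ forall b u v, U u -> U v -> U (b *: u + v).

(** These are the submodules over the subalgebra generated by X, described by stability under X so
    that the basis theorem can adjoin one generator at a time. *)
Definition opsub X U : Prop :=
  bsub U /\ forall x m, x \in X -> U m -> U (x *: m).

Definition acc X V : Prop := forall N : nat -> set M,
  (forall k, opsub X (N k)) -> (forall k, N k `<=` V) ->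
  (forall k, N k `<=` N k.+1) ->
  exists k, forall l, (k <= l)%N -> N l `<=` N k.

Lemma msub_bsub U : msub U -> bsub U.
Proof. by move=> [U0 UU]; split=> // a u v; exact: UU. Qed.

Lemma msubZ U b u : msub U -> U u -> U (b *: u).
Proof. by move=> [U0 UU] Uu; have := UU b u 0 Uu U0; rewrite addr0. Qed.

Lemma chain_mono (N : nat -> set M) : (forall k, N k `<=` N k.+1) ->
  forall k l, (k <= l)%N -> N k `<=` N l.
Proof.
move=> Ninc k l; elim: l => [|l IH]; first by rewrite leqn0 => /eqP ->.
rewrite leq_eqVlt => /orP[/eqP -> //|/IH h]; exact: subset_trans (Ninc l).
Qed.

Lemma acc_fin_len V : fin_len V -> acc [::] V.
Proof.
move=> Vf N Ns NV Ninc.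
pose P l := `[< exists k, len (N k) = l >].
have P0 : exists l, P l by exists (len (N 0%N)); apply/asboolP; exists 0%N.
have Nf k : fin_len (N k) := fin_len_sub (proj1 (Ns k)) (NV k) Vf.
have Pn l : P l -> (l <= len V)%N.
  by move=> /asboolP[k <-]; apply: len_le => //; case: (Ns k).
case: (ex_maxnP P0 Pn) => _ /asboolP[k <-] kmax; exists k => l kl.
have Nkl := chain_mono Ninc kl.
have [<- //|/(len_lt (fin_len_bsub (Nf k)) (Nf l))] := subset_eq_or_proper Nkl.
by rewrite ltnNge kmax //; apply/asboolP; exists l.
Qed.

Section Step.
Variables (X : seq B) (x : B) (V : set M).
Hypotheses (Vs : opsub X V) (Vacc : acc X V).

(** The sum of the x^j V for j < k, that is, the polynomials in x of degree below k with
    coefficients in V. *)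
Fixpoint powsum k : set M :=
  if k is k'.+1 then sumset (powsum k') ( *:%R (x ^+ k') @` V) else [set 0].

Lemma bsub_pow k : bsub ( *:%R (x ^+ k) @` V).
Proof. by apply: bsub_image; [exact: blin_scale | case: Vs]. Qed.

Lemma powsum_opsub k : opsub X (powsum k).
Proof.
elim: k => [|k [IHs IHX]].
  by split; [exact: bsub0 | move=> y m _ ->; rewrite /= scaler0].
split; first by apply: bsub_sum => //; exact: bsub_pow.
move=> y _ yX [u [_ [Fu [v Vv <-] ->]]].
exists (y *: u), (x ^+ k *: (y *: v)); split; first exact: IHX.
  by exists (y *: v) => //; exact: (proj2 Vs).
by rewrite scalerDr !scalerA [y * _]mulrC.
Qed.

Lemma powsum_mono k l : (k <= l)%N -> powsum k `<=` powsum l.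
Proof. by apply: chain_mono => {k l} k; exact: sumsetl (bsub_pow k). Qed.

Lemma powsum_mul k m : powsum k m -> powsum k.+1 (x *: m).
Proof.
elim: k m => [m ->|k IH _ [u [_ [Fu [v Vv <-] ->]]]].
  by rewrite scaler0; case: (powsum_opsub 1) => -[].
exists (x *: u), (x ^+ k.+1 *: v); split; [exact: IH | by exists v|].
by rewrite scalerDr scalerA exprS.
Qed.

Let V' : set M := [set m | exists k, powsum k m].

(* The leading coefficients of the elements of N of degree at most k in x. *)
Let lead N k : set M :=
  [set v | V v /\ exists2 w, powsum k w & N (x ^+ k *: v + w)].

Lemma lead_opsub N k : opsub (x :: X) N -> opsub X (lead N k).
Proof.
move=> [Ns NX]; have [Fs FX] := powsum_opsub k; have [Vb VX] := Vs.
split; [split|].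
- by split; [case: Vb | exists 0; [case: Fs | rewrite scaler0 addr0; case: Ns]].
- move=> a u v [Vu [w Fw Nu]] [Vv [w' Fw' Nv]].
  split; first by apply: (proj2 Vb).
  exists ((a%:A : B) *: w + w'); first exact: (proj2 Fs).
  have -> : x ^+ k *: (a%:A *: u + v) + (a%:A *: w + w') =
      (a%:A : B) *: (x ^+ k *: u + w) + (x ^+ k *: v + w').
    by rewrite !scalerDr !scalerA [x ^+ k * _]mulrC addrACA.
  exact: (proj2 Ns).
move=> y v yX [Vv [w Fw Nv]]; split; first exact: VX.
exists (y *: w); first exact: FX.
have -> : x ^+ k *: (y *: v) + y *: w = y *: (x ^+ k *: v + w).
  by rewrite scalerDr !scalerA mulrC.
by apply: NX => //; rewrite inE yX orbT.
Qed.

Lemma lead_inc N k : opsub (x :: X) N -> lead N k `<=` lead N k.+1.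
Proof.
move=> [Ns NX] v [Vv [w Fw Nv]]; split=> //.
exists (x *: w); first exact: powsum_mul.
have -> : x ^+ k.+1 *: v + x *: w = x *: (x ^+ k *: v + w).
  by rewrite scalerDr scalerA exprS.
by apply: NX => //; rewrite inE eqxx.
Qed.

Lemma lead_mono N N' k : N `<=` N' -> lead N k `<=` lead N' k.
Proof. by move=> NN' v [Vv [w Fw /NN' Nv]]; split=> //; exists w. Qed.

Lemma opsub_step : opsub (x :: X) V'.
Proof.
split; [split|].
- by exists 0%N.
- move=> a u v [k Fu] [l Fv]; exists (maxn k l).
  apply: (proj2 (proj1 (powsum_opsub (maxn k l)))).
    exact: (powsum_mono (leq_maxl k l)).
  exact: (powsum_mono (leq_maxr k l)).
move=> y m; rewrite inE => /orP[/eqP ->|yX] [k Fm].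
  by exists k.+1; exact: powsum_mul.
by exists k; apply: (proj2 (powsum_opsub k)).
Qed.

Lemma sub_step : V `<=` V'.
Proof.
move=> v Vv; exists 1%N; exists 0, v; rewrite add0r; split=> //.
by exists v; rewrite // expr0 scale1r.
Qed.

(* Hilbert's basis theorem for R[x]V, where V is a Noetherian R-module. *)
Lemma acc_step : acc (x :: X) V'.
Proof.
move=> N Ns NV Ninc.
have leadV i k : lead (N i) k `<=` V by move=> v [].
have leadi i j k : (i <= j)%N -> lead (N i) k `<=` lead (N j) k.
  by move=> ij; apply: lead_mono; exact: chain_mono ij.
have leadk i k l : (k <= l)%N -> lead (N i) k `<=` lead (N i) l.
  by apply: chain_mono => {k l} k; exact: lead_inc.
(* The diagonal takes care of all k >= p at once; the finitely many rows k < p are stabilized one by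
   one in [hfin]. *)
have [|||p hp] := Vacc (N := fun i => lead (N i) i).
- by move=> k; exact: lead_opsub.
- by move=> k; exact: leadV.
- by move=> k; apply: subset_trans (leadi k k.+1 _ _) _; [|exact: leadk].
have hfin q : exists I, forall i k, (I <= i)%N -> (k < q)%N ->
    lead (N i) k `<=` lead (N I) k.
  elim: q => [|q [I hI]]; first by exists 0%N.
  have [|||j hj] := Vacc (N := fun i => lead (N i) q).
  - by move=> k; exact: lead_opsub.
  - by move=> k; exact: leadV.
  - by move=> k; exact: leadi.
  exists (maxn I j) => i k; rewrite geq_max => /andP[Ii ji].
  rewrite ltnS leq_eqVlt => /orP[/eqP ->|kq].
    by apply: subset_trans (hj i ji) (leadi _ _ _ _); exact: leq_maxr.
  by apply: subset_trans (hI i k Ii kq) (leadi _ _ _ _); exact: leq_maxl.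
have [I hI] := hfin p.
pose I0 := maxn I p; exists I0 => i I0i.
have lead_stab k : lead (N i) k `<=` lead (N I0) k.
  have [kp|pk] := ltnP k p.
    apply: subset_trans (hI i k _ kp) (leadi _ _ _ _); rewrite ?leq_maxl //.
    by rewrite (leq_trans _ I0i) // leq_maxl.
  apply: (@subset_trans _ (lead (N (maxn i k)) (maxn i k))).
    apply: (@subset_trans _ (lead (N (maxn i k)) k)).
      by apply: leadi; exact: leq_maxl.
    by apply: leadk; exact: leq_maxr.
  have pm : (p <= maxn i k)%N by rewrite (leq_trans pk) // leq_maxr.
  apply: (subset_trans (hp _ pm)).
  apply: (@subset_trans _ (lead (N I0) p)).
    by apply: leadi; exact: leq_maxr.
  exact: leadk.
have NII := chain_mono Ninc I0i.
(* Induction on the degree in x: an element of [N I0] with the same leading coefficient is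
   subtracted. *)
have H k m : powsum k m -> N i m -> N I0 m.
  elim: k m => [m -> _|k IH m [u [_ [Fu [v Vv <-] e]]] Nm].
    by case: (Ns I0) => -[].
  have [_ [w' Fw' Nw']] : lead (N I0) k v.
    by apply: lead_stab; split=> //; exists u; rewrite // addrC -e.
  rewrite -(subrK (x ^+ k *: v + w') m); apply: bsubD => //.
    by case: (Ns I0).
  apply: IH; last by apply: bsubB => //; [case: (Ns i) | exact: NII].
  have -> : m - (x ^+ k *: v + w') = u - w' by rewrite e addrKA.
  by apply: bsubB => //; case: (powsum_opsub k).
by move=> m Nm; have [k Fm] := NV i m Nm; exact: H Fm Nm.
Qed.

End Step.

Lemma acc_exists X V : fin_len V ->
  exists V', [/\ opsub X V', acc X V' & V `<=` V'].
Proof.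
move=> Vf; elim: X => [|x X [V' [Vs Va VV']]].
  by exists V; split=> //; [split=> //; exact: fin_len_bsub | exact: acc_fin_len].
eexists; split; [exact: (opsub_step x Vs)| exact: acc_step|].
by apply: (subset_trans VV'); exact: sub_step.
Qed.

Definition gen_alg X := forall S : {pred B}, GRing.subalg_closed S ->
  {subset X <= S} -> forall b, b \in S.

(** The scalars mapping U into itself form a subalgebra, which is B as soon as it contains the
    generators. *)
Lemma opsub_msub X U : gen_alg X -> opsub X U -> msub U.
Proof.
move=> genX [Us UX]; suff UB b m : U m -> U (b *: m).
  by split; [case: Us | move=> b u v Uu Uv; apply: bsubD => //; exact: UB].
have : b \in (fun b : B => `[< forall m, U m -> U (b *: m) >]).
  apply: genX.
    split=> [|a u v /asboolP hu /asboolP hv|u v /asboolP hu /asboolP hv].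
    - by apply/asboolP => {}m; rewrite scale1r.
    - apply/asboolP => {}m Um; rewrite scalerDl -[a *: u]mulr_algl -scalerA.
      apply: bsubD => //; last exact: hv.
      by apply: bsubZ => //; exact: hu.
    - by apply/asboolP => {}m Um; rewrite -scalerA; apply: hu; exact: hv.
  by move=> x xX; apply/asboolP => {}m; exact: UX.
by move=> /asboolP; exact.
Qed.

Hypotheses (hA : artinian_ring A) (hM : fin_gen_module M).
Variable X : seq B.
Hypothesis genX : gen_alg X.

Lemma msub_acc (N : nat -> set M) : (forall k, msub (N k)) ->
  (forall k, N k `<=` N k.+1) -> exists k, forall l, (k <= l)%N -> N l `<=` N k.
Proof.
move=> Ns Ninc; have [G hG] := hM.
(* V is the A-span of the module generators; closing it under X yields all of M. *)
have [V Vf GV] : exists2 V : set M, fin_len V & forall g, g \in G -> V g.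
  elim: G {hG} => [|g G [V Vf GV]]; first by exists [set 0]; first exact: fin_len0.
  exists (sumset (line g) V); first by apply: fin_len_sum => //; exact: fin_len_line.
  move=> g'; rewrite inE => /orP[/eqP ->|/GV Vg'].
    by apply: sumsetl; [exact: fin_len_bsub | exists 1; rewrite !scale1r].
  by apply: sumsetr => //; exact: bsub_line.
have [V' [V's V'acc VV']] := acc_exists X Vf.
apply: V'acc => // k; first by case: (Ns k) => N0 NN; split;
  [exact: msub_bsub | move=> x m _; exact: msubZ].
move=> m _; have [V0 VB] := opsub_msub genX V's.
suff /asboolP : m \in (fun v : M => `[< V' v >]) by [].
have /asboolP hm := hG m; apply: hm.
  split=> [|b u v /asboolP Vu /asboolP Vv]; first exact/asboolP.
  by apply/asboolP; exact: VB.
by move=> g /GV/VV' ?; exact/asboolP.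
Qed.

Lemma maximal_msub (F : set (set M)) N0 : (forall N, F N -> msub N) -> F N0 ->
  exists N, [/\ F N, N0 `<=` N & forall N', F N' -> N `<=` N' -> N' `<=` N].
Proof.
move=> Fs FN0; apply: contrapT => nmax.
have [|X' [FX XN]|c hc] := @dependent_choice _
    [set N | F N /\ N0 `<=` N] (fun Y Z : set M => Y `<` Z) N0.
- by split.
- apply: contrapT => nY; apply: nmax; exists X'; split=> // Y FY XY.
  apply: contrapT => nYX; apply: nY; exists Y; split=> //; split=> //.
  exact: subset_trans XY.
have [k|k|k hk] := @msub_acc c.
- by have [[/Fs]] := hc k.
- by have [_ []] := hc k.
by have [_ [_]] := hc k; apply; exact: hk.
Qed.

End Noetherian.

(** * Gradings *)

Section Components.
Variables (G : eqType) (V : zmodType) (F : G -> {pred V}).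

Definition comp_spec (v : V) (p : seq G * (G -> V)) : Prop :=
  [/\ uniq p.1, forall g, p.2 g \in F g, forall g, g \notin p.1 -> p.2 g = 0
    & v = \sum_(g <- p.1) p.2 g].

Definition decomp (v : V) : seq G * (G -> V) :=
  if pselect (exists p, comp_spec v p) is left h then projT1 (cid h)
  else ([::], fun=> 0).

Definition gsupp v := (decomp v).1.
(* The component of v in degree g. *)
Definition cmp g v := (decomp v).2 g.

(** Componentwise form of [homogeneous]; [hom_homogeneous] returns to the predicate of the
    statement. *)
Definition hom (N : set V) : Prop := forall v, N v -> forall g, N (cmp g v).

Hypothesis hF : grading F.

Let F0 g : 0 \in F g. Proof. by have [/(_ g)[]] := hF. Qed.
Hint Resolve F0 : core.
Let FB g u v : u \in F g -> v \in F g -> u - v \in F g.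
Proof. by have [/(_ g)[_ h] _ _] := hF; exact: h. Qed.
Let FN g u : u \in F g -> - u \in F g.
Proof. by rewrite -(sub0r u); exact: FB. Qed.
Let FD g u v : u \in F g -> v \in F g -> u + v \in F g.
Proof. by move=> uF vF; rewrite -(opprK v); apply: FB => //; exact: FN. Qed.

Lemma decompP v : comp_spec v (decomp v).
Proof.
rewrite /decomp; case: pselect => [h|[]]; first by case: (cid h).
have [_ /(_ v)/asboolP[s [f [us sF ->]]] _] := hF.
exists (s, fun g => if g \in s then f g else 0); split=> //= [g|g /negPf -> //|].
  by case: ifP => // /sF h.
by apply: eq_big_seq => g ->.
Qed.

Lemma cmp_in g v : cmp g v \in F g.
Proof. by have [_ h _ _] := decompP v; exact: h. Qed.

Lemma cmp_notin g v : g \notin gsupp v -> cmp g v = 0.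
Proof. by have [_ _ h _] := decompP v; exact: h. Qed.

Lemma gsupp_uniq v : uniq (gsupp v).
Proof. by have [] := decompP v. Qed.

Lemma big_sub_uniq (s t : seq G) (f : G -> V) : uniq s -> uniq t ->
  {subset s <= t} -> (forall g, g \notin s -> f g = 0) ->
  \sum_(g <- t) f g = \sum_(g <- s) f g.
Proof.
move=> us ut st f0; rewrite [LHS](bigID (mem s)) /= [X in _ + X]big1 => [|g /f0//].
rewrite addr0 -big_filter; apply: perm_big; apply: uniq_perm => //.
  exact: filter_uniq.
by move=> g; rewrite mem_filter /=; case: (boolP (g \in s)) => // /st ->.
Qed.

Lemma cmp_sum t v : uniq t -> {subset gsupp v <= t} -> v = \sum_(g <- t) cmp g v.
Proof.
move=> ut st; have [us _ s0 {1}->] := decompP v.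
by rewrite (big_sub_uniq (s := (decomp v).1)).
Qed.

Lemma cmp_sum_supp v : v = \sum_(g <- gsupp v) cmp g v.
Proof. exact: cmp_sum (gsupp_uniq v) _. Qed.

Lemma cmp_uniq t (f : G -> V) v : uniq t -> (forall g, f g \in F g) ->
  (forall g, g \notin t -> f g = 0) -> v = \sum_(g <- t) f g ->
  forall g, cmp g v = f g.
Proof.
move=> ut fF f0 ev.
pose w := undup (t ++ gsupp v).
have tw : {subset t <= w} by move=> x; rewrite mem_undup mem_cat => ->.
have sw : {subset gsupp v <= w}.
  by move=> x; rewrite mem_undup mem_cat orbC => ->.
have uw : uniq w by exact: undup_uniq.
have [_ _ indep] := hF.
have h0 : \sum_(g <- w) (cmp g v - f g) = 0.
  rewrite sumrB -(cmp_sum uw sw) (big_sub_uniq (s := t)) // -ev subrr //.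
move=> g; have [gw|gw] := boolP (g \in w).
  apply: subr0_eq; apply: (indep w (fun g => cmp g v - f g)) => // h _.
  by apply: FB => //; exact: cmp_in.
move: gw; rewrite mem_undup mem_cat negb_or => /andP[gt gs].
by rewrite f0 // cmp_notin.
Qed.

Lemma cmp_id g v : v \in F g -> cmp g v = v.
Proof.
move=> vF; rewrite (@cmp_uniq [:: g] (fun h => if h == g then v else 0)) ?eqxx //.
- by move=> h; case: eqP => [->|].
- by move=> h; rewrite inE => /negPf ->.
by rewrite big_seq1 eqxx.
Qed.

Lemma cmp_neq g h v : v \in F g -> h != g -> cmp h v = 0.
Proof.
move=> vF hg.
rewrite (@cmp_uniq [:: g] (fun h => if h == g then v else 0)) ?(negPf hg) //.
- by move=> x; case: eqP => [->|].
- by move=> x; rewrite inE => /negPf ->.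
by rewrite big_seq1 eqxx.
Qed.

Lemma cmpD g u v : cmp g (u + v) = cmp g u + cmp g v.
Proof.
pose t := undup (gsupp u ++ gsupp v).
apply: (@cmp_uniq t (fun g => cmp g u + cmp g v)) => [|h|h|].
- exact: undup_uniq.
- by apply: FD; exact: cmp_in.
- rewrite mem_undup mem_cat negb_or => /andP[hu hv].
  by rewrite !cmp_notin // addr0.
rewrite big_split /= -!cmp_sum ?undup_uniq // => x; rewrite mem_undup mem_cat.
  by rewrite orbC => ->.
by move=> ->.
Qed.

Lemma cmp0 g : cmp g 0 = 0.
Proof. by apply: cmp_id. Qed.

Lemma cmpN g v : cmp g (- v) = - cmp g v.
Proof. by apply/eqP; rewrite -subr_eq0 opprK -cmpD addNr cmp0. Qed.

Lemma cmpB g u v : cmp g (u - v) = cmp g u - cmp g v.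
Proof. by rewrite cmpD cmpN. Qed.

Lemma cmp_bigsum I (s : seq I) (P : pred I) (f : I -> V) g :
  cmp g (\sum_(i <- s | P i) f i) = \sum_(i <- s | P i) cmp g (f i).
Proof. by elim/big_rec2: _ => [|i x y _ <-]; rewrite ?cmp0 ?cmpD. Qed.

Lemma cmp_ext u v : (forall g, cmp g u = cmp g v) -> u = v.
Proof.
move=> h; apply/eqP; rewrite -subr_eq0; apply/eqP.
rewrite [LHS]cmp_sum_supp big1 // => g _.
by rewrite cmpB h subrr.
Qed.

Lemma cmp_all_in (N : set V) v : N 0 -> (forall a b, N a -> N b -> N (a + b)) ->
  (forall g, N (cmp g v)) -> N v.
Proof.
move=> N0 ND Nv; rewrite [v]cmp_sum_supp.
by elim/big_ind: _.
Qed.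

Lemma hom_homogeneous (P : {pred V}) : hom [set v | v \in P] -> homogeneous F P.
Proof.
move=> hP v vP; apply/asboolP; exists (gsupp v), (cmp^~ v).
split; [exact: gsupp_uniq | | exact: cmp_sum_supp].
by move=> g _; rewrite !inE cmp_in /=; exact: hP.
Qed.

End Components.

(** Covers both degree shifts in use: multiplication by a homogeneous ring element, and b |-> b g
    for a homogeneous g of M. Injectivity of [sigma] keeps different components from merging. *)
Lemma cmp_morph (G G' : eqType) (V V' : zmodType) (F : G -> {pred V})
    (F' : G' -> {pred V'}) (sigma : G -> G') (f : V -> V') :
  grading F -> grading F' -> injective sigma ->
  {morph f : u v / u + v} -> (forall g v, v \in F g -> f v \in F' (sigma g)) ->
  (forall g v, cmp F' (sigma g) (f v) = f (cmp F g v)) /\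
  (forall g' v, (forall g, g' <> sigma g) -> cmp F' g' (f v) = 0).
Proof.
move=> hF hF' sinj fD fF.
have f0 : f 0 = 0 by apply: (addrI (f 0)); rewrite -fD !addr0.
have fv v : f v = \sum_(g <- gsupp F v) f (cmp F g v).
  rewrite {1}(cmp_sum_supp hF v).
  by elim: (gsupp F v) => [|g s IH]; rewrite ?big_nil // !big_cons fD IH.
split=> [g v|g' v ng']; rewrite {1}fv cmp_bigsum //; last first.
  rewrite big1 // => g _; apply: (cmp_neq hF' (g := sigma g)).
    by apply: fF; exact: cmp_in.
  by apply/eqP; exact: ng'.
have [gs|gs] := boolP (g \in gsupp F v).
  rewrite (bigD1_seq g) //=; last exact: gsupp_uniq.
  rewrite (cmp_id hF'); last by apply: fF; exact: cmp_in.
  rewrite big1 ?addr0 // => h hg; apply: (cmp_neq hF' (g := sigma h)).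
    by apply: fF; exact: cmp_in.
  by apply: contra hg => /eqP/sinj ->.
rewrite (cmp_notin hF gs) f0 big_seq big1 // => h hs.
apply: (cmp_neq hF' (g := sigma h)); first by apply: fF; exact: cmp_in.
by apply: contra gs => /eqP/sinj ->.
Qed.

Section DirectSums.
Variables (A : comNzRingType) (B : comAlgType A) (V : lmodType B).
Variables (G : eqType) (F : G -> {pred V}).
Hypothesis hF : grading F.

Definition dsum (S : seq G) : set V := [set v | forall g, g \notin S -> cmp F g v = 0].

Lemma dsum_cons g S : dsum (g :: S) = sumset [set v | v \in F g] (dsum S).
Proof.
apply/seteqP; split=> [v hv|_ [u [v [uF hv ->]]] h].
  exists (cmp F g v), (v - cmp F g v); split; first exact: cmp_in.
    move=> h hS; rewrite cmpB //; have [->|hg] := eqVneq h g.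
      by rewrite [cmp _ _ (cmp _ _ _)](cmp_id hF) ?subrr //; exact: cmp_in.
    rewrite (cmp_neq hF (cmp_in hF g v) hg) subr0; apply: hv.
    by rewrite inE negb_or hg.
  by rewrite addrC subrK.
rewrite inE negb_or => /andP[hg hS].
by rewrite cmpD // (cmp_neq hF uF hg) hv // addr0.
Qed.

Lemma dsum_nil : dsum [::] = [set 0].
Proof.
apply/seteqP; split=> [v hv|_ -> g _]; last exact: cmp0.
by apply: (cmp_ext hF) => g; rewrite cmp0 // hv.
Qed.

Hypothesis Ff : forall g, fin_len [set v | v \in F g].

Lemma fin_len_dsum S : fin_len (dsum S).
Proof.
elim: S => [|g S IH]; first by rewrite dsum_nil; exact: fin_len0.
by rewrite dsum_cons; exact: fin_len_sum.
Qed.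

Lemma rlen_dsum N S : bsub N -> hom F N -> uniq S ->
  rlen N (dsum S) = (\sum_(g <- S) rlen N [set v | v \in F g])%N.
Proof.
move=> Ns Nh; elim: S => [_|g S IH /= /andP[gS uS]].
  by rewrite big_nil dsum_nil /rlen len0.
rewrite big_cons dsum_cons rlen_direct ?IH //; first exact: fin_len_dsum.
  move=> v [vF hv]; apply: (cmp_ext hF) => h; rewrite cmp0 //.
  have [->|hg] := eqVneq h g; first exact: hv.
  exact: cmp_neq vF hg.
move=> u v uF hv Nuv; have := Nh _ Nuv g.
by rewrite cmpD // hv // addr0 (cmp_id hF).
Qed.

End DirectSums.

(** * Ideals, and primes of a graded ring *)

Section IdealFacts.
Variable R : comNzRingType.
Variable P : {pred R}.
Hypothesis hP : idealr_closed P.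

Lemma ideal0 : 0 \in P. Proof. by case: hP. Qed.
Lemma ideal1 : 1 \notin P. Proof. by case: hP. Qed.
Lemma idealD u v : u \in P -> v \in P -> u + v \in P.
Proof. by case: hP => _ _ h uP vP; rewrite -[u]mul1r; exact: h. Qed.
Lemma idealMr u v : u \in P -> v * u \in P.
Proof. by case: hP => P0 _ h uP; rewrite -[v * u]addr0; exact: h. Qed.
Lemma idealMl u v : u \in P -> u * v \in P.
Proof. by rewrite mulrC; exact: idealMr. Qed.
Lemma idealB u v : u \in P -> v \in P -> u - v \in P.
Proof. by move=> uP vP; rewrite -mulN1r; apply: idealD => //; exact: idealMr. Qed.

Lemma ideal_sum I (l : seq I) (Q : pred I) (f : I -> R) :
  (forall i, Q i -> f i \in P) -> \sum_(i <- l | Q i) f i \in P.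
Proof.
move=> fP; apply: (big_ind (fun b => b \in P)) => //; [exact: ideal0|].
exact: idealD.
Qed.

End IdealFacts.

Lemma seq_max d (T : orderType d) (l : seq T) x0 : x0 \in l ->
  exists2 x, x \in l & forall y, y \in l -> (y <= x)%O.
Proof.
elim: l x0 => // y l IH x0 _; case: l IH => [_|z l IH].
  by exists y; rewrite ?inE // => x; rewrite inE => /eqP ->.
have [|x xl hx] := IH z; first by rewrite inE eqxx.
have [yx|xy] := leP y x.
  exists x; first by rewrite inE xl orbT.
  by move=> w; rewrite inE => /orP[/eqP -> //|]; exact: hx.
exists y; first by rewrite inE eqxx.
move=> w; rewrite inE => /orP[/eqP -> //|/hx]; move=> /le_trans; apply; exact: ltW.
Qed.

(** The monomial order on N^r is total and compatible with addition. For b and c outside P, let mu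
    and mu' be the largest degrees whose components avoid P; modulo P, the component of b c in
    degree mu + mu' is the product of these two components. *)
Lemma graded_prime r (B : comNzRingType) (BB : 'X_{1..r} -> {pred B}) (P : {pred B}) :
  graded_ring BB -> idealr_closed P -> hom BB [set b | b \in P] ->
  (forall mu nu x y, x \in BB mu -> y \in BB nu -> x * y \in P ->
    x \in P \/ y \in P) -> prime_ideal P.
Proof.
move=> [hBg _ BBM] hP Ph prP; split=> // b c bcP; apply/orP; apply: contrapT.
move=> /orP; rewrite negb_or => /andP[bP cP].
have top a : a \notin P -> exists2 mu, cmp BB mu a \notin P &
    forall nu, cmp BB nu a \notin P -> (nu <= mu)%O.
  move=> aP; pose l := [seq mu <- gsupp BB a | cmp BB mu a \notin P].
  have lE mu : (mu \in l) = (cmp BB mu a \notin P).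
    rewrite mem_filter andb_idr // => h; apply: contraNT h => /(cmp_notin hBg) ->.
    exact: ideal0.
  have [x0 x0l] : exists x0, x0 \in l.
    apply: contrapT => nl; move/negP: aP; apply.
    rewrite (cmp_sum_supp hBg a); apply: ideal_sum => // mu _.
    by apply: contrapT => /negP h; apply: nl; exists mu; rewrite lE.
  have [mu mul hmu] := seq_max x0l.
  by exists mu; [rewrite -lE | move=> nu; rewrite -lE; exact: hmu].
have [mu muP hmu] := top b bP; have [mu' muP' hmu'] := top c cP.
(* If neither component is in P, then g <= mu and h <= mu'; having the same sum would force equality
   in both. *)
have tP g h : (g, h) <> (mu, mu') ->
    cmp BB (mu + mu')%MM (cmp BB g b * cmp BB h c) \in P.
  move=> ne; have ghF := BBM _ _ _ _ (cmp_in hBg g b) (cmp_in hBg h c).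
  have [e|ne'] := eqVneq (mu + mu')%MM (g + h)%MM; last first.
    by rewrite (cmp_neq hBg ghF ne') ideal0.
  rewrite e (cmp_id hBg ghF).
  have [gP|gP] := boolP (cmp BB g b \in P); first exact: idealMl.
  have [hP'|hP'] := boolP (cmp BB h c \in P); first exact: idealMr.
  exfalso; apply: ne; have gm := hmu _ gP; have hm := hmu' _ hP'.
  move: gm; rewrite le_eqVlt => /orP[/eqP eg|gm].
    by rewrite eg; move/eqP: e; rewrite eg eqm_add2l => /eqP ->.
  have : ((g + h)%MM < (mu + mu')%MM)%O.
    by apply: (@lt_le_trans _ _ (mu + h)%MM); rewrite ?ltmc_add2l ?lemc_add2r.
  by rewrite e ltxx.
have nb : mu \in gsupp BB b.
  by apply: contraNT muP => /(cmp_notin hBg) ->; exact: ideal0.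
have nc : mu' \in gsupp BB c.
  by apply: contraNT muP' => /(cmp_notin hBg) ->; exact: ideal0.
have : cmp BB mu b * cmp BB mu' c \in P; last first.
  move=> /(prP _ _ _ _ (cmp_in hBg _ _) (cmp_in hBg _ _)).
  by case; [exact/negP | exact/negP].
have := Ph _ bcP (mu + mu')%MM.
rewrite /= {1}(cmp_sum_supp hBg b) {1}(cmp_sum_supp hBg c).
rewrite mulr_suml (bigD1_seq mu) ?gsupp_uniq //= mulr_sumr.
rewrite (bigD1_seq mu') ?gsupp_uniq //= !cmpD // (cmp_id hBg); last first.
  by apply: BBM; exact: cmp_in.
set x := _ * _; set y := cmp _ _ _; set z := cmp _ _ _ => h.
have -> : x = (x + y + z) - (y + z) by rewrite -[x + y + z]addrA addrK.
apply: idealB => //; apply: idealD => //.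
  rewrite /y cmp_bigsum //; apply: ideal_sum => // g gne; apply: tP => -[eg].
  by rewrite eg eqxx in gne.
rewrite /z cmp_bigsum //; apply: ideal_sum => // g gne.
rewrite mulr_sumr cmp_bigsum //; apply: ideal_sum => // g' _; apply: tP => -[eg].
by rewrite eg eqxx in gne.
Qed.

(** * Differences and Newton interpolation *)

Section Differences.
Variables (r : nat) (R : zmodType).
Implicit Types (h g : {ffun 'I_r -> int} -> R) (nu delta : {ffun 'I_r -> int}).

Definition diff (i : 'I_r) h nu : R := h nu - h (nu - degZ U_(i)%MM).

(* h vanishes for nu >> 0. *)
Definition evz h : Prop := exists c : int, forall nu,
  (forall i, c <= nu i) -> h nu = 0.

Fixpoint vanish_diff s h : Prop :=
  if s is s'.+1 then forall i, vanish_diff s' (diff i h) else evz h.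

Lemma evzD h g : evz h -> evz g -> evz (fun nu => h nu + g nu).
Proof.
move=> [c hc] [c' hc']; exists (Num.max c c') => nu hnu.
by rewrite hc ?hc' ?addr0 // => i; apply: le_trans (hnu i); rewrite le_max lexx ?orbT.
Qed.

Lemma evzN h : evz h -> evz (fun nu => - h nu).
Proof. by move=> [c hc]; exists c => nu /hc ->; rewrite oppr0. Qed.

Lemma evz_shift h delta : evz h -> evz (fun nu => h (nu - delta)).
Proof.
move=> [c hc]; exists (c + (\sum_i `|delta i|)%N%:Z) => nu hnu; apply: hc => i.
rewrite !ffunE; have := hnu i; rewrite (bigD1 i) //= PoszD.
by move: (\sum_(_ < _ | _) _)%N (delta i) (nu i) => x y z; lia.
Qed.

Lemma evz_diff i h : evz h -> evz (diff i h).
Proof.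
by move=> hz; apply: evzD => //; apply: evzN; exact: evz_shift.
Qed.

Lemma evz_ext h g : h =1 g -> evz h -> evz g.
Proof. by move=> /funext ->. Qed.

Lemma diffB i h g : diff i (fun nu => h nu - g nu) =
  fun nu => diff i h nu - diff i g nu.
Proof. by apply/funext => nu; rewrite /diff !opprD !opprK addrACA. Qed.

Lemma diffD i h g : diff i (fun nu => h nu + g nu) =
  fun nu => diff i h nu + diff i g nu.
Proof. by apply/funext => nu; rewrite /diff opprD addrACA. Qed.

Lemma vanish_evz s h : evz h -> vanish_diff s h.
Proof. by elim: s h => //= s IH h hz i; apply: IH; exact: evz_diff. Qed.

Lemma vanish_add s h g : vanish_diff s h -> vanish_diff s g ->
  vanish_diff s (fun nu => h nu + g nu).
Proof.
elim: s h g => /= [h g|s IH h g hh hg i]; first exact: evzD.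
by rewrite diffD; exact: IH.
Qed.

Lemma vanish_shift s h delta : vanish_diff s h ->
  vanish_diff s (fun nu => h (nu - delta)).
Proof.
elim: s h => /= [h|s IH h vh i]; first exact: evz_shift.
have -> : diff i (fun nu => h (nu - delta)) = fun nu => diff i h (nu - delta).
  by apply/funext => nu; rewrite /diff addrAC.
exact: IH.
Qed.

Definition diffs (w : seq 'I_r) h := foldl (fun h i => diff i h) h w.

End Differences.

(** Passes from chains of sets, used in the proof, to chains of boolean predicates, used in the
    statement. *)
Lemma base_lengthE (A : comNzRingType) (B : comAlgType A) (M : lmodType B)
  (V : {pred M}) : fin_len [set m | m \in V] -> base_length V (len [set m | m \in V]).
Proof.
move=> Vf; have [[c [hc1 hc2]] hl] := len_blen Vf; split.
  exists (fun i m => `[< c i m >]); split=> i hi.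
    have [[c0 cc] cV] := hc1 _ hi; split; last by move=> m /asboolP/cV.
    split=> [|a u v /asboolP cu /asboolP cv]; apply/asboolP => //; exact: cc.
  have [h1 h2] := hc2 _ hi; split.
    by move=> m /asboolP cm; apply/asboolP; exact: h1.
  by move=> h; apply: h2 => m cm; apply/asboolP; apply: h; apply/asboolP.
move=> l N [hN1 hN2]; apply: (hl l (fun i => [set m | m \in N i])).
split=> i hi.
  have [[N0 NN] NV] := hN1 _ hi; split; last exact: NV.
  by split=> // a u v; exact: NN.
by have [h1 h2] := hN2 _ hi; split; [exact: h1 | move=> h; apply: h2 => m; exact: h].
Qed.

Section Diffs.
Variables (r : nat) (R : zmodType).
Implicit Types (f g : {ffun 'I_r -> int} -> R) (w : seq 'I_r).

Lemma diff_comm i j f : diff i (diff j f) = diff j (diff i f).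
Proof.
by apply/funext => nu; rewrite /diff !opprD !opprK addrACA [nu - _ - _]addrAC.
Qed.

Lemma diffs_cat w w' f : diffs (w ++ w') f = diffs w' (diffs w f).
Proof. exact: foldl_cat. Qed.

Lemma diffs_diff w i f : diffs w (diff i f) = diff i (diffs w f).
Proof. by elim: w f => //= j w IH f; rewrite diff_comm IH. Qed.

Lemma diffs_perm w w' f : perm_eq w w' -> diffs w f = diffs w' f.
Proof.
elim: w w' f => [|i w IH] w' f; first by rewrite perm_sym => /perm_nilP ->.
move=> h; have iw' : i \in w' by rewrite -(perm_mem h) mem_head.
move: h; case/splitPr: iw' => w1 w2.
rewrite perm_sym perm_catC cat_cons perm_cons perm_catC perm_sym => h.
by rewrite diffs_cat /= -diffs_diff -diffs_cat; apply: IH.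
Qed.

Lemma evz_diffs w f : evz f -> evz (diffs w f).
Proof. by elim: w f => //= i w IH f fz; apply: IH; exact: evz_diff. Qed.

Lemma diffsB w f g : diffs w (fun nu => f nu - g nu) =
  fun nu => diffs w f nu - diffs w g nu.
Proof. by elim: w f g => //= i w IH f g; rewrite diffB IH. Qed.

Lemma vanish_diffsP s f :
  vanish_diff s f <-> forall w, size w = s -> evz (diffs w f).
Proof.
elim: s f => [|s IH] f /=; split.
- by move=> fz w /size0nil ->.
- by move=> h; exact: (h [::]).
- by move=> h [//|i w] [sw]; have/IH := h i; exact.
by move=> h i; apply/IH => w sw; apply: (h (i :: w)); rewrite /= sw.
Qed.

Lemma diff0 i : diff i (fun _ : {ffun 'I_r -> int} => 0 : R) = fun=> 0.
Proof. by apply/funext => nu; rewrite /diff subrr. Qed.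

Lemma diffs0 w : diffs w (fun _ : {ffun 'I_r -> int} => 0 : R) = fun=> 0.
Proof. by elim: w => //= i w IH; rewrite diff0. Qed.

(** A degree above (C, ..., C) descends to that point by unit steps inside the region where all
    differences vanish; the induction is on the length of this path. *)
Lemma eventually_const f : (forall i, evz (diff i f)) -> exists a, evz (fun nu => f nu - a).
Proof.
move=> /choice[c hc]; pose C := (\sum_i `|c i|)%N.
have cC i : c i <= C%:Z.
  rewrite /C (bigD1 i) //=; move: (\sum_(_ < _ | _) _)%N (c i) => x y; lia.
exists (f [ffun=> C%:Z]); exists C%:Z => nu hnu; apply/eqP; rewrite subr_eq0; apply/eqP.
elim: {nu}(\sum_i `|nu i - C%:Z|)%N {-2}nu (erefl (\sum_i `|nu i - C%:Z|)%N) hnu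
  => [|k IH] nu e hnu.
  congr f; apply/ffunP => i; rewrite ffunE.
  have : (`|nu i - C%:Z| <= 0)%N by rewrite -e (bigD1 i) //= leq_addr.
  by move: (nu i) => x; lia.
have [i hi] : exists i, nu i != C%:Z.
  apply: contrapT => h; move: e; rewrite big1 // => i _.
  apply/eqP; rewrite absz_eq0 subr_eq0; apply/negPn/negP => hi; apply: h.
  by exists i.
have hnu' j : C%:Z <= (nu - degZ U_(i)%MM) j.
  rewrite !ffunE mnmE; have := hnu j; case: eqP => [<-|_].
    by move: hi (hnu i); move: (nu i) => x /eqP; lia.
  by rewrite subr0.
rewrite -(IH (nu - degZ U_(i)%MM)) //; last first.
  apply/eqP; rewrite -eqSS -e; apply/eqP.
  rewrite (bigD1 i) //= [RHS](bigD1 i) //= !ffunE mnmE eqxx.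
  rewrite (eq_bigr (fun j => `|nu j - C%:Z|%N)); last first.
    by move=> j /negPf ji; rewrite !ffunE mnmE eq_sym ji subr0.
  move: (\sum_(_ < _ | _) _)%N => S; have := hnu i; move: hi.
  by move: (nu i) => x /eqP; lia.
apply/eqP; rewrite -subr_eq0; apply/eqP; apply: (hc i) => j.
exact: le_trans (cC i) (hnu j).
Qed.

End Diffs.

Lemma degZD r (mu nu : 'X_{1..r}) : degZ (mu + nu)%MM = degZ mu + degZ nu.
Proof. by apply/ffunP => i; rewrite !ffunE mnmDE PoszD. Qed.

Lemma degZ0 r : degZ (0%MM : 'X_{1..r}) = 0.
Proof. by apply/ffunP => i; rewrite !ffunE mnm0E. Qed.

Lemma degZ_inj r : injective (@degZ r).
Proof.
by move=> mu nu /ffunP e; apply/mnmP => i; have := e i; rewrite !ffunE => -[].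
Qed.

Lemma total_degD r (nu nu' : {ffun 'I_r -> int}) :
  total_deg (nu + nu') = total_deg nu + total_deg nu'.
Proof. by rewrite -big_split; apply: eq_bigr => i _; rewrite ffunE. Qed.

Lemma total_degB r (nu nu' : {ffun 'I_r -> int}) :
  total_deg (nu - nu') = total_deg nu - total_deg nu'.
Proof. by rewrite -sumrB; apply: eq_bigr => i _; rewrite !ffunE. Qed.

Lemma total_degZ r (mu : 'X_{1..r}) : total_deg (degZ mu) = (mdeg mu)%:Z.
Proof.
rewrite mdegE (big_morph Posz PoszD (erefl 0%:Z)).
by apply: eq_bigr => i _; rewrite ffunE.
Qed.

Lemma mnm_subU r (mu : 'X_{1..r}) i : (0 < mu i)%N -> mu = (U_(i) + (mu - U_(i)))%MM.
Proof. by move=> hi; rewrite addmC submK // lep1mP -lt0n. Qed.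

Lemma mdeg_pos r (mu : 'X_{1..r}) : (0 < mdeg mu)%N -> exists i, (0 < mu i)%N.
Proof.
move=> h; apply/existsP; apply: contraLR h; rewrite negb_exists => /forallP h.
suff -> : mu = 0%MM by rewrite mdeg0.
by apply/mnmP => i; apply/eqP; rewrite mnm0E -leqn0 leqNgt.
Qed.

Lemma mnm_ind r (Q : 'X_{1..r} -> Prop) : Q 0%MM ->
  (forall i mu, Q mu -> Q (U_(i) + mu)%MM) -> forall mu, Q mu.
Proof.
move=> Q0 QU mu; elim: {mu}(mdeg mu) {-2}mu (erefl (mdeg mu)) => [|d IH] mu dmu.
  by move/eqP: dmu; rewrite mdeg_eq0 => /eqP ->.
have [|i /mnm_subU e] := @mdeg_pos _ mu; first by rewrite dmu.
rewrite e; apply/QU/IH; apply/eqP.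
by move/eqP: dmu; rewrite {1}e mdegD mdeg1 add1n eqSS.
Qed.

Section Newton.
Variable r : nat.
Implicit Types (f g : {ffun 'I_r -> int} -> rat) (w : seq 'I_r) (k n : 'X_{1..r}).

Definition binom_val (x : rat) (k : nat) : rat :=
  (k`!%:R)^-1 * \prod_(j < k) (x + j.+1%:R).

Definition binom_fun k (nu : {ffun 'I_r -> int}) : rat :=
  \prod_i binom_val (nu i)%:~R (k i).

(** Pascal's rule; it is why the binomials C(X + k, k) are the basis adapted to backward
    differences. *)
Lemma binom_val_diff x (k : nat) : binom_val x k.+1 - binom_val (x - 1) k.+1 = binom_val x k.
Proof.
rewrite /binom_val -mulrBr big_ord_recr /= [X in _ - X]big_ord_recl /=.
have -> : \prod_(i < k) (x - 1 + (bump 0 i).+1%:R) = \prod_(i < k) (x + i.+1%:R).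
  by apply: eq_bigr => i _; rewrite /bump /= add1n -[i.+2%:R]nat1r addrA subrK.
set p := \prod_(_ < _) _.
have -> : p * (x + k.+1%:R) - (x - 1 + 1) * p = k.+1%:R * p.
  by rewrite subrK mulrDr [p * x]mulrC [p * _]mulrC addrAC subrr add0r.
rewrite factS natrM invfM mulrA; congr (_ * p).
by rewrite -mulrA mulrCA mulVf ?mulr1 // pnatr_eq0.
Qed.

Lemma diff_binom i k : diff i (binom_fun (U_(i) + k)%MM) = binom_fun k.
Proof.
apply/funext => nu; rewrite /diff /binom_fun (bigD1 i) //=.
rewrite [X in _ - X](bigD1 i) //= [RHS](bigD1 i) //=.
rewrite mnmDE mnmE eqxx add1n !ffunE mnmE eqxx.
have E j : j != i -> binom_val ((nu - degZ U_(i)%MM) j)%:~R ((U_(i) + k)%MM j) =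
    binom_val (nu j)%:~R (k j).
  by move=> /negPf ji; rewrite mnmDE !ffunE mnmE eq_sym ji subr0.
have E' j : j != i -> binom_val (nu j)%:~R ((U_(i) + k)%MM j) =
    binom_val (nu j)%:~R (k j).
  by move=> /negPf ji; rewrite mnmDE mnmE eq_sym ji.
rewrite (eq_bigr _ E) (eq_bigr _ E') -mulrBl; congr (_ * _).
by rewrite rmorphB /= binom_val_diff.
Qed.

Lemma diff_binom0 i k : k i = 0%N -> diff i (binom_fun k) = fun=> 0.
Proof.
move=> ki; apply/funext => nu; rewrite /diff /binom_fun.
apply/eqP; rewrite subr_eq0; apply/eqP; apply: eq_bigr => j _.
have [->|/negPf ji] := eqVneq j i; first by rewrite ki /binom_val !big_ord0.
by rewrite !ffunE mnmE eq_sym ji subr0.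
Qed.

Definition content w : 'X_{1..r} := (\sum_(i <- w) U_(i))%MM.

Lemma content_cons i w : content (i :: w) = (U_(i) + content w)%MM.
Proof. by rewrite /content big_cons. Qed.

Lemma contentE w i : content w i = count_mem i w.
Proof.
elim: w => [|j w IH]; first by rewrite /content big_nil mnm0E.
by rewrite content_cons mnmDE mnmE IH.
Qed.

(** Differences are dual to the Newton basis: among the binomials of degree at most the order of the
    difference, only the one with the content of w survives. *)
Lemma diffs_binom w k : (mdeg k <= size w)%N ->
  diffs w (binom_fun k) = fun=> (k == content w)%:R.
Proof.
elim: w k => [|i w IH] k.
  rewrite leqn0 mdeg_eq0 => /eqP ->; rewrite /content big_nil eqxx /=.
  by apply/funext => nu; rewrite /binom_fun big1 // => i _;
    rewrite mnm0E /binom_val big_ord0 mulr1 invr1.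
rewrite content_cons /=; have [ki|ki] := posnP (k i).
  move=> _; rewrite diff_binom0 // diffs0; apply/funext => nu.
  case: eqP => // e; exfalso; move: ki; rewrite e mnmDE mnmE eqxx; lia.
have e := mnm_subU ki.
rewrite e mdegD mdeg1 add1n ltnS diff_binom => /IH ->.
by apply/funext => nu; rewrite eqm_add2l.
Qed.

(** Ordered like the sequence [zs] of the theorem, so that the two can be matched entry by entry. *)
Definition word k : seq 'I_r := flatten [seq nseq (k i) i | i <- enum 'I_r].

Lemma content_word k : content (word k) = k.
Proof.
apply/mnmP => i; rewrite contentE /word count_flatten -map_comp.
rewrite sumnE big_map -[RHS]addn0 (bigD1_seq i) ?enum_uniq ?mem_enum //=.
rewrite count_nseq /= eqxx mul1n big1 ?addn0 // => j /negPf ji.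
by rewrite count_nseq /= ji.
Qed.

Lemma size_word k : size (word k) = mdeg k.
Proof.
rewrite /word size_flatten /shape -map_comp sumnE big_map mdegE big_enum /=.
by apply: eq_bigr => i _; rewrite size_nseq.
Qed.

Lemma perm_word w : perm_eq w (word (content w)).
Proof.
by apply/allP => i _ /=; rewrite -!contentE content_word.
Qed.

Lemma diff_sum i I (l : seq I) (F : I -> {ffun 'I_r -> int} -> rat) :
  diff i (fun nu => \sum_(j <- l) F j nu) = fun nu => \sum_(j <- l) diff i (F j) nu.
Proof. by apply/funext => nu; rewrite /diff -sumrB. Qed.

Lemma diffs_sum w I (l : seq I) (c : I -> rat) (F : I -> {ffun 'I_r -> int} -> rat) :
  diffs w (fun nu => \sum_(j <- l) c j * F j nu) =
  fun nu => \sum_(j <- l) c j * diffs w (F j) nu.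
Proof.
elim: w F => //= i w IH F; rewrite diff_sum -IH; congr diffs.
apply/funext => nu; apply: eq_bigr => j _; by rewrite /diff mulrBr.
Qed.

Variable d : nat.
Definition mnm_upto : seq 'X_{1..r} :=
  [seq bmnm k | k : 'X_{1..r < d.+1}].

Lemma mem_mnm_upto k : (k \in mnm_upto) = (mdeg k <= d)%N.
Proof.
apply/mapP/idP => [[k' _ ->]|hk]; first by rewrite -ltnS bmdeg.
by exists (BMultinom (hk : (mdeg k < d.+1)%N)); rewrite ?mem_enum ?inE.
Qed.

Lemma mnm_upto_uniq : uniq mnm_upto.
Proof. by rewrite map_inj_uniq ?enum_uniq //; exact: val_inj. Qed.

Lemma diffs_expansion w (c : 'X_{1..r} -> rat) : (size w <= d)%N ->
  (forall k, (size w < mdeg k)%N -> c k = 0) ->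
  diffs w (fun nu => \sum_(k <- mnm_upto) c k * binom_fun k nu) =
  fun=> c (content w).
Proof.
move=> hw c0; rewrite diffs_sum; apply/funext => nu.
have hcw : content w \in mnm_upto.
  by rewrite mem_mnm_upto -size_word -(perm_size (perm_word w)).
rewrite (bigD1_seq (content w)) ?mnm_upto_uniq //=.
rewrite diffs_binom; last by rewrite -size_word -(perm_size (perm_word w)).
rewrite eqxx mulr1 big1 ?addr0 // => k /negPf kw.
have [hk|hk] := leqP (mdeg k) (size w); last by rewrite c0 ?mul0r.
by rewrite diffs_binom // kw mulr0.
Qed.

(** The coefficients of degree s are the eventual values of the differences of order s, which are
    eventually constant because those of order s + 1 vanish. Subtracting these terms makes the
    differences of order s vanish eventually, and the induction continues downwards. *)
Lemma newton s f : (s <= d.+1)%N -> vanish_diff s f ->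
  exists c : 'X_{1..r} -> rat, (forall k, (s <= mdeg k)%N -> c k = 0) /\
    evz (fun nu => f nu - \sum_(k <- mnm_upto) c k * binom_fun k nu).
Proof.
elim: s f => [|s IH] f hs vf.
  exists (fun=> 0); split=> //; apply: evz_ext vf => nu.
  by rewrite big1 ?subr0 // => k _; rewrite mul0r.
have [c0 hc0] : exists c0 : 'X_{1..r} -> rat, forall k, mdeg k = s ->
    evz (fun nu => diffs (word k) f nu - c0 k).
  have [|c0 hc0] := @choice 'X_{1..r} rat (fun k a => mdeg k = s ->
    evz (fun nu => diffs (word k) f nu - a)); last by exists c0.
  move=> k; have [ks|ks] := pselect (mdeg k = s); last by exists 0.
  have [|a ha] := @eventually_const _ _ (diffs (word k) f); last by exists a.
  move=> i; rewrite -diffs_diff -[diffs _ _]/(diffs (i :: word k) f).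
  by have/vanish_diffsP := vf; apply; rewrite /= size_word ks.
pose c1 k := if mdeg k == s then c0 k else 0.
pose g nu := f nu - \sum_(k <- mnm_upto) c1 k * binom_fun k nu.
have [||c2 [hc2 gz]] := IH g; first exact: ltnW.
  apply/vanish_diffsP => w sw; rewrite /g diffsB diffs_expansion ?sw //; last first.
    by move=> k; rewrite /c1; case: ltngtP.
  have cw : mdeg (content w) = s.
    by rewrite -size_word -(perm_size (perm_word w)).
  by rewrite (diffs_perm _ (perm_word w)) /c1 cw eqxx; exact: hc0.
exists (fun k => c1 k + c2 k); split.
  move=> k hk; rewrite hc2 ?addr0 /c1; last exact: ltnW.
  by case: ltngtP hk.
apply: evz_ext gz => nu; rewrite /g -addrA -opprD -big_split /=; congr (_ - _).
by apply: eq_bigr => k _; rewrite mulrDl.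
Qed.

Lemma meval_binomX (v : 'I_r -> rat) i (k : nat) : (binomX i k).@[v] = binom_val (v i) k.
Proof.
rewrite /binomX mevalZ rmorph_prod /=; congr (_ * _); apply: eq_bigr => j _.
by rewrite mevalD mevalXU rmorph_nat.
Qed.

End Newton.

(** * Growth of sequences *)

Section Sequences.
Implicit Types (u v : nat -> int).

Definition fdiff u (n : nat) : int := u n.+1 - u n.

Lemma fdiff_lower u j N : (forall x, 'C(x, j)%:Z <= fdiff u (N + x)%N) ->
  exists N', forall x, 'C(x, j.+1)%:Z <= u (N' + x)%N.
Proof.
move=> hu.
have h1 x : u N + 'C(x, j.+1)%:Z <= u (N + x)%N.
  elim: x => [|x IH]; first by rewrite bin0n addr0 addn0.
  by have := hu x; rewrite /fdiff addnS binS PoszD; lia.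
have h2 b y : ('C(y, j.+1) + b <= 'C(y + j + b, j.+1))%N.
  elim: b => [|b IH]; first by rewrite !addn0 leq_bin2l ?leq_addr.
  rewrite !addnS binS -addn1; apply: leq_add => //.
  by rewrite bin_gt0 -addnA addnCA leq_addr.
(* The shift by |u N| + j lets the binomial make up for a negative initial value u N. *)
exists (N + `|u N| + j)%N => x; have := h1 (x + j + `|u N|)%N; have := h2 `|u N|%N x.
have -> : (N + (x + j + `|u N|) = N + `|u N| + j + x)%N by lia.
by move: 'C(_, _) 'C(_, _) => y z; lia.
Qed.

Lemma iter_fdiffN a u n : iter a fdiff (fun n => - u n) n = - iter a fdiff u n.
Proof.
by elim: a n => //= a IH n; rewrite /fdiff !IH opprB opprK addrC.
Qed.

Lemma iter_fdiffB a u v n :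
  iter a fdiff (fun n => u n - v n) n = iter a fdiff u n - iter a fdiff v n.
Proof.
by elim: a n => //= a IH n; rewrite /fdiff !IH !opprD !opprK addrACA.
Qed.

Lemma fdiff_eventually0 a u N : (forall n, (N <= n)%N -> u n = 0) ->
  forall n, (N <= n)%N -> iter a fdiff u n = 0.
Proof.
move=> hN; elim: a => //= a IH n hn.
by rewrite /fdiff !IH ?subrr //; exact: leqW.
Qed.

(** An a-th difference at least 1 makes u grow at least like n^a / a!, while the bound says u =
    O(n^(p-1)). The factor n on the left avoids the exponent p - 1, which would be truncated for p =
    0. *)
Lemma growth_contradiction a p K N0 u : (p <= a)%N ->
  (exists N, forall n, (N <= n)%N -> 1 <= iter a fdiff u n) ->
  (forall n, (N0 <= n)%N -> (`|u n| * n <= K * n ^ p)%N) -> False.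
Proof.
move=> pa [N hN] hK.
have claim j : (j <= a)%N -> exists N, forall x,
    'C(x, j)%:Z <= iter (a - j) fdiff u (N + x)%N.
  elim: j => [|j IH] ja.
    by exists N => x; rewrite bin0 subn0; apply: hN; exact: leq_addr.
  have [N1 hN1] := IH (ltnW ja); apply: (@fdiff_lower _ _ N1) => x.
  by rewrite -[fdiff _ _]/(iter (a - j.+1).+1 fdiff u (N1 + x)) -subSn // subSS.
have [N1 hN1] := claim a (leqnn a); rewrite subnn /= in hN1.
(* From (m + 1)^a <= a! C(m + a, a) and n <= (N1 + a + 1)(m + 1), the bound yields n <= D; m is
   chosen so that n exceeds both D and N0. *)
pose D := (a`! * K * (N1 + a).+1 ^ a)%N.
pose m := (D + N0).+1; pose n := (N1 + (m + a))%N.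
have h1 : ('C(m + a, a) <= `|u n|)%N by have := hN1 (m + a)%N; rewrite -/n; lia.
have h2 : (m.+1 ^ a <= 'C(m + a, a) * a`!)%N.
  rewrite bin_ffact; elim: (a) => [|q IHq]; first by rewrite ffactn0.
  by rewrite addnS ffactnS expnS leq_mul // ltnS leq_addr.
have n0 : (0 < n)%N by rewrite /n /m; lia.
have h3 : (`|u n| * n <= K * n ^ a)%N.
  apply: leq_trans (hK n _) _; first by rewrite /n /m; lia.
  by rewrite leq_mul2l leq_pexp2l ?orbT.
have h4 : (n ^ a <= (N1 + a).+1 ^ a * m.+1 ^ a)%N.
  rewrite -expnMn; have [a0|a0] := posnP a; first by rewrite a0 !expn0.
  by rewrite leq_exp2r // /n; nia.
suff : (n <= D)%N by rewrite /n /m; lia.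
rewrite -(@leq_pmul2r (m.+1 ^ a)); last by rewrite expn_gt0.
apply: (@leq_trans ('C(m + a, a) * a`! * n)%N); first by rewrite mulnC leq_mul2r h2 orbT.
rewrite /D; move: (a`!) => F; apply: (@leq_trans (F * (`|u n| * n))%N).
  by rewrite mulnAC mulnC leq_mul2l leq_mul2r h1 !orbT.
rewrite -!mulnA leq_mul2l; apply/orP; right; apply: (leq_trans h3).
by rewrite leq_mul2l h4 orbT.
Qed.

(* Such a u is eventually a polynomial, of degree less than p by the bound. *)
Lemma fdiff_growth a p K N0 u :
  (exists N, forall n, (N <= n)%N -> iter a fdiff u n = 0) ->
  (forall n, (N0 <= n)%N -> (`|u n| * n <= K * n ^ p)%N) ->
  exists N, forall n, (N <= n)%N -> iter p fdiff u n = 0.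
Proof.
move=> + hK; elim: a => [[N hN]|a IH].
  by exists N => n; exact: fdiff_eventually0.
move=> [N hN]; have [ap|pa] := ltnP a p.
  by exists N => n hn; rewrite -(subnK ap) iterD; exact: fdiff_eventually0 hN _ hn.
(* The a-th difference is eventually constant; since p <= a, a nonzero constant contradicts the
   bound, for u or for -u according to its sign. *)
apply: IH; exists N => n hn.
have hc m : iter a fdiff u (N + m)%N = iter a fdiff u N.
  elim: m => [|m IHm]; first by rewrite addn0.
  by have := hN (N + m)%N (leq_addr _ _); rewrite /= /fdiff IHm addnS => /subr0_eq.
rewrite -(subnKC hn) hc; apply/eqP/negPn/negP => ne.
have [pos|neg] : 1 <= iter a fdiff u N \/ 1 <= - iter a fdiff u N.
- by move: (iter _ _ _ _) ne => x; lia.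
- apply: (@growth_contradiction a p K N0 u) => //; exists N => m hm.
  by rewrite -(subnKC hm) hc.
apply: (@growth_contradiction a p K N0 (fun n => - u n)) => //; last first.
  by move=> m; rewrite abszN; exact: hK.
by exists N => m hm; rewrite iter_fdiffN -(subnKC hm) hc.
Qed.

Lemma iter_fdiff_bin d j n : (j <= d)%N ->
  iter j fdiff (fun n => 'C(n + d, d)%:Z) n = 'C(n + d, d - j)%:Z.
Proof.
elim: j n => [|j IH] n hj; first by rewrite subn0.
rewrite /= /fdiff !IH ?(ltnW hj) // addSn -(subnSK hj) binS PoszD.
by rewrite addrC addKr.
Qed.

End Sequences.

(** * Backward differences and generating functions *)

Section BackwardDifference.
Implicit Types (h : int -> int) (x : int).

Definition bdiff h x : int := h x - h (x - 1).

Lemma iter_fdiff_bdiff a h q n :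
  iter a fdiff (fun n => h (n%:Z - q)) n = iter a bdiff h ((n + a)%N%:Z - q).
Proof.
elim: a n => [|a IH] n; first by rewrite addn0.
rewrite /= /fdiff !IH /bdiff !addSnnS; congr (_ - iter a bdiff h _).
lia.
Qed.

Lemma iter_bdiff_coef d h x :
  \sum_(i < d.+1) ((1 - 'X) ^+ d : {poly int})`_i * h (x - i%:Z) = iter d bdiff h x.
Proof.
elim: d x => [|d IH] x.
  by rewrite big_ord_recl big_ord0 expr0 coef1 mul1r addr0 /= subr0.
have hs : ((1 - 'X) ^+ d : {poly int})`_d.+1 = 0.
  apply: nth_default; apply: leq_trans (size_poly_exp_leq _ _) _.
  have hs1 : (size ((1 - 'X)%R : {poly int}) <= 2)%N.
    by apply: leq_trans (size_polyD _ _) _; rewrite size_polyN size_polyX size_poly1.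
  by rewrite ltnS; move: (size _) hs1 => n hn; nia.
rewrite /= /bdiff -!IH.
pose p : {poly int} := (1 - 'X) ^+ d.
have e i : ((1 - 'X) ^+ d.+1 : {poly int})`_i =
    p`_i - (if i == 0%N then 0 else p`_i.-1).
  by rewrite exprS mulrBl mul1r coefB coefXM.
rewrite (eq_bigr (fun i : 'I_d.+2 => p`_i * h (x - i%:Z) -
  (if i == 0 :> nat then 0 else p`_i.-1) * h (x - i%:Z))); last first.
  by move=> i _; rewrite e mulrBl.
rewrite sumrB; congr (_ - _).
  by rewrite big_ord_recr /= -/p hs mul0r addr0.
rewrite big_ord_recl /= mul0r add0r; apply: eq_bigr => i _.
rewrite /bump /= add0n; congr (_ * h _); lia.
Qed.

Lemma iter_bdiff_low d h x0 : (forall x, x < x0 -> h x = 0) ->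
  forall x, x < x0 -> iter d bdiff h x = 0.
Proof.
move=> h0; elim: d => //= d IH x hx; rewrite /bdiff !IH ?subrr //.
by rewrite (le_lt_trans _ hx) // gerBl.
Qed.

End BackwardDifference.

(** * Counting monomials *)

Section Counting.
Variable r : nat.

Definition mnm_deg (N : nat) : seq 'X_{1..r} := [seq mu <- mnm_upto r N | mdeg mu == N].

Lemma mem_mnm_deg N mu : (mu \in mnm_deg N) = (mdeg mu == N).
Proof. by rewrite mem_filter mem_mnm_upto; case: eqP => // ->; rewrite leqnn. Qed.

Lemma mnm_deg_uniq N : uniq (mnm_deg N).
Proof. by apply: filter_uniq; exact: mnm_upto_uniq. Qed.

(** Translation by (t, ..., t), of degree r t, is a bijection between the two lists. *)
Lemma size_mnm_deg_ge N t :
  size [seq mu : 'X_{1..r} <- mnm_deg (N + r * t) |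
    [forall i : 'I_r, t <= mu i]%N] = size (mnm_deg N).
Proof.
pose tt : 'X_{1..r} := [multinom t | i < r].
have dt : mdeg tt = (r * t)%N.
  by rewrite mdegE (eq_bigr (fun=> t)) ?sum_nat_const ?card_ord // => i _; rewrite mnmE.
rewrite -(size_map (fun mu => (mu + tt)%MM) (mnm_deg N)).
apply/perm_size/uniq_perm.
- by apply: filter_uniq; exact: mnm_deg_uniq.
- by rewrite map_inj_uniq ?mnm_deg_uniq // => mu nu /addIm.
move=> mu; rewrite mem_filter mem_mnm_deg; apply/andP/mapP.
  move=> [/forallP ht /eqP dmu].
  have e : mu = (mu - tt + tt)%MM.
    by apply/mnmP => i; rewrite mnmDE mnmBE mnmE subnK.
  exists (mu - tt)%MM => //; rewrite mem_mnm_deg.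
  by rewrite -(eqn_add2r (r * t)) -dmu {2}e mdegD dt.
move=> [nu]; rewrite mem_mnm_deg => /eqP dnu ->; split.
  by apply/forallP => i; rewrite mnmDE mnmE leq_addl.
by rewrite mdegD dt dnu.
Qed.

End Counting.

(** Stars and bars: [card_ord_partitions] counts the tuples with a given sum. *)
Lemma size_mnm_deg r N : size (mnm_deg r.+1 N) = 'C(N + r, r).
Proof.
rewrite addnC -card_ord_partitions cardE.
pose f (t : r.+1.-tuple 'I_N.+1) : 'X_{1..r.+1} := [multinom (tnth t i : nat) | i < r.+1].
rewrite -(size_map f); apply/perm_size/uniq_perm.
- exact: mnm_deg_uniq.
- rewrite map_inj_uniq ?enum_uniq // => t t' /mnmP e; apply: eq_from_tnth => i.
  by apply/val_inj; have := e i; rewrite !mnmE.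
move=> mu; rewrite mem_mnm_deg; apply/idP/mapP.
  move=> /eqP dmu; have hmu i : (mu i < N.+1)%N.
    by rewrite ltnS -dmu mdegE (bigD1 i) //= leq_addr.
  exists [tuple inord (mu i) | i < r.+1].
    rewrite mem_enum inE big_tuple; apply/eqP; rewrite -[RHS]dmu mdegE.
    apply: eq_bigr => i _.
    by rewrite tnth_mktuple inordK.
  by apply/mnmP => i; rewrite mnmE tnth_mktuple inordK.
move=> [t]; rewrite mem_enum inE big_tuple => /eqP e ->; rewrite mdegE -[X in _ == X]e.
by apply/eqP/eq_bigr => i _; rewrite mnmE.
Qed.

Lemma bin_leq_exp n k : ('C(n, k) <= n ^ k)%N.
Proof.
elim: k n => [|k IH] n; first by rewrite bin0.
have h : ('C(n, k.+1) * k.+1`! <= n ^ k.+1)%N.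
  rewrite bin_ffact; elim: (k.+1) => [|q IHq]; first by rewrite ffactn0.
  by rewrite ffactnSr expnSr leq_mul // leq_subr.
by apply: leq_trans h; rewrite leq_pmulr // fact_gt0.
Qed.

(** Each of t Pascal steps adds at most (x + t)^p. This will bound the number of degrees near the
    coordinate hyperplanes. *)
Lemma bin_diff_bound x t p : ('C(x + t, p.+1) - 'C(x, p.+1) <= t * (x + t) ^ p)%N.
Proof.
rewrite leq_subLR; elim: t => [|t IH]; first by rewrite addn0 mul0n addn0.
rewrite addnS binS mulSn; apply: leq_trans (leq_add IH (bin_leq_exp _ _)) _.
rewrite -addnA leq_add2l addnC; apply: leq_add.
  by have [->|p0] := posnP p; rewrite ?expn0 // leq_exp2r.
rewrite leq_mul2l; apply/orP; right.
by have [->|p0] := posnP p; rewrite ?expn0 // leq_exp2r.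
Qed.

Lemma size_mnm_upto r d : (size (mnm_upto r d) <= d.+1 ^ r)%N.
Proof.
rewrite size_map -cardE -[X in (_ <= _ ^ X)%N]card_ord -[d.+1 in X in (_ <= X)%N]card_ord.
rewrite -card_ffun; pose f (k : 'X_{1..r < d.+1}) := [ffun i : 'I_r => inord (k i) : 'I_d.+1].
rewrite -(card_codom (f := f)) ?max_card // => k k' /ffunP e.
apply/val_inj/mnmP => i; have := e i; rewrite !ffunE => /(congr1 val) /=.
have hk (l : 'X_{1..r < d.+1}) : (l i < d.+1)%N.
  by apply: leq_ltn_trans (bmdeg l); rewrite mdegE (bigD1 i) //= leq_addr.
by rewrite !inordK.
Qed.

Lemma quot_pi_eq0 (R : pzRingType) (V : lmodType R) (N : submodClosed V) (x : V) :
  quot_pi N x = 0 <-> x \in N.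
Proof.
have e : quot_pi N 0 = 0 by apply: (addrI (quot_pi N 0)); rewrite -quot_piD !addr0.
by rewrite -e; split=> [/quot_piP|h]; [|apply/quot_piP]; rewrite subr0.
Qed.

Lemma rlen0 (A : comNzRingType) (B : comAlgType A) (M : lmodType B) (U : set M) :
  bsub U -> rlen [set 0] U = len U.
Proof.
move=> [U0 _]; rewrite /rlen.
suff -> : U `&` [set 0] = [set 0] by rewrite len0 subn0.
by apply/seteqP; split=> [m []//|_ ->].
Qed.

Lemma blin_quot_pi (A : comNzRingType) (B : comAlgType A) (M : lmodType B)
  (N : submodClosed M) : blin (quot_pi N).
Proof. by move=> b u v; rewrite quot_piD -quot_scaleE. Qed.

Lemma vanish_diff_intr r t (h : {ffun 'I_r -> int} -> int) :
  vanish_diff t h -> vanish_diff t (fun nu => (h nu)%:~R : rat).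
Proof.
elim: t h => [|t IH] h /= => [[c hc]|vh i]; first by exists c => nu /hc ->.
have -> : diff i (fun nu => (h nu)%:~R : rat) = fun nu => (diff i h nu)%:~R.
  by apply/funext => nu; rewrite /diff rmorphB.
exact: IH.
Qed.

Lemma diffs_intr r w (h : {ffun 'I_r -> int} -> int) :
  diffs w (fun nu => (h nu)%:~R : rat) = fun nu => (diffs w h nu)%:~R.
Proof.
elim: w h => //= i w IH h; rewrite -IH; congr diffs.
by apply/funext => nu; rewrite /diff rmorphB.
Qed.

(** * Multigraded rings and modules *)

Section Multigraded.
Variables (r : nat) (A : comNzRingType) (B : comAlgType A).
Variable BB : 'X_{1..r} -> {pred B}.
Hypothesis hBB : graded_ring BB.
Hypothesis hB0 : forall b : B, b \in BB 0%MM <-> exists a : A, b = a%:A.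
Variable s : seq B.
Hypothesis hs1 : forall x, x \in s -> exists i : 'I_r, x \in BB U_(i)%MM.
Hypothesis hs2 : gen_alg s.
Hypothesis hA : artinian_ring A.

Definition gens (i : 'I_r) : seq B := [seq x <- undup s | x \in BB U_(i)%MM].

Let hBg : grading BB. Proof. by case: hBB. Qed.
Let BBM mu nu x y : x \in BB mu -> y \in BB nu -> x * y \in BB (mu + nu)%MM.
Proof. by case: hBB => _ _; exact. Qed.

Lemma gens_deg i x : x \in gens i -> x \in BB U_(i)%MM.
Proof. by rewrite mem_filter => /andP[]. Qed.

Lemma scalar_deg (a : A) : a%:A \in BB 0%MM.
Proof. by apply/hB0; exists a. Qed.

Lemma mul_cmp mu nu x b : x \in BB mu ->
  cmp BB (mu + nu)%MM (x * b) = x * cmp BB nu b.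
Proof.
move=> xF; have [h _] := cmp_morph (sigma := fun nu => (mu + nu)%MM)
  (f := fun b => x * b) hBg hBg (@addmI _ mu) (mulrDr x) (fun g v => BBM xF).
exact: h.
Qed.

Lemma mul_cmp0 mu mu' x b : x \in BB mu -> (forall nu, mu' <> (mu + nu)%MM) ->
  cmp BB mu' (x * b) = 0.
Proof.
move=> xF hn; have [_ h] := cmp_morph (sigma := fun nu => (mu + nu)%MM)
  (f := fun b => x * b) hBg hBg (@addmI _ mu) (mulrDr x) (fun g v => BBM xF).
exact: h.
Qed.

(** Standardness enters here. The sums of an element of [Z], without components of positive i-th
    degree, and an element of the ideal [I] generated by [gens i] form a subalgebra containing s,
    hence B; in degree e_i + mu only the second summand survives. *)
Lemma BB_ind i mu (U : set B) : U 0 -> (forall a b, U a -> U b -> U (a + b)) ->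
  (forall x c, x \in gens i -> c \in BB mu -> U (x * c)) ->
  forall b, b \in BB (U_(i) + mu)%MM -> U b.
Proof.
move=> U0 UD Ux.
pose Z b := forall nu : 'X_{1..r}, (0 < nu i)%N -> cmp BB nu b = 0.
pose I b := exists c : B -> B, b = \sum_(x <- gens i) x * c x.
have ID b b' : I b -> I b' -> I (b + b').
  move=> [c ->] [c' ->]; exists (fun x => c x + c' x).
  by rewrite -big_split; apply: eq_bigr => x _; rewrite mulrDr.
have IM b b' : I b -> I (b * b').
  move=> [c ->]; exists (fun x => c x * b'); rewrite mulr_suml.
  by apply: eq_bigr => x _; rewrite mulrA.
have ZD b b' : Z b -> Z b' -> Z (b + b').
  by move=> h h' nu hnu; rewrite cmpD // h // h' // addr0.
have ZM b b' : Z b -> Z b' -> Z (b * b').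
  move=> h h' nu hnu; rewrite (cmp_sum_supp hBg b) (cmp_sum_supp hBg b').
  rewrite mulr_suml cmp_bigsum // big1 // => g _.
  rewrite mulr_sumr cmp_bigsum // big1 // => g' _.
  have [gi|gi] := posnP (g i); last by rewrite h // mul0r cmp0.
  have [gi'|gi'] := posnP (g' i); last by rewrite h' // mulr0 cmp0.
  apply: (cmp_neq hBg (BBM (cmp_in hBg g b) (cmp_in hBg g' b'))).
  by apply: contraTneq hnu => ->; rewrite mnmDE gi gi'.
have ZA (a : A) : Z a%:A.
  move=> nu hnu; apply: (cmp_neq hBg (scalar_deg a)).
  by apply: contraTneq hnu => ->; rewrite mnm0E.
move=> b; suff [b0 [b1 [hZ [c ->] ->]]] : exists b0 b1, [/\ Z b0, I b1 & b = b0 + b1].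
  move=> bF; rewrite -(cmp_id hBg bF) cmpD // hZ; last first.
    by rewrite mnmDE mnmE eqxx.
  rewrite add0r cmp_bigsum // big_seq; elim/big_ind: _ => // x xi.
  by rewrite mul_cmp ?gens_deg //; apply: Ux => //; exact: (cmp_in hBg).
suff /asboolP : b \in (fun b => `[< exists b0 b1,
  [/\ Z b0, I b1 & b = b0 + b1] >]) by [].
apply: hs2; first split.
- apply/asboolP; exists 1, 0; rewrite addr0; split=> //.
    by rewrite -[1](scale1r 1); exact: ZA.
  by exists (fun=> 0); rewrite big1 // => x _; rewrite mulr0.
- move=> a u v /asboolP[u0 [u1 [hu0 hu1 ->]]] /asboolP[v0 [v1 [hv0 hv1 ->]]].
  apply/asboolP; exists (a%:A * u0 + v0), (u1 * a%:A + v1); split.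
  + by apply: (ZD) => //; exact: ZM.
  + by apply: (ID) => //; exact: IM.
  by rewrite scalerDr [u1 * _]mulrC !mulr_algl addrACA.
- move=> u v /asboolP[u0 [u1 [hu0 hu1 ->]]] /asboolP[v0 [v1 [hv0 hv1 ->]]].
  apply/asboolP; exists (u0 * v0), (v1 * u0 + u1 * (v0 + v1)); split.
  + exact: ZM.
  + by apply: (ID); exact: IM.
  by rewrite [v1 * _]mulrC mulrDl mulrDr addrA.
move=> x xs; apply/asboolP; have [j xj] := hs1 xs.
have [xi|xi] := boolP (x \in gens i).
  exists 0, x; rewrite add0r; split=> //; first by move=> nu _; rewrite cmp0.
  exists (fun y => (y == x)%:R); rewrite (bigD1_seq x) //=; last first.
    by apply: filter_uniq; exact: undup_uniq.
  by rewrite eqxx mulr1 big1 ?addr0 // => y /negPf ->; rewrite mulr0.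
exists x, 0; rewrite addr0; split=> //; last first.
  by exists (fun=> 0); rewrite big1 // => y _; rewrite mulr0.
move=> nu hnu; apply: (cmp_neq hBg xj); apply: contraNneq xi => e.
rewrite mem_filter mem_undup xs andbT.
move: hnu; rewrite e mnmE; case: eqP => [<- //|//].
Qed.

Lemma BB_split nu mu (U : set B) : U 0 -> (forall a b, U a -> U b -> U (a + b)) ->
  (forall y c, y \in BB nu -> c \in BB mu -> U (y * c)) ->
  forall b, b \in BB (nu + mu)%MM -> U b.
Proof.
elim/mnm_ind: nu U => [|i nu IH] U U0 UD Uy b.
  rewrite add0m => bF; rewrite -[b]mul1r; apply: Uy => //.
  by case: hBB.
rewrite -addmA; apply: BB_ind => // x c xi.
apply: (IH [set c | U (x * c)]).
- by rewrite /= mulr0.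
- by move=> u v; rewrite /= mulrDr; exact: UD.
move=> y {}c yF cF; rewrite /= mulrA; apply: Uy => //.
by apply: BBM => //; exact: gens_deg.
Qed.

Lemma bsub_BB mu : bsub ([set b | b \in BB mu] : set (B^o : lmodType B)).
Proof.
have [hz _ _] := hBg; have [z0 zB] := hz mu; split=> // a u v uF vF.
rewrite /= -[v]opprK; apply: (zB); last by rewrite -sub0r; exact: zB.
by rewrite -(add0m mu); apply: BBM => //; exact: scalar_deg.
Qed.

Lemma fin_len_BB mu : fin_len ([set b | b \in BB mu] : set (B^o : lmodType B)).
Proof.
elim/mnm_ind: mu => [|i mu IH].
  suff -> : [set b | b \in BB 0%MM] = line (1 : B^o) by exact: artinian_fin_len.
  by apply/seteqP; split=> b; rewrite /= hB0 => -[a ->]; exists a;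
    rewrite -[_ *: (1 : B^o)]/(_ * _) mulr1.
have [W Wf hW] : exists2 W : set (B^o : lmodType B), fin_len W &
    forall x c, x \in gens i -> c \in BB mu -> W (x * c).
  elim: (gens i) => [|x l [W Wf hW]]; first by exists [set 0]; first exact: fin_len0.
  exists (sumset ((fun c : (B^o : lmodType B) => x *: c) @` [set b | b \in BB mu]) W).
    by apply: fin_len_sum => //; apply: (fin_len_image (blin_scale x)); exact: IH.
  move=> y c; rewrite inE => /orP[/eqP -> cF|yl cF].
    by apply: sumsetl; [exact: fin_len_bsub | exists c].
  apply: sumsetr; last exact: hW.
  by apply: (bsub_image (blin_scale x)); exact: bsub_BB.
apply: (fin_len_sub (bsub_BB _) _ Wf) => b.
apply: BB_ind => //; first by case: (fin_len_bsub Wf).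
by move=> u v Wu Wv; apply: (bsubD (fin_len_bsub Wf)).
Qed.

Lemma irrelevant_BB mu b : b \in BB mu -> (forall i, 0 < mu i)%N ->
  b \in irrelevant BB.
Proof.
move=> bF mu0; apply/asboolP; exists [:: mu], (fun=> b).
rewrite big_seq1; split=> // nu; rewrite inE => /eqP ->; rewrite !inE bF.
exact/forallP.
Qed.

Definition one_mnm : 'X_{1..r} := [multinom 1%N | i < r].

(** Since B is standard, k factors of degree (1, ..., 1) can be split off, and each lies in the
    irrelevant ideal. *)
Lemma BB_ideal_pow k mu b : b \in BB mu -> (forall i, k <= mu i)%N ->
  b \in ideal_pow (irrelevant BB) k.
Proof.
elim: k mu b => [|k IH] mu b bF hmu.
  rewrite -[b]mulr1; apply: (@rpredZ B B^o (ideal_pow (irrelevant BB) 0)).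
  by apply/asboolP => N _; apply; exists [::]; rewrite big_nil.
have e : mu = (one_mnm + (mu - one_mnm))%MM.
  apply/mnmP => i; rewrite mnmDE mnmBE mnmE subnKC //.
  exact: leq_ltn_trans (hmu i).
have hmu' i : (k <= (mu - one_mnm)%MM i)%N.
  by rewrite mnmBE mnmE subn1; have := hmu i; case: (mu i).
move: bF; rewrite e.
apply: (BB_split (U := [set b | b \in ideal_pow (irrelevant BB) k.+1])).
- exact: (@rpred0 B^o (ideal_pow (irrelevant BB) k.+1)).
- exact: (@rpredD B^o (ideal_pow (irrelevant BB) k.+1)).
move=> y c yF /IH/(_ hmu')/asboolP hc; rewrite /=.
apply: (hc (fun c : B^o => y * c \in ideal_pow (irrelevant BB) k.+1)).
  split=> [|a u v hu hv]; rewrite -topredE /=.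
    by rewrite mulr0; exact: (@rpred0 B^o (ideal_pow (irrelevant BB) k.+1)).
  rewrite mulrDr; apply: (@rpredD B^o (ideal_pow (irrelevant BB) k.+1)) => //.
  rewrite mulrCA; exact: (@rpredZ B B^o (ideal_pow (irrelevant BB) k.+1)).
move=> _ [l [sl lI ->]]; apply/asboolP => N _; apply.
exists (y :: l); rewrite big_cons /= sl; split=> // x.
rewrite inE => /orP[/eqP ->|/lI //]; apply: irrelevant_BB yF _.
by move=> i; rewrite mnmE.
Qed.

(** For a prime P not containing the irrelevant ideal, this provides a generator outside P in every
    degree e_i. *)
Lemma irrelevant_sub (P : {pred B}) i : idealr_closed P ->
  {subset gens i <= P} -> {subset irrelevant BB <= P}.
Proof.
move=> [P0 P1 PP] gP b /asboolP[l [f [ul lF ->]]].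
have PD u v : u \in P -> v \in P -> u + v \in P.
  by move=> uP vP; rewrite -[u]mul1r; exact: PP.
have PM u v : u \in P -> v * u \in P.
  by move=> uP; rewrite -[v * u]addr0; exact: PP.
rewrite big_seq; apply: (big_ind (fun b => b \in P)) => // mu mul.
have := lF mu mul; rewrite !inE => /andP[fF /forallP/(_ i) hi].
have e := mnm_subU hi.
move: fF; rewrite {2}e; apply: (BB_ind (U := [set b | b \in P])) => //.
by move=> x c /gP xP _; rewrite /= mulrC; exact: PM.
Qed.

(** * Graded submodules and Noetherian induction *)

Variables (M : lmodType B) (MM : {ffun 'I_r -> int} -> {pred M}).
Hypotheses (hM : graded_module BB MM) (hMfg : fin_gen_module M).
Implicit Types (N K : set M) (nu delta : {ffun 'I_r -> int}) (mu : 'X_{1..r}).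

Let hMg : grading MM. Proof. by case: hM. Qed.
Let MMZ mu nu b m : b \in BB mu -> m \in MM nu -> b *: m \in MM (degZ mu + nu).
Proof. by case: hM => _; exact. Qed.

Definition gsub N := msub N /\ hom MM N.

(* (N : x), N + xM and N + Bg *)
Definition colon N (x : B) : set M := [set m | N (x *: m)].
Definition add_mul N (x : B) : set M := sumset N ( *:%R x @` [set: M]).
Definition add_gen N (g : M) : set M :=
  sumset N ((fun b : B => b *: g) @` [set: B]).

Lemma msubD N u v : msub N -> N u -> N v -> N (u + v).
Proof. by move=> /msub_bsub; exact: bsubD. Qed.

Lemma scal_cmp mu nu b m : b \in BB mu ->
  cmp MM (degZ mu + nu) (b *: m) = b *: cmp MM nu m.
Proof.
move=> bF; have [h _] := cmp_morph (sigma := fun nu => degZ mu + nu)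
  (f := fun m => b *: m) hMg hMg (@addrI _ (degZ mu)) (scalerDr b)
  (fun g v => MMZ bF).
exact: h.
Qed.

Lemma scal_cmpB mu nu b m : b \in BB mu ->
  cmp MM nu (b *: m) = b *: cmp MM (nu - degZ mu) m.
Proof. by move=> bF; rewrite -(scal_cmp _ _ bF) addrC subrK. Qed.

Lemma act_cmp delta g mu b : g \in MM delta ->
  cmp MM (degZ mu + delta) (b *: g) = cmp BB mu b *: g.
Proof.
move=> gF; have [|||h _] := @cmp_morph _ _ _ _ _ _ (fun mu => degZ mu + delta)
  (fun b => b *: g) hBg hMg.
- by move=> u v /addIr/degZ_inj.
- by move=> u v; rewrite scalerDl.
- by move=> u v vF; exact: MMZ.
exact: h.
Qed.

Lemma act_cmpP delta g nu b : g \in MM delta ->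
  cmp MM nu (b *: g) = 0 \/ exists mu, nu = degZ mu + delta /\
    cmp MM nu (b *: g) = cmp BB mu b *: g.
Proof.
move=> gF; have [[mu e]|h] := pselect (exists mu, nu = degZ mu + delta).
  by right; exists mu; rewrite {2}e act_cmp.
left; have [|||_ h'] := @cmp_morph _ _ _ _ _ _ (fun mu => degZ mu + delta)
  (fun b => b *: g) hBg hMg.
- by move=> u v /addIr/degZ_inj.
- by move=> u v; rewrite scalerDl.
- by move=> u v vF; exact: MMZ.
by apply: h' => mu e; apply: h; exists mu.
Qed.

Lemma bsub_MM nu : bsub [set m | m \in MM nu].
Proof.
have [hz _ _] := hMg; have [z0 zB] := hz nu; split=> // a u v uF vF.
rewrite /= -[v]opprK; apply: (zB); last by rewrite -sub0r; exact: zB.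
rewrite -[nu]add0r -degZ0; apply: MMZ => //; exact: scalar_deg.
Qed.

Lemma MM_cmp nu m : cmp MM nu m \in MM nu. Proof. exact: cmp_in. Qed.

Lemma msub0 : msub [set 0 : M].
Proof. by split=> // b u v -> ->; rewrite scaler0 addr0. Qed.

Lemma gsub0 : gsub [set 0].
Proof. by split; [exact: msub0 | move=> _ -> g; exact: cmp0]. Qed.

Lemma gsubT : gsub setT.
Proof. by []. Qed.

Lemma msub_colon N x : msub N -> msub (colon N x).
Proof.
move=> [N0 NN]; split; first by rewrite /colon /= scaler0.
by move=> b u v Nu Nv; rewrite /colon /= blin_scale; exact: NN.
Qed.

Lemma gsub_colon N x mu : gsub N -> x \in BB mu -> gsub (colon N x).
Proof.
move=> [Ns Nh] xF; split; first exact: msub_colon.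
by move=> m Nm nu; rewrite /colon /= -(scal_cmp _ _ xF); exact: Nh.
Qed.

Lemma msub_sum N K : msub N -> msub K -> msub (sumset N K).
Proof.
move=> [N0 NN] [K0 KK]; split; first by exists 0, 0; rewrite addr0.
move=> b _ _ [u [v [Nu Kv ->]]] [u' [v' [Nu' Kv' ->]]].
exists (b *: u + u'), (b *: v + v').
by split; [exact: NN | exact: KK | rewrite scalerDr addrACA].
Qed.

Lemma gsub_add_mul N x mu : gsub N -> x \in BB mu -> gsub (add_mul N x).
Proof.
move=> [Ns Nh] xF; split.
  apply: msub_sum => //; split; first by exists 0; rewrite ?scaler0.
  by move=> b _ _ [u _ <-] [v _ <-]; exists (b *: u + v) => //; exact: blin_scale.
move=> _ [u [_ [Nu [v _ <-] ->]]] nu.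
exists (cmp MM nu u), (x *: cmp MM (nu - degZ mu) v); split; first exact: Nh.
  by exists (cmp MM (nu - degZ mu) v).
by rewrite cmpD // (scal_cmpB _ _ xF).
Qed.

Lemma gsub_add_gen N g delta : gsub N -> g \in MM delta -> gsub (add_gen N g).
Proof.
move=> [Ns Nh] gF; split.
  apply: msub_sum => //; split; first by exists 0; rewrite ?scale0r.
  move=> b _ _ [u _ <-] [v _ <-]; exists (b * u + v) => //.
  by rewrite scalerDl scalerA.
move=> _ [u [_ [Nu [v _ <-] ->]]] nu.
rewrite cmpD //; have [->|[mu [-> ->]]] := act_cmpP nu v gF.
  by exists (cmp MM nu u), 0; split=> //; [exact: Nh | exists 0; rewrite ?scale0r].
by exists (cmp MM (degZ mu + delta) u), (cmp BB mu v *: g); split=> //; exact: Nh.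
Qed.

Lemma maximal_gsub (F : set (set M)) N0 : (forall N, F N -> gsub N) -> F N0 ->
  exists N, [/\ F N, N0 `<=` N & forall N', F N' -> N `<=` N' -> N' `<=` N].
Proof.
move=> Fs; apply: (maximal_msub hA hMfg hs2).
by move=> N /Fs[].
Qed.

Lemma graded_ind (Q : set M -> Prop) N K : gsub N -> gsub K -> N `<=` K -> Q N ->
  (forall K' delta g, gsub K' -> N `<=` K' -> K' `<=` K -> Q K' ->
    g \in MM delta -> K g -> Q (add_gen K' g)) -> Q K.
Proof.
move=> Ng Kg NK QN step.
have [||K' [[K'g NK' K'K QK'] _ maxK']] := @maximal_gsub
  [set K' | [/\ gsub K', N `<=` K', K' `<=` K & Q K']] N.
- by move=> N' [].
- by split.
suff -> : K = K' by [].
apply/seteqP; split=> // m Km; apply: (cmp_all_in hMg) => [||nu].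
- by case: K'g => -[].
- by move=> a b; apply: msubD; case: K'g.
have gF := MM_cmp nu m; have Kgm := proj2 Kg _ Km nu.
apply: (maxK' (add_gen K' (cmp MM nu m))).
- split; first exact: gsub_add_gen gF.
  + move=> u Nu; exists u, 0; rewrite addr0; split=> //; first exact: NK'.
    by exists 0; rewrite ?scale0r.
  + move=> _ [u [_ [/K'K Ku [b _ <-] ->]]]; have [Ks _] := Kg.
    by apply: msubD => //; exact: msubZ.
  + exact: step gF Kgm.
- move=> u Ku; exists u, 0; rewrite addr0; split=> //.
  by exists 0; rewrite ?scale0r.
exists 0, (cmp MM nu m); rewrite add0r; split=> //; first by case: K'g => -[].
by exists 1; rewrite ?scale1r.
Qed.

(** The notion [large] stays abstract to serve both for degrees large in every coordinate
    ([tors_eventually]) and for large total degree ([kill_total]). The shift hypothesis absorbs the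
    degree of each adjoined generator. *)
Lemma eventually_sub (large : nat -> {ffun 'I_r -> int} -> Prop) N K :
  gsub N -> gsub K -> N `<=` K ->
  (forall c c' nu, (c <= c')%N -> large c' nu -> large c nu) ->
  (forall k delta, exists c, forall mu, large c (degZ mu + delta) ->
    large k (degZ mu)) ->
  (forall delta g, g \in MM delta -> K g -> exists k, forall mu,
    large k (degZ mu) -> forall b, b \in BB mu -> N (b *: g)) ->
  exists c, forall nu, large c nu -> forall m, m \in MM nu -> K m -> N m.
Proof.
move=> Ng Kg NK lmono lshift kill.
apply: (@graded_ind (fun K => exists c, forall nu, large c nu ->
  forall m, m \in MM nu -> K m -> N m)) NK _ _ => //; first by exists 0%N.
move=> K' delta g K'g NK' K'K [c hc] gF Kgm.
have [k hk] := kill _ _ gF Kgm; have [c' hc'] := lshift k delta.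
exists (maxn c c') => nu lnu m mF [u [_ [K'u [b _ <-] e]]].
have -> : m = cmp MM nu u + cmp MM nu (b *: g) by rewrite -cmpD // -e cmp_id.
have [Ns _] := Ng; apply: msubD => //.
  apply: (hc nu); [by apply: lmono lnu; exact: leq_maxl | exact: MM_cmp |].
  by case: K'g => _; apply.
have [->|[mu [enu ->]]] := act_cmpP nu b gF; first by case: Ns.
apply: (hk mu); last exact: cmp_in.
by apply: hc'; rewrite -enu; apply: lmono lnu; exact: leq_maxr.
Qed.

(* The elements killed modulo N by a power of the irrelevant ideal. *)
Definition tors N : set M := [set m | exists k, forall mu, (forall i, k <= mu i)%N ->
  forall b, b \in BB mu -> N (b *: m)].

Lemma sub_tors N : msub N -> N `<=` tors N.
Proof. by move=> Ns m Nm; exists 0%N => mu _ b _; exact: msubZ. Qed.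

Lemma gsub_tors N : gsub N -> gsub (tors N).
Proof.
move=> [Ns Nh]; split; [split|].
- by exists 0%N => mu _ b _; rewrite scaler0; case: Ns.
- move=> b u v [k hk] [l hl]; exists (maxn k l) => mu hmu c cF.
  rewrite blin_scale; apply: (proj2 Ns).
    by apply: hk cF => i; apply: leq_trans (hmu i); exact: leq_maxl.
  by apply: hl cF => i; apply: leq_trans (hmu i); exact: leq_maxr.
move=> m [k hk] nu; exists k => mu hmu b bF.
by rewrite -(scal_cmp _ _ bF); apply: Nh; exact: hk bF.
Qed.

Definition abs_bound delta : nat := (\sum_i `|delta i|)%N.

Lemma abs_boundP delta i : `|delta i| <= (abs_bound delta)%:Z.
Proof.
rewrite /abs_bound (bigD1 i) //= -[`|delta i|]/(`|delta i|%N%:Z) lez_nat.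
exact: leq_addr.
Qed.

Lemma degZ_shift_ge k delta mu i :
  (k + abs_bound delta)%:Z <= (degZ mu + delta) i -> k%:Z <= degZ mu i.
Proof.
have := abs_boundP delta i; rewrite !ffunE.
by move: (delta i) (mu i) (abs_bound delta) => x y z; lia.
Qed.

(** [tors N] is finitely generated over N, so only finitely many exponents and degree shifts
    matter. *)
Lemma tors_eventually N : gsub N -> exists c : nat, forall nu,
  (forall i, c%:Z <= nu i) -> forall m, m \in MM nu -> tors N m -> N m.
Proof.
move=> Ng; apply: eventually_sub => //.
- exact: gsub_tors.
- by apply: sub_tors; case: Ng.
- move=> c c' nu cc' h i; apply: le_trans (h i); rewrite lez_nat; exact: cc'.
- move=> k delta; exists (k + abs_bound delta)%N => mu h i.
  by apply: degZ_shift_ge; exact: h.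
move=> delta g gF [k hk]; exists k => mu h b bF; apply: hk bF => i.
by have := h i; rewrite !ffunE lez_nat.
Qed.

Lemma kill_gens N i mu b m : msub N -> b \in BB mu -> (0 < mu i)%N ->
  (forall x c, x \in gens i -> c \in BB (mu - U_(i))%MM -> N (x *: (c *: m))) ->
  N (b *: m).
Proof.
move=> Ns bF hi hx.
have e := mnm_subU hi.
move: bF; rewrite e; apply: (BB_ind (U := [set b | N (b *: m)])).
- by rewrite /= scale0r; case: Ns.
- by move=> u v /=; rewrite scalerDl; exact: msubD.
by move=> x c xi cF; rewrite /= -scalerA; exact: hx.
Qed.

(** Elements of B of positive degree are combinations of the generators and kill M/N, so only the
    degrees of module generators can remain. *)
Lemma kill_total N : gsub N -> (forall i x m, x \in gens i -> N (x *: m)) ->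
  exists c : nat, forall nu, c%:Z <= total_deg nu -> forall m, m \in MM nu -> N m.
Proof.
move=> Ng hx.
have totB delta : total_deg delta <= (abs_bound delta)%:Z.
  rewrite /abs_bound (big_morph Posz PoszD (erefl 0%:Z)); apply: ler_sum => i _.
  by rewrite abszE ler_norm.
have [||||c hc] := @eventually_sub (fun c nu => c%:Z <= total_deg nu) N setT Ng gsubT.
- by [].
- by move=> c c' nu cc'; apply: le_trans; rewrite lez_nat.
- move=> k delta; exists (k + abs_bound delta)%N => mu.
  by rewrite total_degD; have := totB delta;
    move: (total_deg delta) (total_deg (degZ mu)) (abs_bound delta) => x y z; lia.
- move=> delta g gF _; exists 1%N => mu.
  rewrite total_degZ lez_nat => /mdeg_pos[i hi] b bF.
  have [Ns _] := Ng; apply: (kill_gens (i := i)) bF _ _ => //.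
  by move=> x c xi _; exact: hx xi.
by exists c => nu h m mF; exact: hc mF I.
Qed.

(** M has finitely many homogeneous generators, and B only raises degrees. *)
Lemma degrees_bounded_below : exists k : nat, forall nu m, m \in MM nu ->
  m <> 0 -> forall i, - k%:Z <= nu i.
Proof.
suff [k hk] : exists k : nat, forall nu m, m \in MM nu -> [set: M] m ->
  m <> 0 -> forall i, - k%:Z <= nu i by exists k => nu m mF; exact: hk.
apply: (@graded_ind (fun K => exists k : nat, forall nu m, m \in MM nu -> K m ->
  m <> 0 -> forall i, - k%:Z <= nu i) [set 0]) => //; first exact: gsub0.
  by exists 0%N => nu m _ ->.
move=> K' delta g K'g _ _ [k hk] gF _; exists (k + abs_bound delta)%N.
move=> nu m mF [u [_ [K'u [b _ <-] e]]] mn0 i.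
have em : m = cmp MM nu u + cmp MM nu (b *: g) by rewrite -cmpD // -e cmp_id.
have [u0|un0] := pselect (cmp MM nu u = 0); last first.
  have := hk nu _ (MM_cmp nu u) (proj2 K'g _ K'u nu) un0 i.
  by move: (nu i) (abs_bound delta) => x y; lia.
have [e0|[mu [enu _]]] := act_cmpP nu b gF.
  by case: mn0; rewrite em u0 e0 addr0.
have := abs_boundP delta i; rewrite enu !ffunE.
by move: (delta i) (mu i) (abs_bound delta) => x y z; lia.
Qed.

Lemma fin_len_MM nu : fin_len [set m | m \in MM nu].
Proof.
suff h : forall nu, fin_len ([set m | m \in MM nu] `&` setT).
  by have := h nu; rewrite setIT.
apply: (@graded_ind (fun K => forall nu, fin_len ([set m | m \in MM nu] `&` K))
  [set 0]) => //; first exact: gsub0.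
  move=> {}nu; apply: (fin_len_sub _ _ (fin_len0 M)) => //.
  by apply: bsubI; [exact: bsub_MM | exact: bsub0].
move=> K' delta g K'g _ _ hK' gF _ {}nu.
have [K''s _] := gsub_add_gen K'g gF.
have Ks : bsub ([set m | m \in MM nu] `&` add_gen K' g).
  by apply: bsubI; [exact: bsub_MM | exact: msub_bsub].
have [[mu e]|ne] := pselect (exists mu, nu = degZ mu + delta).
  have Wf := fin_len_image (blin_act g) (fin_len_BB mu).
  apply: (fin_len_sub Ks _ (fin_len_sum (hK' nu) Wf)).
  move=> m [mF [u [_ [K'u [b _ <-] em]]]].
  exists (cmp MM nu u), (cmp BB mu b *: g); split.
  - by split; [exact: MM_cmp | case: K'g => _; exact].
  - by exists (cmp BB mu b) => //; exact: cmp_in.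
  by rewrite -(act_cmp mu b gF) -e -cmpD // -em cmp_id.
apply: (fin_len_sub Ks _ (hK' nu)) => m [mF [u [_ [K'u [b _ <-] em]]]]; split=> //.
have -> : m = cmp MM nu u + cmp MM nu (b *: g) by rewrite -cmpD // -em cmp_id.
have [->|[mu [enu _]]] := act_cmpP nu b gF; last by case: ne; exists mu.
by rewrite addr0; case: K'g => _; exact.
Qed.

(** * Hilbert functions and chains of primes *)

Let finM nu : fin_len [set m | m \in MM nu] := fin_len_MM nu.

(* The Hilbert function of M/N. *)
Definition hilb N nu : int := (rlen N [set m | m \in MM nu])%:Z.

(* The exact sequence 0 -> M/(N : x) -> M/N -> M/(N + xM) -> 0, where W and W'
   are the relevant homogeneous parts of the middle and left terms. *)
Lemma rlen_exact N x (W W' : set M) : msub N -> fin_len W -> fin_len W' ->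
  *:%R x @` W' `<=` W -> W `&` add_mul N x `<=` sumset ( *:%R x @` W') (W `&` N) ->
  rlen N W = (rlen (add_mul N x) W + rlen (colon N x) W')%N.
Proof.
move=> Ns Wf Wf' xW' hW; have Ns' := msub_bsub Ns.
have Nxs : msub (add_mul N x).
  apply: msub_sum => //; split; first by exists 0; rewrite ?scaler0.
  by move=> b _ _ [u _ <-] [v _ <-]; exists (b *: u + v) => //; exact: blin_scale.
have xf := fin_len_image (blin_scale x) Wf'.
rewrite (rlen_trans Ns' (msub_bsub Nxs) Wf); last first.
  by apply: sumsetl; exact: (bsub_image (blin_scale x) (bsubT M)).
congr addn; rewrite -[colon N x]/( *:%R x @^-1` N) -(rlen_image (blin_scale x) Ns' Wf').
apply: rlen_eq => //; first exact: fin_len_bsub.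
- by apply: fin_lenI => //; exact: msub_bsub.
- move=> _ [m Wm <-]; split; first by apply: xW'; exists m.
  by apply: sumsetr => //; exists m.
move=> m /hW[u [v [? [? ?] ->]]]; by exists u, v.
Qed.

Lemma hilb_exact N x mu nu : gsub N -> x \in BB mu ->
  hilb N nu = hilb (add_mul N x) nu + hilb (colon N x) (nu - degZ mu).
Proof.
move=> [Ns Nh] xF; rewrite /hilb -PoszD; congr Posz.
apply: rlen_exact => //.
  by move=> _ [m mF <-]; have := MMZ xF mF; rewrite addrC subrK.
move=> m [mF [u [_ [Nu [v _ <-] e]]]].
exists (x *: cmp MM (nu - degZ mu) v), (cmp MM nu u); split.
- by exists (cmp MM (nu - degZ mu) v) => //; exact: cmp_in.
- by split; [exact: cmp_in | exact: Nh].
by rewrite -(scal_cmpB _ _ xF) -cmpD // addrC -e cmp_id.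
Qed.

Lemma hilb_eq0 N nu : msub N -> (forall m, m \in MM nu -> N m) -> hilb N nu = 0.
Proof.
by move=> Ns h; rewrite /hilb; congr Posz; apply/rlen_eq0 => //; exact: msub_bsub.
Qed.

Lemma hilb_evz_irrelevant N : gsub N ->
  (forall b m, b \in irrelevant BB -> N (b *: m)) -> evz (hilb N).
Proof.
move=> Ng hN; suff hT m : tors N m.
  have [c hc] := tors_eventually Ng.
  exists c => nu hnu; apply: hilb_eq0; first by case: Ng.
  by move=> m mF; exact: hc mF (hT m).
by exists 1%N => mu hmu b bF; apply: hN; exact: irrelevant_BB bF hmu.
Qed.

Lemma msub_add_mul N x : msub N -> msub (add_mul N x).
Proof.
move=> Ns; apply: msub_sum => //; split; first by exists 0; rewrite ?scaler0.
by move=> b _ _ [u _ <-] [v _ <-]; exists (b *: u + v) => //; exact: blin_scale.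
Qed.

Lemma sub_add_mul N x : N `<=` add_mul N x.
Proof.
by apply: sumsetl; exact: (bsub_image (blin_scale x) (bsubT M)).
Qed.

Lemma mem_add_mul N x m : msub N -> add_mul N x (x *: m).
Proof. by move=> Ns; apply: sumsetr; [exact: msub_bsub | exists m]. Qed.

(* Take N' maximal. If a homogeneous x is neither zero nor injective on M/N',
   then N' + xM and (N' : x) are both larger than N', and the t-fold differences
   of h_N' vanish eventually by additivity. *)
Lemma maximal_nonvanishing t N : gsub N -> ~ vanish_diff t (hilb N) ->
  exists (N' : set M) (P : {pred B}),
    [/\ gsub N', N `<=` N' & ~ vanish_diff t (hilb N')] /\
    [/\ prime_ideal P, hom BB [set b | b \in P], ~ {subset irrelevant BB <= P},
        forall mu x, x \in BB mu -> x \notin P -> colon N' x `<=` N' &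
        (forall b m, b \in P -> N' (b *: m)) /\
        exists m : M, forall b, N' (b *: m) -> b \in P].
Proof.
move=> Ng nv.
have [||N' [[N'g nv'] NN' maxN]] := @maximal_gsub
  [set N' | gsub N' /\ ~ vanish_diff t (hilb N')] N.
- by move=> ? [].
- by [].
have [N's N'h] := N'g.
pose P : {pred B} := fun b => `[< forall m, N' (b *: m) >].
have inP b : (b \in P) = `[< forall m, N' (b *: m) >] by [].
have dich mu x : x \in BB mu -> x \notin P -> colon N' x `<=` N'.
  move=> xF; apply: contraPP => ncol; apply/negP; rewrite negbK inP.
  apply/asboolP => m.
  have [hx|nx] := pselect (vanish_diff t (hilb (add_mul N' x))); last first.
    apply: (maxN (add_mul N' x)); last exact: mem_add_mul.
      by split=> //; exact: gsub_add_mul xF.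
    exact: sub_add_mul.
  exfalso; apply: nv'.
  have -> : hilb N' = fun nu =>
      hilb (add_mul N' x) nu + hilb (colon N' x) (nu - degZ mu).
    by apply/funext => nu; exact: hilb_exact.
  apply: vanish_add => //; apply: vanish_shift; apply: contrapT => nvx.
  apply: ncol; apply: maxN; first by split=> //; exact: gsub_colon xF.
  by move=> u N'u; exact: msubZ.
have hP : idealr_closed P.
  split.
  - by rewrite inP; apply/asboolP => m; rewrite scale0r; case: N's.
  - rewrite inP; apply/asboolPn => h; apply: nv'; apply: vanish_evz.
    by exists 0 => nu _; apply: hilb_eq0 => // m _; rewrite -[m]scale1r.
  move=> a u v; rewrite !inP => /asboolP hu /asboolP hv; apply/asboolP => m.
  by rewrite scalerDl -scalerA; apply: msubD => //; exact: msubZ.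
have hPh : hom BB [set b | b \in P].
  move=> b /=; rewrite inP => /asboolP hb mu; rewrite inP; apply/asboolP => m.
  apply: (cmp_all_in hMg (N := colon N' (cmp BB mu b))) => [|u v hu hv|nu].
  - by rewrite /colon /= scaler0; case: N's.
  - by rewrite /colon /= scalerDr; exact: msubD.
  rewrite /colon /= -(act_cmp mu b (cmp_in hMg nu m)).
  by apply: N'h; exact: hb.
have hPp : prime_ideal P.
  apply: (graded_prime hBB) => // mu nu x y xF yF xyP.
  have [xP|xP] := boolP (x \in P); [by left | right].
  rewrite inP; apply/asboolP => m; apply: (dich mu x xF xP).
  by rewrite /colon /= scalerA; move: xyP; rewrite inP => /asboolP.
exists N', P; split=> //; split=> //.
  move=> irrP; apply: nv'; apply: vanish_evz; apply: hilb_evz_irrelevant => //.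
  by move=> b m /irrP; rewrite inP => /asboolP.
split; first by move=> b m; rewrite inP => /asboolP.
(* Any homogeneous m outside N' will do: a component of b outside P acts injectively modulo N', so
   it cannot kill m. *)
have [m [nu [mF N'm]]] : exists m nu, m \in MM nu /\ ~ N' m.
  apply: contrapT => h; apply: nv'; apply: vanish_evz; exists 0 => nu _.
  apply: hilb_eq0 => // m mF; apply: contrapT => N'm; apply: h.
  by exists m, nu.
exists m => b N'b; rewrite (cmp_sum_supp hBg b); apply: ideal_sum => // mu _.
apply: contrapT => /negP bP; apply: N'm; apply: (dich mu _ (cmp_in hBg mu b) bP).
by rewrite /colon /= -(act_cmp mu b mF); exact: N'h.
Qed.

(** The chain is decreasing: the new P lies in all primes found for N' + xM, so it goes last. The
    element m keeps each prime in the support of M/N. *)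
Lemma prime_chain t N : gsub N -> ~ vanish_diff t (hilb N) ->
  exists c : nat -> {pred B},
    (forall i, (i <= t)%N -> [/\ prime_ideal (c i), hom BB [set b | b \in c i],
        ~ {subset irrelevant BB <= c i} &
        exists m : M, forall b, N (b *: m) -> b \in c i]) /\
    (forall i, (i < t)%N -> pred_proper (c i.+1) (c i)).
Proof.
elim: t N => [|t IH] N Ng nv.
  have [N' [P [[N'g NN' _] [? ? ? _ [_ [m hm]]]]]] := maximal_nonvanishing Ng nv.
  by exists (fun=> P); split=> // i _; split=> //; exists m => b /NN'; exact: hm.
have [N' [P [[N'g NN' nv'] [Pp Ph nP dich [killP [m hm]]]]]] :=
  maximal_nonvanishing Ng nv.
have [N's _] := N'g.
have [i nvi] : exists i, ~ vanish_diff t (diff i (hilb N')).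
  by apply: contrapT => h; apply: nv' => i; apply: contrapT => nvi; apply: h; exists i.
have [x xi xP] : exists2 x, x \in gens i & x \notin P.
  apply: contrapT => h; apply: nP.
  apply: (irrelevant_sub (proj1 Pp) (i := i)) => x xi.
  by apply: contrapT => /negP xP; apply: h; exists x.
have xF := gens_deg xi.
have e : diff i (hilb N') = hilb (add_mul N' x).
  apply/funext => nu; rewrite /diff {1}(hilb_exact _ N'g xF).
  suff -> : colon N' x = N' by rewrite addrK.
  apply/seteqP; split; first exact: dich xF xP.
  by move=> u; exact: msubZ.
rewrite e in nvi; have N'xg := gsub_add_mul N'g xF.
have [c [hc1 hc2]] := IH _ N'xg nvi.
exists (fun j => if (j <= t)%N then c j else P); split=> j hj.
  case: ifP => [/hc1[? ? ? [m' hm']]|_]; split=> //.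
    by exists m' => b /NN'/(@sub_add_mul _ x); exact: hm'.
  by exists m => b /NN'; exact: hm.
move: hj; rewrite ltnS => jt; rewrite jt; case: ltnP => [|tj]; first exact: hc2.
have [cp _ _ [m' hm']] := hc1 _ jt.
split=> [b bP|h]; first by apply: hm'; apply: sub_add_mul; exact: killP.
move/negP: xP; apply; apply: h; apply: hm'; exact: mem_add_mul.
Qed.

(** The primes become the closed sets V(c_i), irreducible because c_i is a generic point; decreasing
    primes give increasing closed sets, and a chain of length d + 1 contradicts the dimension. *)
Lemma vanish_of_dim d : dim_supp_pp BB M d -> vanish_diff d.+1 (hilb [set 0]).
Proof.
move=> [_ hd]; apply: contrapT => nv.
have [c [hc1 hc2]] := prime_chain (gsub0) nv.
pose V (P : {pred B}) := supp_pp BB M `&` [set Q : {pred B} | {subset P <= Q}].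
have hsupp i : (i <= d.+1)%N -> supp_pp BB M (c i).
  move=> /hc1[cp ch cn [m hm]]; split.
    by split=> //; exists m => b /negP nb e; apply: nb; apply: hm.
  by split=> //; exact: hom_homogeneous.
have hV i : (i <= d.+1)%N -> V (c i) (c i) by move=> hi; split=> //; exact: hsupp.
suff : (d.+1 <= d)%N by rewrite ltnn.
apply: (hd _ (fun i => V (c i))); split=> i hi; last first.
  have [cc ncc] := hc2 _ hi; split.
    by move=> Q [hQ h]; split=> // b /cc; exact: h.
  by move=> h; apply: ncc; have [_] := h _ (hV _ hi).
have [[P0 P1 PP] _] : prime_ideal (c i) by have [] := hc1 _ hi.
split; [|by exists (c i); exact: hV|].
  exists (c i); split=> //; last by have [_ [_ h _]] := hsupp _ hi.
move=> Z1 Z2 [J1 [_ _ ->]] [J2 [_ _ ->]] h.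
by case: (h _ (hV _ hi)) => -[_ hJ]; [left|right] => Q [hQ hcQ]; split=> // b /hJ;
  exact: hcQ.
Qed.

(** In large degrees [tors N] coincides with N by [tors_eventually]; the exponent is chosen to carry
    each component of m there. *)
Lemma tors_tors N : gsub N -> tors (tors N) `<=` tors N.
Proof.
move=> Ng m [k hk]; have [Ts Th] := gsub_tors Ng.
have [c hc] := tors_eventually Ng.
apply: (cmp_all_in hMg); [by case: Ts | by move=> a b; exact: msubD |].
move=> nu; exists (maxn k (c + abs_bound nu)) => mu hmu b bF.
rewrite -(scal_cmp _ _ bF); apply: (hc (degZ mu + nu)).
- move=> i; have := abs_boundP nu i; have := hmu i; rewrite !ffunE geq_max => /andP[_].
  by move: (nu i) (mu i) (abs_bound nu) => x y z; lia.
- exact: cmp_in.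
apply: Th; apply: hk bF => i; apply: leq_trans (hmu i); exact: leq_maxl.
Qed.

Lemma fin_gen_regular : fin_gen_module (B^o : lmodType B).
Proof.
exists [:: 1] => b; apply/asboolP => N [N0 NN] hN.
rewrite -[b]mulr1 -[_ * _]/(b *: (1 : B^o)) -[_ *: _]addr0; apply: NN => //.
by apply: hN; exact: mem_head.
Qed.

(* An element of (N : z) that is not torsion modulo N and whose annihilator is
   maximal has a prime annihilator not containing the irrelevant ideal. *)
Lemma colon_sub_tors N z : gsub N ->
  (forall (P : {pred B}) m, prime_ideal P -> (forall b, b \in P <-> N (b *: m)) ->
    ~ {subset irrelevant BB <= P} -> z \notin P) ->
  colon N z `<=` tors N.
Proof.
move=> Ng hz; have [Ns _] := Ng; have [Ts _] := gsub_tors Ng.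
apply: contrapT => /asboolPn/existsp_asboolPn[m0 /asboolPn/imply_asboolPn[zm0 nm0]].
pose ann m : set (B^o : lmodType B) := [set b | N ((b : B) *: m)].
have anns m : msub (ann m).
  split; first by rewrite /ann /= scale0r; case: Ns.
  move=> b u v Nu Nv; rewrite /ann /= -[b *: u]/(b * u) scalerDl -scalerA.
  by case: Ns => _; exact.
have [||I [[m [zm nm] eI] _ maxI]] := @maximal_msub _ _ _ hA fin_gen_regular _ hs2
  [set I | exists2 m, colon N z m /\ ~ tors N m & I = ann m] (ann m0).
- by move=> _ [m _ ->].
- by exists m0.
have maxm m' : colon N z m' -> ~ tors N m' -> ann m `<=` ann m' ->
    ann m' `<=` ann m.
  by move=> zm' nm'; rewrite -eI; apply: maxI; exists m'.
pose P : {pred B} := fun b => `[< N (b *: m) >].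
have inP b : b \in P <-> N (b *: m) by split=> [/asboolP|h]; last exact/asboolP.
have hzs : msub (colon N z) by exact: msub_colon.
have : z \notin P.
  apply: (hz P m) => // [|irrP]; last first.
    by apply: nm; exists 1%N => mu hmu b bF; apply/inP/irrP; exact: irrelevant_BB bF hmu.
  split; [split|].
  - by apply/inP; rewrite scale0r; case: Ns.
  - by apply/negP => /inP; rewrite scale1r => /(sub_tors Ns).
  - move=> a u v /inP hu /inP hv; apply/inP.
    by rewrite scalerDl -scalerA; case: Ns => _; exact.
  move=> b c /inP hbc; apply/orP; have [bP|bP] := boolP (b \in P); [by left | right].
  (* If b m is not torsion, maximality gives ann(b m) = ann(m), so c kills m modulo N. If it is,
     some y m with y of large degree is not torsion, for otherwise m would be, by [tors_tors]; but
     then b kills y m, hence m by maximality. *)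
  apply/inP; have [tbm|ntbm] := pselect (tors N (b *: m)); last first.
    apply: (maxm (b *: m) _ ntbm); first exact: msubZ.
      move=> u um; rewrite /ann /= scalerA mulrC -scalerA; exact: msubZ.
    by rewrite /ann /= scalerA mulrC.
  have [k hk] := tbm; exfalso; apply: nm; apply: tors_tors => //.
  exists k => mu hmu y yF; apply: contrapT => ntym.
  move/negP: bP; apply; apply/inP.
  apply: (maxm (y *: m) _ ntym); first exact: msubZ.
    move=> u um; rewrite /ann /= scalerA mulrC -scalerA; exact: msubZ.
  by rewrite /ann /= scalerA mulrC -scalerA; exact: hk yF.
by move/negP; apply; apply/inP.
Qed.

Lemma filter_step N z i : gsub N -> z \in BB U_(i)%MM ->
  (forall (P : {pred B}) m, prime_ideal P -> (forall b, b \in P <-> N (b *: m)) ->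
    ~ {subset irrelevant BB <= P} -> z \notin P) ->
  evz (fun nu => hilb (add_mul N z) nu - diff i (hilb N) nu).
Proof.
move=> Ng zF hz; have [c hc] := tors_eventually Ng.
have ct := colon_sub_tors Ng hz; have [Ns _] := Ng.
(* The extra 1 keeps nu - e_i in the range where torsion modulo N vanishes. *)
exists (c%:Z + 1) => nu hnu.
rewrite /diff (hilb_exact nu Ng zF).
suff -> : hilb (colon N z) (nu - degZ U_(i)%MM) = hilb N (nu - degZ U_(i)%MM).
  by rewrite addrK subrr.
congr (Posz (len _ - len _)%N); apply/seteqP; split=> m [mF Nm]; split=> //.
  apply: (hc _ _ m mF); last exact: ct.
  move=> j; have := hnu j; rewrite !ffunE mnmE.
  by move: (nu j) => x; case: eqP => _; lia.
exact: msubZ.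
Qed.

Definition mul_seq (zs : seq B) : set M := [set m | m \in seq_submod M zs].

Lemma seq_submodZ zs (N : {pred M}) : GRing.submod_closed N ->
  (forall z m, z \in zs -> z *: m \in N) -> forall m, mul_seq zs m -> m \in N.
Proof.
by move=> Ns hN m /asboolP; apply=> // _ [z zzs [u ->]]; exact: hN.
Qed.

Lemma mul_seq_nil : mul_seq [::] = [set 0].
Proof.
apply/seteqP; split=> [m|_ ->]; last exact: (@rpred0 M (seq_submod M [::])).
move=> /(@seq_submodZ _ (fun m => m == 0)) h; apply/eqP; apply: h => //.
split=> [|a u v]; rewrite -!topredE //= => /eqP -> /eqP ->.
by rewrite scaler0 addr0.
Qed.

Lemma mul_seq_gen zs z m : z \in zs -> mul_seq zs (z *: m).
Proof. by move=> zzs; apply/asboolP => N _; apply; exists z => //; exists m. Qed.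

Lemma mul_seq_rcons zs z : mul_seq (rcons zs z) = add_mul (mul_seq zs) z.
Proof.
have Ss : msub (mul_seq zs).
  split; first exact: (@rpred0 M (seq_submod M zs)).
  by move=> b u v hu hv; apply: (@rpredD M (seq_submod M zs)) => //; exact: rpredZ.
have Sz := msub_add_mul z Ss.
have addz := @sub_add_mul (mul_seq zs) z.
apply/seteqP; split=> [m hm|_ [u [_ [hu [v _ <-] ->]]]].
  suff /asboolP : m \in (fun m => `[< add_mul (mul_seq zs) z m >]) by [].
  apply: seq_submodZ hm.
    case: Sz => S0 SS; split=> [|a u v /asboolP hu /asboolP hv]; apply/asboolP => //.
    exact: SS.
  move=> y u; rewrite mem_rcons inE => /orP[/eqP ->|yzs]; apply/asboolP.
    exact: mem_add_mul.
  by apply: addz; exact: mul_seq_gen.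
apply: (@rpredD M (seq_submod M (rcons zs z))).
  apply: seq_submodZ hu => [|y w yzs]; first exact: submod_span_closed.
  by apply: mul_seq_gen; rewrite mem_rcons inE yzs orbT.
by apply: mul_seq_gen; rewrite mem_rcons inE eqxx.
Qed.

(** Elements are added at the end, since each is filter-regular modulo its predecessors; w records
    their degrees, and each costs one difference by [filter_step]. *)
Lemma hilb_filter_seq zs w :
  all2 (fun (z : B) (i : 'I_r) => z \in BB U_(i)%MM) zs w ->
  filter_regular_seq BB M zs ->
  gsub (mul_seq zs) /\
  evz (fun nu => hilb (mul_seq zs) nu - diffs w (hilb [set 0]) nu).
Proof.
elim/last_ind: zs w => [|zs z IH] w.
  case: w => // _ _; rewrite mul_seq_nil; split; first exact: (gsub0).
  by exists 0 => nu _; rewrite subrr.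
case/lastP: w => [|w i]; first by case: zs {IH}.
rewrite !all2E !size_rcons eqSS => /andP[/eqP szw].
rewrite zip_rcons // all_rcons /= => /andP[zF hall] hf.
have [||Ng hev] := IH w.
- by rewrite all2E szw eqxx.
- move=> j hj; have := hf j; rewrite size_rcons nth_rcons hj -cats1.
  by rewrite takel_cat; [apply; exact: ltnW | exact: ltnW].
have hz := hf (size zs); rewrite size_rcons nth_rcons ltnn eqxx in hz.
have {}hz := hz (leqnn _).
rewrite -cats1 take_size_cat // in hz.
rewrite mul_seq_rcons; split; first exact: gsub_add_mul Ng zF.
rewrite /diffs foldl_rcons -/(diffs w _).
have fz : forall (P : {pred B}) m, prime_ideal P ->
    (forall b, b \in P <-> mul_seq zs (b *: m)) ->
    ~ {subset irrelevant BB <= P} -> z \notin P.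
  move=> P m Pp hP nP; apply: hz => //; split=> //.
  exists (quot_pi _ m) => b; rewrite hP.
  by rewrite -[b *: quot_pi _ m]/(quot_scale b _) quot_scaleE quot_pi_eq0.
apply: evz_ext (evzD (filter_step Ng zF fz) (evz_diff i hev)) => nu.
by rewrite diffB addrA subrK.
Qed.

(** Compares powers of the irrelevant ideal with the degree condition of [tors]: one direction is
    [BB_ideal_pow]; for the other, a product of k elements of the ideal only has components in
    degrees at least (k, ..., k). *)
Lemma torsion_tors zs (m : M) : gsub (mul_seq zs) ->
  (quot_pi (seq_submod M zs) m \in torsion (quot_mod (seq_submod M zs)) (irrelevant BB))
  <-> tors (mul_seq zs) m.
Proof.
move=> [Ss Sh].
have E b : b *: quot_pi (seq_submod M zs) m = 0 <-> mul_seq zs (b *: m).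
  by rewrite -[b *: quot_pi _ m]/(quot_scale b _) quot_scaleE quot_pi_eq0.
split=> [/asboolP[k hk]|[k hk]].
  exists k => mu hmu b bF; apply/E; apply: hk.
  exact: (BB_ideal_pow bF hmu).
apply/asboolP; exists k => b /asboolP hb; apply/E.
suff /asboolP : b \in (fun b : B => `[< mul_seq zs (b *: m) >]) by [].
apply: hb.
  split=> [|a u v /asboolP hu /asboolP hv]; apply/asboolP.
    by rewrite scale0r; case: Ss.
  rewrite -[a *: u]/(a * u) scalerDl -scalerA; case: Ss => _; exact.
move=> _ [l [sl lI ->]]; apply/asboolP.
elim: k l sl m {E} hk lI => [|k IH] [|x l] //= sl m' hk lI.
  rewrite big_nil; apply: (hk 0%MM) => //; by case: hBB.
rewrite big_cons mulrC -scalerA; apply: IH; first by case: sl.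
  move=> mu hmu y yF.
  have /asboolP[t [f [_ tF ->]]] := lI x (mem_head _ _).
  rewrite scalerA mulr_sumr scaler_suml big_seq.
  elim/big_ind: _ => [|u v|nu nt]; first by case: Ss.
    exact: msubD.
  have := tF nu nt; rewrite !inE => /andP[fF /forallP hnu].
  apply: (hk (mu + nu)%MM); last by case: hBB => _ _; exact.
  by move=> i; rewrite mnmDE -addn1 leq_add.
by move=> y yl; apply: lI; rewrite inE yl orbT.
Qed.

(** A single i suffices: elements of degree at least (1, ..., 1) are combinations of generators of
    degree e_i, so they map m into [tors N], and torsion is idempotent. *)
Lemma tors_saturated N i m : gsub N ->
  (forall x, x \in gens i -> tors N (x *: m)) -> tors N m.
Proof.
move=> Ng hx; have [Ts _] := gsub_tors Ng.
apply: (tors_tors Ng); exists 1%N => mu hmu b bF.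
apply: (kill_gens (i := i) Ts bF (hmu i)) => x c xi cF.
by rewrite scalerA mulrC -scalerA; apply: msubZ => //; exact: hx.
Qed.

(** * Torsion-free quotients: bounded Hilbert function and dimension at most r *)

Section Saturated.
Variable T : set M.
Hypothesis Tg : gsub T.
Hypothesis Tsat : forall i m, (forall x, x \in gens i -> T (x *: m)) -> T m.
Let Ts : msub T. Proof. by case: Tg. Qed.
Let Tb : bsub T. Proof. exact: msub_bsub. Qed.

(** W/T maps to one copy of W'/T for each element of l, and the last term is the kernel of this
    map. *)
Lemma rlen_kill (l : seq B) (W W' : set M) : fin_len W -> fin_len W' ->
  (forall x m, x \in l -> W m -> W' (x *: m)) ->
  (rlen T W <= size l * rlen T W' +
     rlen T (W `&` [set m | forall x, x \in l -> T (x *: m)]))%N.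
Proof.
move=> Wf Wf'; have Wb := fin_len_bsub Wf; elim: l => [|x l IH] hl.
  by rewrite mul0n add0n; apply: eq_leq; congr rlen; apply/seteqP; split=> // m [].
apply: (leq_trans (IH _)) => [y m yl Wm|]; first by apply: hl; rewrite // inE yl orbT.
set U := W `&` _; set U' := W `&` _.
have Ub : bsub U.
  apply: bsubI => //; split=> [y _|a u v hu hv y yl]; first by rewrite scaler0; case: Ts.
  by rewrite blin_scale; apply: (proj2 Tb); [exact: hu | exact: hv].
have Uf : fin_len U by exact: fin_len_sub Ub (@subIsetl _ _ _) Wf.
have Cs := msub_colon x Ts.
rewrite (rlen_trans Tb (msub_bsub Cs) Uf); last by move=> m; exact: msubZ.
have -> : U `&` colon T x = U'.
  apply/seteqP; split=> m.
    move=> [[Wm h] h']; split=> // y; rewrite inE => /orP[/eqP -> //|]; exact: h.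
  move=> [Wm h]; split; last by apply: h; rewrite mem_head.
  by split=> // y yl; apply: h; rewrite inE yl orbT.
rewrite -[colon T x]/( *:%R x @^-1` T) -(rlen_image (blin_scale x) Tb Uf).
have : (rlen T ( *:%R x @` U) <= rlen T W')%N.
  apply: rlen_le => //; first exact: (bsub_image (blin_scale x)).
  by move=> _ [m [Wm _] <-]; apply: hl => //; rewrite mem_head.
by rewrite /=; lia.
Qed.

(** By [Tsat], multiplication by the generators of degree e_i, at most [size s] in number, has no
    kernel on (M/T)_nu. *)
Lemma hilb_step i nu : hilb T nu <= (size s)%:Z * hilb T (degZ U_(i)%MM + nu).
Proof.
rewrite /hilb -PoszM lez_nat.
apply: leq_trans (rlen_kill (l := gens i) (finM nu) (finM (degZ U_(i)%MM + nu)) _) _.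
  by move=> x m xi mF; apply: MMZ => //; exact: gens_deg xi.
rewrite [X in (_ + X)%N](_ : _ = 0%N); last first.
  apply/rlen_eq0 => //; last by move=> m [_ /Tsat].
  apply: fin_len_sub (finM nu) => //; apply: bsubI; first exact: (bsub_MM).
  split=> [y _|a u v hu hv y yl]; first by rewrite scaler0; case: Ts.
  by rewrite blin_scale; apply: (proj2 Tb); [exact: hu | exact: hv].
rewrite addn0 leq_mul2r; apply/orP; right.
by apply: (leq_trans (size_subseq (filter_subseq _ _))); exact: size_undup.
Qed.

Lemma hilb_steps mu nu : hilb T nu <= (size s ^ mdeg mu)%:Z * hilb T (degZ mu + nu).
Proof.
elim/mnm_ind: mu nu => [|i mu IH] nu.
  by rewrite degZ0 add0r mdeg0 expn0 mul1r.
apply: le_trans (hilb_step i nu) _; rewrite mdegD mdeg1 expnS PoszM -mulrA.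
by apply: ler_wpM2l => //; rewrite addmC degZD -addrA; exact: IH.
Qed.

Lemma hilb_bounded c : evz (fun nu => hilb T nu - c) ->
  exists C : nat, forall nu, hilb T nu <= C%:Z.
Proof.
move=> [c0 hc]; have [k hk] := degrees_bounded_below.
(* Adding j to all coordinates moves a degree >= -k beyond c0, where the value is c. *)
pose j := (k + `|c0|)%N; pose mu : 'X_{1..r} := [multinom j | i < r].
exists (size s ^ mdeg mu * `|c|)%N => nu.
have [hnu|hnu] := pselect (forall i, - k%:Z <= nu i).
  apply: le_trans (hilb_steps mu nu) _; rewrite PoszM; apply: ler_wpM2l => //.
  rewrite (_ : hilb T _ = c); first by rewrite abszE ler_norm.
  apply/eqP; rewrite -subr_eq0; apply/eqP; apply: hc => i.
  by have := hnu i; rewrite !ffunE mnmE /j; move: (nu i) => x; lia.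
rewrite (hilb_eq0 Ts) // => m mF.
have [->|m0] := pselect (m = 0); first by case: Ts.
by case: hnu; exact: hk mF m0.
Qed.

Definition annT K : set (B^o : lmodType B) := [set b | forall m, K m -> T ((b : B) *: m)].

Lemma msub_annT K : msub (annT K).
Proof.
split=> [m _|b u v hu hv m Km]; first by rewrite scale0r; case: Ts.
rewrite -[b *: u]/(b * u) scalerDl -scalerA.
by apply: (proj2 Ts); [exact: hu | exact: hv].
Qed.

(** The filtration of B by total degree, against which growth is measured. *)
Definition Bupto n : set (B^o : lmodType B) :=
  dsum (V := (B^o : lmodType B)) BB (mnm_upto r n).

Lemma fin_len_Bupto n : fin_len (Bupto n).
Proof. exact: (fin_len_dsum (V := (B^o : lmodType B)) hBg fin_len_BB). Qed.

Lemma mem_Bupto n b : Bupto n b <-> forall mu, (n < mdeg mu)%N -> cmp BB mu b = 0.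
Proof.
by split=> h mu hmu; apply: h; move: hmu; rewrite mem_mnm_upto -ltnNge.
Qed.

Lemma Bupto_mono n n' : (n <= n')%N -> Bupto n `<=` Bupto n'.
Proof.
move=> nn' b /mem_Bupto h; apply/mem_Bupto => mu hmu; apply: h.
exact: leq_ltn_trans hmu.
Qed.

Lemma Bupto_exists b : exists n, Bupto n b.
Proof.
exists (\max_(mu <- gsupp BB b) mdeg mu)%N; apply/mem_Bupto => mu hmu.
apply: (cmp_notin hBg); apply: contraL hmu => hs; rewrite -leqNgt.
exact: leq_bigmax_seq.
Qed.

Lemma BuptoM n n' b b' : Bupto n b -> Bupto n' b' -> Bupto (n + n') (b * b').
Proof.
move=> /mem_Bupto h /mem_Bupto h'; apply/mem_Bupto => mu hmu.
rewrite (cmp_sum_supp hBg b) (cmp_sum_supp hBg b') mulr_suml cmp_bigsum //.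
rewrite big1 // => g _; rewrite mulr_sumr cmp_bigsum // big1 // => g' _.
have [gn|gn] := ltnP n (mdeg g); first by rewrite h // mul0r cmp0.
have [gn'|gn'] := ltnP n' (mdeg g'); first by rewrite h' // mulr0 cmp0.
apply: (cmp_neq hBg (BBM (cmp_in hBg g b) (cmp_in hBg g' b'))).
by apply: contraTneq hmu => ->; rewrite mdegD -leqNgt leq_add.
Qed.

(** Adjoining g to K enlarges B/(T : K) by at most the image of B g in M/T. Elements of degree at
    most n carry g into at most (n + 1)^r degrees, each of length at most C. *)
Lemma rlen_annT_bound (C : nat) : (forall nu, hilb T nu <= C%:Z) ->
  exists D : nat, forall n, (rlen (annT setT) (Bupto n) <= D * n.+1 ^ r)%N.
Proof.
move=> hC.
apply: (@graded_ind (fun K => exists D : nat, forall n,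
  (rlen (annT K) (Bupto n) <= D * n.+1 ^ r)%N) T) => //.
  exists 0%N => n; rewrite leqn0; apply/eqP/rlen_eq0.
  - exact: (msub_bsub (msub_annT T)).
  - exact: fin_len_Bupto.
  by move=> b _ m Tm; exact: msubZ.
move=> K delta g Kg TK _ [D hD] gF _; exists (D + C)%N => n; rewrite mulnDl.
pose J : set (B^o : lmodType B) := (fun b : (B^o : lmodType B) => (b : B) *: g) @^-1` T.
have Jb : bsub J by exact: (bsub_preimage (blin_act g) Tb).
have Kb := msub_bsub (msub_annT K); have Wf := fin_len_Bupto n.
have WKf := fin_lenI Kb Wf.
have eK : annT (add_gen K g) = annT K `&` J.
  apply/seteqP; split=> [b hb|b [hb hg] _ [u [_ [Ku [b' _ <-] ->]]]].
    split=> [m Km|]; apply: hb.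
      by exists m, 0; rewrite addr0; split=> //; exists 0; rewrite ?scale0r.
    exists 0, g; rewrite add0r; split=> //; first by case: Kg => -[].
    by exists 1; rewrite ?scale1r.
  rewrite scalerDr; apply: msubD => //; first exact: hb.
  by rewrite scalerA mulrC -scalerA; exact: msubZ.
have -> : rlen (annT (add_gen K g)) (Bupto n) =
    (rlen (annT K) (Bupto n) + rlen J (Bupto n `&` annT K))%N.
  rewrite eK (rlen_trans (bsubI Kb Jb) Kb Wf (@subIsetl _ _ _)); congr addn.
  congr (len _ - len _)%N; apply/seteqP.
  by split=> [b [? [_ ?]]//|b [[? ?] ?]].
apply: leq_add; first exact: hD.
apply: leq_trans (rlen_le Jb (fin_len_bsub WKf) Wf (@subIsetl _ _ _)) _.
rewrite -(rlen_image (blin_act g) Tb Wf).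
pose S := [seq degZ mu + delta | mu <- mnm_upto r n].
have hMf := fin_len_dsum hMg finM S.
have uS : uniq S.
  by rewrite map_inj_uniq ?mnm_upto_uniq // => mu mu' /addIr/degZ_inj.
apply: (@leq_trans (rlen T (dsum MM S))).
  apply: rlen_le => //; first by apply: bsub_image; [exact: blin_act|exact: fin_len_bsub].
  move=> _ [b hb <-] nu hnu; have [//|[mu [enu ->]]] := act_cmpP nu b gF.
  rewrite hb ?scale0r //; apply: contra hnu => hmu.
  by apply/mapP; exists mu.
rewrite (rlen_dsum hMg finM Tb _ uS); last by case: Tg.
apply: (@leq_trans (\sum_(nu <- S) C)).
  by apply: leq_sum => nu _; have := hC nu; rewrite /hilb lez_nat.
rewrite big_const_seq count_predT iter_addn_0 leq_mul2l; apply/orP; right.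
by rewrite size_map; exact: size_mnm_upto.
Qed.

(* The lower bound for the Gelfand-Kirillov dimension: a multiple of x in P_1
   but not in P_0 determines its cofactor modulo P_0. *)
Lemma prime_chain_growth l (c : nat -> {pred B}) :
  (forall i, (i <= l)%N -> prime_ideal (c i)) ->
  (forall i, (i < l)%N -> pred_proper (c i) (c i.+1)) ->
  exists a, forall m, ('C(m + l, l) <=
    rlen ([set b | b \in c 0%N] : set (B^o : lmodType B)) (Bupto (a * m)))%N.
Proof.
elim: l c => [|l IH] c hp hc.
  exists 0%N => m; rewrite bin0 lt0n; apply/eqP => /rlen_eq0 h.
  have [[c0 c1 cc] _] := hp 0%N isT.
  move/negP: c1; apply; apply: (h _ (fin_len_Bupto _)).
    by split=> // b u v cu cv; exact: cc.
  apply/mem_Bupto => mu; rewrite mul0n => hmu; apply: (cmp_neq hBg (g := 0%MM)).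
    by case: hBB.
  by apply: contraTneq hmu => ->; rewrite mdeg0.
have [||a ha] := IH (fun i => c i.+1).
- by move=> i hi; exact: hp.
- by move=> i hi; exact: hc.
have [c01 nc01] := hc 0%N isT.
have [x x1 x0] : exists2 x, x \in c 1%N & x \notin c 0%N.
  apply: contrapT => h; apply: nc01 => x x1; apply: contrapT => /negP x0.
  by apply: h; exists x.
(* b dominates both the rate a of the shorter chain and the degree of x, so multiplication by x maps
   level b m into level b (m + 1). *)
have [a' xa'] := Bupto_exists x; pose b := maxn a a'; exists b.
have [P0 pr0] := hp 0%N isT; have [P1 pr1] := hp 1%N isT.
have bs i : idealr_closed (c i) -> bsub ([set y | y \in c i] : set (B^o : lmodType B)).
  by move=> [c0 _ cc]; split=> // a0 u v cu cv; exact: cc.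
have bs0 := bs _ P0; have bs1 := bs _ P1.
elim=> [|m IHm].
  rewrite muln0 add0n binn lt0n; apply/eqP => /rlen_eq0 h.
  move/negP: (ideal1 P0); apply; apply: (h bs0 (fin_len_Bupto _)).
  apply/mem_Bupto => mu hmu; apply: (cmp_neq hBg (g := 0%MM)); first by case: hBB.
  by apply: contraTneq hmu => ->; rewrite mdeg0.
have Wf := fin_len_Bupto (b * m.+1); have Wf' := fin_len_Bupto (b * m).
(* Pascal's rule: B/P_1 accounts for one summand by the induction on l, and P_1/P_0 for the other by
   the induction on m, as it contains x (B/P_0). *)
rewrite (rlen_trans bs0 bs1 Wf c01) addSn binS addnC.
apply: leq_add.
  rewrite addnS -addSn; apply: leq_trans (ha m.+1) _.
  apply: rlen_le => //; first exact: fin_len_bsub (fin_len_Bupto _).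
  by apply: Bupto_mono; rewrite leq_mul2r leq_maxl orbT.
apply: leq_trans IHm _.
have {1}-> : [set y | y \in c 0%N] =
    *:%R x @^-1` ([set y | y \in c 0%N] : set (B^o : lmodType B)).
  apply/seteqP; split=> y /= cy; first exact: idealMr.
  by have /orP[xc|//] := pr0 _ _ cy; rewrite xc in x0.
rewrite -(rlen_image (blin_scale x) bs0 Wf').
apply: rlen_le => //; first by apply: (bsub_image (blin_scale x)); exact: fin_len_bsub.
  exact: fin_lenI.
move=> _ [y Wy <-]; split; last exact: idealMl.
have : Bupto (a' + b * m) (x * y) by exact: BuptoM.
by apply: Bupto_mono; rewrite mulnS leq_add2r leq_maxr.
Qed.

(** A chain of length r + 1 would make B/Ann(M/T) grow like m^(r+1), but it is O(m^r); the
    contradiction is read off at m equal to the constant of the comparison. *)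
Lemma krull_upper (C : nat) l (c : nat -> {pred B}) :
  (forall nu, hilb T nu <= C%:Z) ->
  (forall i, (i <= l)%N -> prime_ideal (c i)) ->
  (forall i, (i < l)%N -> pred_proper (c i) (c i.+1)) ->
  (forall b, (forall m, T (b *: m)) -> b \in c 0%N) -> (l <= r)%N.
Proof.
move=> hC hp hc hann; rewrite leqNgt; apply/negP => rl.
have [||a ha] := @prime_chain_growth r.+1 c.
- by move=> i hi; apply: hp; exact: leq_trans rl.
- by move=> i hi; apply: hc; exact: leq_trans rl.
have [D hD] := rlen_annT_bound hC.
have [P0 _] := hp 0%N isT.
have Pb : bsub ([set y | y \in c 0%N] : set (B^o : lmodType B)).
  by case: P0 => c0 _ cc; split=> // a0 u v cu cv; exact: cc.
pose a' := a.+1.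
have H m : (m.+1 <= r.+1`! * D * a' ^ r)%N.
  have h1 : ('C(m + r.+1, r.+1) <= D * (a * m).+1 ^ r)%N.
    apply: leq_trans (ha m) _; apply: leq_trans (hD (a * m)%N).
    rewrite (rlen_trans (msub_bsub (msub_annT setT)) Pb (fin_len_Bupto _)) ?leq_addr //.
    by move=> b hb; apply: hann => m'; exact: hb.
  have h2 : (m.+1 ^ r.+1 <= 'C(m + r.+1, r.+1) * r.+1`!)%N.
    rewrite bin_ffact; elim: (r.+1) => [|q IHq]; first by rewrite ffactn0.
    by rewrite addnS ffactnS expnS leq_mul // ltnS leq_addr.
  have h3 : ((a * m).+1 ^ r <= a' ^ r * m.+1 ^ r)%N.
    rewrite -expnMn; have [r0|r0] := posnP r; first by rewrite r0 !expn0.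
    by rewrite leq_exp2r // /a' mulSn mulnS; lia.
  have : (m.+1 * m.+1 ^ r <= (r.+1`! * D * a' ^ r) * m.+1 ^ r)%N.
    move: (r.+1`!) h2 => F h2; rewrite -expnS; apply: (leq_trans h2).
    rewrite [X in (X <= _)%N]mulnC -!mulnA leq_mul2l; apply/orP; right.
    by apply: (leq_trans h1); rewrite leq_mul2l h3 orbT.
  by rewrite leq_pmul2r // expn_gt0.
by have := H (r.+1`! * D * a' ^ r)%N; rewrite ltnn.
Qed.

(** * The chain of primes over P along the coordinates *)

Section CoordinateChain.
Variable P : {pred B}.
Hypotheses (Pp : prime_ideal P) (Ph : hom BB [set b | b \in P]).
Hypothesis nP : ~ {subset irrelevant BB <= P}.

(* The kernel of the composition of B -> B/P with the projection onto the
   degrees whose first j coordinates are zero. *)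
Definition coord_prime (j : nat) : {pred B} := fun b => `[< forall mu,
  (forall i : 'I_r, (i < j)%N -> mu i = 0%N) -> cmp BB mu b \in P >].

Let P1 : idealr_closed P. Proof. by case: Pp. Qed.

Lemma coord_primeP j b : b \in coord_prime j <-> forall mu,
  (forall i : 'I_r, (i < j)%N -> mu i = 0%N) -> cmp BB mu b \in P.
Proof. by split=> [/asboolP|h]; last exact/asboolP. Qed.

Lemma sub_coord_prime j : {subset P <= coord_prime j}.
Proof. by move=> b bP; apply/coord_primeP => mu _; exact: Ph bP mu. Qed.

Lemma coord_prime_prime j : prime_ideal (coord_prime j).
Proof.
have [_ B1 _] := hBB.
have idl : idealr_closed (coord_prime j).
  split.
  - exact/sub_coord_prime/ideal0.
  - apply/negP => /coord_primeP/(_ 0%MM); rewrite (cmp_id hBg B1).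
    by move=> h; move/negP: (ideal1 P1); apply; apply: h => i _; rewrite mnm0E.
  move=> a u v /coord_primeP hu /coord_primeP hv; apply/coord_primeP => mu hmu.
  rewrite cmpD //; apply: (idealD P1); last exact: hv.
  rewrite (cmp_sum_supp hBg a) mulr_suml cmp_bigsum //; apply: (ideal_sum P1) => g _.
  have [[g' e]|ne] := pselect (exists g', mu = (g + g')%MM).
    rewrite e (mul_cmp _ _ (cmp_in hBg g a)); apply: (idealMr P1); apply: hu.
    by move=> i ij; have := hmu i ij; rewrite e mnmDE; case: (g i) => //; case: (g' i).
  rewrite (mul_cmp0 _ (cmp_in hBg g a)) ?(ideal0 P1) // => g' e.
  by apply: ne; exists g'.
apply: (graded_prime hBB) => //.
  move=> b /coord_primeP hb mu; apply/coord_primeP => nu hnu.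
  have [e|ne] := eqVneq nu mu.
    by rewrite -e (cmp_id hBg (cmp_in hBg nu b)); exact: hb.
  by rewrite (cmp_neq hBg (cmp_in hBg mu b) ne) (ideal0 P1).
move=> mu nu x y xF yF /coord_primeP hxy.
(* An element of degree nonzero in one of the first j coordinates projects to 0; on the remaining
   degrees the condition is that of P. *)
have pos la w : w \in BB la -> (exists2 i : 'I_r, (i < j)%N & la i <> 0%N) ->
    w \in coord_prime j.
  move=> wF [i ij li]; apply/coord_primeP => g hg.
  rewrite (cmp_neq hBg wF) ?(ideal0 P1) //; apply/eqP => e.
  by apply: li; rewrite -e; exact: hg.
have [hmu|hmu] := pselect (exists2 i : 'I_r, (i < j)%N & mu i <> 0%N).
  by left; exact: pos xF hmu.
have [hnu|hnu] := pselect (exists2 i : 'I_r, (i < j)%N & nu i <> 0%N).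
  by right; exact: pos yF hnu.
have := hxy (mu + nu)%MM; rewrite (cmp_id hBg (BBM xF yF)) => h.
have /(proj2 Pp)/orP[xP|yP] : x * y \in P.
- apply: h => i ij; rewrite mnmDE.
  have -> : mu i = 0%N by apply: contrapT => ?; apply: hmu; exists i.
  by apply: contrapT => ?; apply: hnu; exists i.
- by left; exact: sub_coord_prime.
by right; exact: sub_coord_prime.
Qed.

(** A generator outside P, of degree the unit vector with index j, is in the larger prime but not in
    the smaller one. *)
Lemma coord_prime_proper j : (j < r)%N -> pred_proper (coord_prime j) (coord_prime j.+1).
Proof.
move=> jr; split.
  move=> b /coord_primeP hb; apply/coord_primeP => mu hmu; apply: hb => i ij.
  by apply: hmu; exact: leqW.
pose i0 := Ordinal jr.
have [x xi xP] : exists2 x, x \in gens i0 & x \notin P.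
  apply: contrapT => h; apply: nP.
  apply: (irrelevant_sub P1 (i := i0)) => x xi.
  by apply: contrapT => /negP xP; apply: h; exists x.
have xF := gens_deg xi.
move=> h; have : x \in coord_prime j.
  apply: h; apply/coord_primeP => mu hmu; rewrite (cmp_neq hBg xF) ?(ideal0 P1) //.
  by apply/eqP => e; have := hmu i0 (ltnSn j); rewrite e mnmE eqxx.
move=> /coord_primeP/(_ U_(i0)%MM); rewrite (cmp_id hBg xF) => hx.
move/negP: xP; apply; apply: hx => i ij; rewrite mnmE.
by case: eqP => // e; move: ij; rewrite -e ltnn.
Qed.

End CoordinateChain.

End Saturated.

(** * Total degrees and the multiplicity of E *)

Section TotalDegree.
Hypothesis hr : (0 < r)%N.

Definition total (n : int) : set M := [set m | m \in total_component MM n].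

Lemma totalE n : total n = [set m | forall nu, total_deg nu != n -> cmp MM nu m = 0].
Proof.
apply/seteqP; split=> [_ /asboolP[l [f [_ lF ->]]] nu nun|m hm].
  rewrite cmp_bigsum // big_seq big1 // => g gl.
  have := lF g gl; rewrite !inE => /andP[fF /eqP gn].
  by apply: (cmp_neq hMg fF); apply: contra nun => /eqP ->; rewrite gn.
apply/asboolP; exists [seq nu <- gsupp MM m | total_deg nu == n], (cmp MM ^~ m); split.
- by apply: filter_uniq; exact: gsupp_uniq.
- by move=> g; rewrite mem_filter !inE => /andP[-> _]; rewrite cmp_in.
rewrite big_filter {1}(cmp_sum_supp hMg m) [RHS]big_mkcond.
by apply: eq_bigr => nu _; case: ifP => // /negbT /hm.
Qed.

Lemma total_cmp n m nu : total n m -> total_deg nu != n -> cmp MM nu m = 0.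
Proof. by rewrite totalE; exact. Qed.

Definition total_proj (n : int) (m : M) : M :=
  \sum_(nu <- gsupp MM m | total_deg nu == n) cmp MM nu m.

Lemma cmp_total_proj n m nu :
  cmp MM nu (total_proj n m) = if total_deg nu == n then cmp MM nu m else 0.
Proof.
rewrite /total_proj cmp_bigsum //; case: ifP => nun; last first.
  rewrite big1 // => g /eqP gn; apply: (cmp_neq hMg (cmp_in hMg g m)).
  by apply: contraFN nun => /eqP ->; rewrite gn.
have [ns|ns] := boolP (nu \in gsupp MM m); last first.
  rewrite (cmp_notin hMg ns) big_seq_cond big1 // => g /andP[gs _].
  apply: (cmp_neq hMg (cmp_in hMg g m)).
  by apply: contra ns => /eqP ->.
rewrite big_mkcond (bigD1_seq nu) ?gsupp_uniq //= nun.
rewrite (cmp_id hMg (cmp_in hMg nu m)) big1 ?addr0 // => g gn; case: ifP => // _.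
by apply: (cmp_neq hMg (cmp_in hMg g m)); rewrite eq_sym.
Qed.

Lemma total_projP n m : total n (total_proj n m).
Proof. by rewrite totalE => nu /negPf nun; rewrite cmp_total_proj nun. Qed.

Lemma hom_total_proj N n m : msub N -> hom MM N -> N m -> N (total_proj n m).
Proof.
move=> Ns Nh Nm; rewrite /total_proj; elim/big_ind: _ => [|u v|nu _].
- by case: Ns.
- exact: msubD.
- exact: Nh.
Qed.

(* M lives in the degrees at least (-k, ..., -k), see [degrees_bounded_below]. *)
Variable k : nat.
Hypothesis hk : forall nu m, m \in MM nu -> m <> 0 -> forall i, - k%:Z <= nu i.

Definition kvec : {ffun 'I_r -> int} := [ffun=> k%:Z].

(** As M lives above -k, translating by [kvec] indexes the degrees of a total component by
    monomials, at the cost of r k in the total degree. *)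
Lemma total_dsum d :
  total (d%:Z - (r * k)%N%:Z) = dsum MM [seq degZ mu - kvec | mu <- mnm_deg r d].
Proof.
have dk : total_deg kvec = (r * k)%N%:Z.
  rewrite /total_deg (eq_bigr (fun=> k%:Z)) => [|i _]; last by rewrite ffunE.
  by rewrite sumr_const card_ord -mulr_natl natz PoszM.
rewrite totalE; apply/seteqP; split=> m hm nu hnu; apply: contrapT => ne.
  have hnuk := hk (cmp_in hMg nu m) ne.
  have nuN : total_deg nu = d%:Z - (r * k)%N%:Z.
    by apply/eqP/negPn/negP => h; apply: ne; exact: hm.
  pose mu : 'X_{1..r} := [multinom `|(nu i + k%:Z)%R|%N | i < r].
  have e : nu = degZ mu - kvec.
    apply/ffunP => i; rewrite !ffunE mnmE; have := hnuk i.
    by move: (nu i) => x; lia.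
  move/mapP: hnu; apply; exists mu => //; rewrite mem_mnm_deg.
  by move: nuN; rewrite e total_degB total_degZ dk; move: (mdeg mu) => x; lia.
apply: ne; apply: hm; apply: contra hnu => /mapP[mu].
by rewrite mem_mnm_deg => /eqP dmu ->; rewrite total_degB total_degZ dk dmu.
Qed.

Lemma total_low n : n < - (r * k)%N%:Z -> total n = [set 0].
Proof.
move=> hn; rewrite totalE; apply/seteqP; split=> [m hm|_ -> nu _]; last exact: cmp0.
apply: (cmp_ext hMg) => nu; rewrite cmp0 //; apply: contrapT => ne.
have hnuk := hk (cmp_in hMg nu m) ne.
apply: ne; apply: hm; apply/eqP => nun.
have : - (r * k)%N%:Z <= total_deg nu.
  have -> : - (r * k)%N%:Z = \sum_(i < r) - k%:Z.
    by rewrite sumrN sumr_const card_ord -mulr_natl natz PoszM.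
  by apply: ler_sum => i _; exact: hnuk.
by rewrite nun; lia.
Qed.

Lemma fin_len_total n : fin_len (total n).
Proof.
have [hn|hn] := ltP n (- (r * k)%N%:Z).
  by rewrite total_low //; exact: fin_len0.
have -> : n = `|(n + (r * k)%N%:Z)%R|%N%:Z - (r * k)%N%:Z by lia.
by rewrite total_dsum; exact: fin_len_dsum.
Qed.

(* The Hilbert function of (M/N)^gr. *)
Definition total_hilb N n : int := (rlen N (total n))%:Z.

Lemma total_hilb_low N n : n < - (r * k)%N%:Z -> total_hilb N n = 0.
Proof. by move=> hn; rewrite /total_hilb total_low // /rlen len0. Qed.

Lemma total_hilb_sum N (d : nat) : gsub N ->
  total_hilb N (d%:Z - (r * k)%N%:Z) =
  \sum_(mu <- mnm_deg r d) hilb N (degZ mu - kvec).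
Proof.
move=> [Ns Nh]; rewrite /total_hilb total_dsum rlen_dsum //; last first.
- by rewrite map_inj_uniq ?mnm_deg_uniq // => mu nu /addIr/degZ_inj.
- exact: msub_bsub.
by rewrite big_map (big_morph Posz PoszD (erefl 0%:Z)).
Qed.

Lemma total_hilb_exact N x i n : gsub N -> x \in BB U_(i)%MM ->
  total_hilb N n = total_hilb (add_mul N x) n + total_hilb (colon N x) (n - 1).
Proof.
move=> [Ns Nh] xF; rewrite /total_hilb -PoszD; congr Posz.
have e1 : total_deg (degZ U_(i)%MM : {ffun 'I_r -> int}) = 1 by rewrite total_degZ mdeg1.
apply: rlen_exact => //; try exact: fin_len_total.
  move=> _ [m hm <-]; rewrite totalE => nu nun; rewrite (scal_cmpB _ _ xF).
  rewrite (total_cmp hm) ?scaler0 // total_degB e1; apply: contra nun => /eqP h.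
  by apply/eqP; lia.
move=> m [hm [u [_ [Nu [v _ <-] e]]]].
exists (x *: total_proj (n - 1) v), (total_proj n u); split.
- by exists (total_proj (n - 1) v) => //; exact: total_projP.
- by split; [exact: total_projP | exact: hom_total_proj].
apply: (cmp_ext hMg) => nu; rewrite cmpD // (scal_cmpB _ _ xF) !cmp_total_proj.
rewrite total_degB e1 (inj_eq (addIr (-1))); case: ifP => nun.
  by rewrite -(scal_cmpB _ _ xF) -cmpD // addrC -e.
by rewrite scaler0 addr0 (total_cmp hm) // nun.
Qed.

Let e1 i : total_deg (degZ U_(i)%MM : {ffun 'I_r -> int}) = 1.
Proof. by rewrite total_degZ mdeg1. Qed.

Lemma diff_total h i : diff i (fun nu => h (total_deg nu)) =
  fun nu => bdiff h (total_deg nu).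
Proof. by apply/funext => nu; rewrite /diff /bdiff total_degB e1. Qed.

(** The argument of [maximal_nonvanishing], for the total degree: at a maximal counterexample K all
    generators kill M/K, which then vanishes in large total degree. Functions of the total degree
    are viewed on Z^r so that [vanish_diff] applies. *)
Lemma total_hilb_vanish N : gsub N ->
  exists a, vanish_diff a (fun nu => total_hilb N (total_deg nu)).
Proof.
move=> Ng; apply: contrapT => nv.
pose F : set (set M) := [set K | gsub K /\
  ~ exists a, vanish_diff a (fun nu => total_hilb K (total_deg nu))].
have [||K [[Kg nK] _ maxK]] := @maximal_gsub F N.
- by move=> ? [].
- by [].
have [Ks _] := Kg.
have vmono a a' f : (a <= a')%N -> @vanish_diff r int a f -> vanish_diff a' f.
  move=> aa' /vanish_diffsP h; apply/vanish_diffsP => w sw.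
  rewrite -(cat_take_drop a w) diffs_cat; apply: evz_diffs; apply: h.
  by rewrite size_takel // sw.
have killx i x : x \in gens i -> forall m, K (x *: m).
  move=> xi m; have xF := gens_deg xi; apply: contrapT => nKx.
  have Kxg := gsub_add_mul Kg xF.
  have [a ha] : exists a, vanish_diff a (fun nu => total_hilb (add_mul K x) (total_deg nu)).
    apply: contrapT => na; apply: nKx; apply: (maxK (add_mul K x)) => //.
      exact: sub_add_mul.
    exact: mem_add_mul.
  apply: nK; have [cK|ncK] := pselect (colon K x `<=` K).
    have eK : colon K x = K by apply/seteqP; split=> // u Ku; exact: msubZ.
    (* The order is not fixed in advance, so the injective case may use one more difference. *)
    exists a.+1 => j; rewrite diff_total.
    have -> : bdiff (total_hilb K) = total_hilb (add_mul K x).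
      by apply/funext => n; rewrite /bdiff {1}(total_hilb_exact n Kg xF) eK addrK.
    exact: ha.
  have [a' ha'] : exists a, vanish_diff a (fun nu => total_hilb (colon K x) (total_deg nu)).
    apply: contrapT => na; apply: ncK; apply: maxK; last by move=> u Ku; exact: msubZ.
    by split=> //; exact: gsub_colon xF.
  exists (maxn a a').
  have -> : (fun nu => total_hilb K (total_deg nu)) = fun nu =>
      total_hilb (add_mul K x) (total_deg nu) +
      total_hilb (colon K x) (total_deg (nu - degZ U_(i)%MM)).
    by apply/funext => nu; rewrite (total_hilb_exact _ Kg xF) total_degB e1.
  apply: vanish_add; first exact: vmono (leq_maxl _ _) ha.
  apply: (@vanish_shift _ _ _ (fun nu => total_hilb (colon K x) (total_deg nu))).
  exact: vmono (leq_maxr _ _) ha'.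
have [c hc] := kill_total Kg (fun i x m xi => killx i x xi m).
apply: nK; exists 0%N; exists c%:Z => nu hnu; rewrite /total_hilb; congr Posz.
apply/rlen_eq0; [exact: msub_bsub | exact: fin_len_total|].
have hc' : c%:Z <= total_deg nu.
  apply: (le_trans (hnu (Ordinal hr))); rewrite /total_deg (bigD1 (Ordinal hr)) //= lerDl.
  by apply: sumr_ge0 => i _; exact: le_trans (hnu i).
move=> m hm; apply: (cmp_all_in hMg) => [||g].
- by case: Ks.
- by move=> u v; exact: msubD.
have [e|ne] := eqVneq (total_deg g) (total_deg nu).
  by apply: (hc g); rewrite ?e //; exact: cmp_in.
by rewrite (total_cmp hm ne); case: Ks.
Qed.

Lemma total_hilb_fdiff N : gsub N -> exists a n0, forall n, (n0 <= n)%N ->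
  iter a fdiff (fun d => total_hilb N (d%:Z - (r * k)%N%:Z)) n = 0.
Proof.
move=> /total_hilb_vanish[a /vanish_diffsP va]; exists a.
have [|c hc] := va (nseq a (Ordinal hr)); first by rewrite size_nseq.
have E b h : diffs (nseq b (Ordinal hr)) (fun nu => h (total_deg nu)) =
    fun nu => iter b bdiff h (total_deg nu).
  by elim: b h => //= b IH h; rewrite diff_total IH -iterSr.
rewrite E in hc; pose C := `|c|%N.
exists (r * k + r * C)%N => n hn; rewrite iter_fdiff_bdiff.
pose y := (n + a)%N%:Z - (r * k)%N%:Z.
(* Vanishing is known only for degrees large in every coordinate; a total degree y >= r C is
   realized by such a degree, with the excess placed in one coordinate. *)
pose nu : {ffun 'I_r -> int} :=
  [ffun i => C%:Z + (if i == Ordinal hr then y - (r * C)%N%:Z else 0)].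
have -> : (n + a)%N%:Z - (r * k)%N%:Z = total_deg nu.
  rewrite /total_deg (eq_bigr _ (fun i _ => ffunE _ i)) big_split /=.
  rewrite sumr_const card_ord -big_mkcond big_pred1_eq -mulr_natl natz -PoszM /y.
  lia.
apply: hc => i; rewrite ffunE /y /C.
by case: eqP => _; move: hn; rewrite /C; lia.
Qed.

Variable T : set M.
Hypothesis Tg : gsub T.
Variables (c : int) (C : nat).
Hypotheses (Tc : evz (fun nu => hilb T nu - c)) (TC : forall nu, hilb T nu <= C%:Z).

(** Multiplying by n expresses the error O(n^(r-2)) in the form required by [fdiff_growth]. *)
Lemma total_hilb_growth : exists D n0, forall n, (n0 <= n)%N ->
  (`|(total_hilb T (n%:Z - (r * k)%N%:Z) - c * 'C(n + r.-1, r.-1)%:Z)%R| * n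
    <= D * n ^ r.-1)%N.
Proof.
(* If all exponents of mu are at least t, then [degZ mu - kvec] is beyond c0 and the value is
   exactly c; elsewhere the error is at most C'. *)
have [c0 hc0] := Tc; pose t := (k + `|c0|)%N; pose C' := (C + `|c|)%N.
(* For n >= r t, the number of monomials of degree n with some exponent below t. *)
pose bad n := ('C(n + r.-1, r.-1) - 'C(n - r * t + r.-1, r.-1))%N.
have sz n : size (mnm_deg r n) = 'C(n + r.-1, r.-1).
  by move: hr; case: (r) => // r' _; rewrite size_mnm_deg.
have h1 n : (r * t <= n)%N ->
    (`|(total_hilb T (n%:Z - (r * k)%N%:Z) - c * 'C(n + r.-1, r.-1)%:Z)%R| <= C' * bad n)%N.
  move=> hn; rewrite total_hilb_sum // -sz.
  have -> : c * (size (mnm_deg r n))%:Z = \sum_(mu <- mnm_deg r n) c.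
    by rewrite big_const_seq count_predT iter_addr_0 -mulr_natr natz.
  rewrite -sumrB.
  pose P (mu : 'X_{1..r}) := [forall i : 'I_r, t <= mu i]%N.
  have -> : bad n = count (predC P) (mnm_deg r n).
    rewrite /bad -!sz -(count_predC P (mnm_deg r n)) -size_filter.
    by rewrite -{1}(subnK hn) size_mnm_deg_ge addKn.
  elim: (mnm_deg r n) => [|mu l IH]; first by rewrite big_nil muln0.
  rewrite big_cons /= mulnDr; set S := \sum_(_ <- _) _ in IH *.
  have h : (`|(hilb T (degZ mu - kvec) - c)%R| <= C' * ~~ P mu)%N.
    have [Pmu|_] := boolP (P mu).
      rewrite hc0 // => i; rewrite !ffunE; have := forallP Pmu i.
      by rewrite /t; move: (mu i) => x; lia.
    have := TC (degZ mu - kvec); have : 0 <= hilb T (degZ mu - kvec) by [].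
    by move: (hilb _ _) => x; rewrite /C'; lia.
  by move: (hilb T _ - c) h => x h; move: IH h; lia.
(* For r = 1 no degree is bad and the difference is 0; otherwise p is r - 2. *)
move: (hr) h1 => hr' h1; case er : r.-1 => [|p].
  exists 0%N, (r * t)%N => n /h1; rewrite /bad er !bin0 muln0 leqn0 => /eqP ->.
  by [].
exists (C' * (r * t) * r ^ p)%N, (r * t).+1 => n hn.
have {}h1 := h1 n (ltnW hn).
have h2 : (bad n <= (r * t) * (n + p.+1) ^ p)%N.
  rewrite /bad er; set x := (n - r * t + p.+1)%N.
  have -> : (n + p.+1 = x + r * t)%N by rewrite /x; lia.
  exact: bin_diff_bound.
have h3 : ((n + p.+1) ^ p <= r ^ p * n ^ p)%N.
  rewrite -expnMn; have [p0|p0] := posnP p; first by rewrite p0 !expn0.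
  by rewrite leq_exp2r //; nia.
rewrite expnSr mulnA leq_mul2r; apply/orP; right.
rewrite er in h1; apply: (leq_trans h1); rewrite -!mulnA leq_mul2l; apply/orP; right.
by apply: (leq_trans h2); rewrite -mulnA leq_mul2l leq_mul2l h3 !orbT.
Qed.

(** Applied to the difference with c C(n + r - 1, r - 1), [fdiff_growth] removes the error term, and
    the (r-1)-st difference of the binomial is 1. *)
Lemma total_hilb_leading : exists n0, forall n, (n0 <= n)%N ->
  iter r.-1 fdiff (fun d => total_hilb T (d%:Z - (r * k)%N%:Z)) n = c.
Proof.
have [K [n1 hK]] := total_hilb_growth.
have [a [n2 ha]] := total_hilb_fdiff Tg.
pose u d := total_hilb T (d%:Z - (r * k)%N%:Z).
pose v d := c * 'C(d + r.-1, r.-1)%:Z.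
have hv j n : (j <= r.-1)%N -> iter j fdiff v n = c * 'C(n + r.-1, r.-1 - j)%:Z.
  move=> hj; rewrite -iter_fdiff_bin //; elim: j {hj} n => //= j IH n.
  by rewrite /fdiff !IH -mulrBr.
have [||n0 hn0] := @fdiff_growth (maxn a r) r.-1 K n1 (fun d => u d - v d).
- exists n2 => n hn; rewrite iter_fdiffB.
  have -> : iter (maxn a r) fdiff v n = 0.
    have e : (maxn a r = (maxn a r - r.-1.+1) + r.-1.+1)%N by lia.
    rewrite e iterD.
    have -> : iter r.-1.+1 fdiff v = fun=> 0.
      by apply/funext => x; rewrite /= /fdiff !hv // subnn !bin0 subrr.
    elim: (_ - _)%N n {hn} => //= q IH n; by rewrite /fdiff !IH subrr.
  rewrite subr0 -(subnK (leq_maxl a r)) iterD.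
  exact: fdiff_eventually0 ha _ hn.
- exact: hK.
exists n0 => n /hn0; rewrite iter_fdiffB hv // subnn bin0 mulr1 => /eqP.
by rewrite subr_eq0 => /eqP.
Qed.

End TotalDegree.

(** * Transfer to E along a surjection with kernel T *)

Section Quotient.
Hypothesis hr : (0 < r)%N.
Variable T : set M.
Hypothesis Tg : gsub T.
Hypothesis Tsat : forall i m, (forall x, x \in gens i -> T (x *: m)) -> T m.
Variable c : int.
Hypothesis Tc : evz (fun nu => hilb T nu - c).

Variables (E : lmodType B) (EE : {ffun 'I_r -> int} -> {pred E}) (p : M -> E).
Hypotheses (pl : blin p) (psurj : forall y, exists x, y = p x).
Hypothesis pker : forall m, p m = 0 <-> T m.
Hypothesis pEE : forall nu y, y \in EE nu <-> exists2 x, x \in MM nu & y = p x.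

Lemma ann_quotient b : (forall y : E, b *: y = 0) <-> forall m, T (b *: m).
Proof.
split=> h m; first by apply/pker; rewrite blinZ.
by have [x ->] := psurj m; rewrite -blinZ //; apply/pker.
Qed.

Lemma total_component_quotient n :
  [set y | y \in total_component EE n] = p @` total n.
Proof.
have p0 := blin0 pl; have pD u v := blinD u v pl.
have psum I (l : seq I) (f : I -> M) : p (\sum_(i <- l) f i) = \sum_(i <- l) p (f i).
  by elim: l => [|i l IH]; rewrite ?big_nil // !big_cons pD IH.
apply/seteqP; split=> [_ /asboolP[l [f [ul lF ->]]]|_ [_ /asboolP[l [f [ul lF ->]]] <-]].
  have [|g hg] := @choice {ffun 'I_r -> int} M (fun nu m => nu \in l ->
    m \in MM nu /\ f nu = p m).
    move=> nu; have [nl|nl] := boolP (nu \in l); last by exists 0.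
    by have := lF nu nl; rewrite !inE => /andP[/pEE[x xF e] _]; exists x.
  exists (\sum_(nu <- l) g nu).
    apply/asboolP; exists l, g; split=> // nu nl; rewrite !inE.
    have := lF nu nl; rewrite !inE => /andP[_ ->].
    by have [-> _] := hg nu nl.
  by rewrite psum; apply: eq_big_seq => nu nl; have [_ ->] := hg nu nl.
apply/asboolP; exists l, (p \o f); split=> // nu nl; rewrite !inE /=.
have := lF nu nl; rewrite !inE => /andP[fF ->]; rewrite andbT.
by apply/pEE; exists (f nu).
Qed.

Let Tb : bsub T. Proof. by case: Tg => /msub_bsub. Qed.

(** If c is nonzero, [hilb T] itself does not vanish eventually, so the case t = 0 of
    [maximal_nonvanishing] gives P containing Ann(E). The primes [coord_prime P j] give the lower
    bound and [krull_upper] the upper one. *)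
Lemma krull_dim_quotient : c != 0 -> krull_dim E r.
Proof.
move=> c0.
have [C hC] := hilb_bounded Tg Tsat Tc.
have nv : ~ vanish_diff 0 (hilb T).
  move=> [c1 h1]; have [c2 h2] := Tc; move/eqP: c0; apply.
  pose nu : {ffun 'I_r -> int} := [ffun=> Num.max c1 c2].
  have := h2 nu; rewrite h1 => [|i]; last by rewrite ffunE le_max lexx.
  rewrite sub0r => h; apply/eqP; rewrite -oppr_eq0; apply/eqP/h => i.
  by rewrite ffunE le_max lexx orbT.
have [N' [P [[_ TN' _] [Pp Ph nP _ [_ [m hm]]]]]] :=
  maximal_nonvanishing Tg nv.
split.
  exists (coord_prime P); split=> i hi; last first.
    exact: (coord_prime_proper Pp nP hi).
  split; first exact: (coord_prime_prime Pp Ph).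
  move=> b /ann_quotient hb; apply: (sub_coord_prime Ph).
  by apply: hm; apply: TN'.
move=> l ch [hc1 hc2].
apply: (krull_upper Tg hC (c := ch)) => //.
  by move=> i /hc1[].
by move=> b hb; have [_] := hc1 0%N isT; apply; apply/ann_quotient.
Qed.

(** The numerator has as coefficients the r-th backward differences of the Hilbert function,
    finitely many of them nonzero because the (r-1)-st is eventually c; their sum telescopes to
    c. *)
Lemma total_multiplicity_quotient : krull_dim E r -> total_multiplicity EE c.
Proof.
move=> hE.
have [C hC] := hilb_bounded Tg Tsat Tc.
have [k hk] := degrees_bounded_below.
have [n0 hn0] := total_hilb_leading hr hk Tg Tc hC.
have tf n : fin_len (total n).
  exact: (fin_len_total hr hk).
pose H := total_hilb T; pose K := (r * k)%N.
have Hlow x : x < - K%:Z -> H x = 0 by move=> hx; exact: (total_hilb_low hr hk).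
pose d := r.-1; have er : r = d.+1 by rewrite prednK.
(* The shift by d is the price of passing from [fdiff] to [bdiff]. *)
pose D := (n0 + d).+1.
have lead x : (D <= x)%N -> iter d bdiff H (x%:Z - K%:Z) = c.
  move=> hx; rewrite -(hn0 (x - d)%N); last by move: hx; rewrite /D; lia.
  by rewrite iter_fdiff_bdiff subnK //; move: hx; rewrite /D; lia.
exists r, (fun n => rlen T (total n)), K,
  (\poly_(m < D.+1) iter r bdiff H (m%:Z - K%:Z)); split=> //.
- move=> n; have e := total_component_quotient n.
  have -> : rlen T (total n) = len [set y | y \in total_component EE n].
    rewrite e -(rlen0 (fin_len_bsub (fin_len_image pl (tf n)))).
    rewrite (rlen_image pl (bsub0 _) (tf n)); congr (rlen _ (total n)).
    by apply/seteqP; split=> m /pker.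
  by apply: base_lengthE; rewrite e; exact: fin_len_image.
- by move=> n /Hlow [].
- move=> m; rewrite -[RHS]/((\poly_(m < D.+1) iter r bdiff H (m%:Z - K%:Z))`_m).
  rewrite (eq_bigr (fun i : 'I_r.+1 => ((1 - 'X) ^+ r : {poly int})`_i *
    H (m%:Z - K%:Z - i%:Z))) // iter_bdiff_coef coef_poly; case: ltnP => // hm.
  rewrite er /= /bdiff lead ?(ltnW hm) //.
  have -> : m%:Z - K%:Z - 1 = m.-1%:Z - K%:Z by move: hm; lia.
  by rewrite lead ?subrr //; move: hm; lia.
rewrite horner_poly (eq_bigr (fun i : 'I_D.+1 => iter r bdiff H (i%:Z - K%:Z))); last first.
  by move=> i _; rewrite expr1n mulr1.
(* No boundary term appears at the lower end, as H vanishes below -K. *)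
have tele b : \sum_(i < b.+1) iter r bdiff H (i%:Z - K%:Z) = iter d bdiff H (b%:Z - K%:Z).
  elim: b => [|b IH].
    rewrite big_ord_recl big_ord0 addr0 er /= /bdiff /=.
    by rewrite [X in _ - X](iter_bdiff_low d Hlow) ?subr0 //; lia.
  rewrite big_ord_recr IH /= er /= /bdiff.
  have -> : b.+1%:Z - K%:Z - 1 = b%:Z - K%:Z by lia.
  by rewrite addrCA subrr addr0.
by rewrite tele lead.
Qed.

End Quotient.

End Multigraded.

Theorem theorem3p10 (r : nat) (A : comNzRingType) (B : comAlgType A)
    (BB : 'X_{1..r} -> {pred B}) (M : lmodType B)
    (MM : {ffun 'I_r -> int} -> {pred M})
    (n : 'X_{1..r}) (z : 'I_r -> seq B)
    (hr : (0 < r)%N)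
    (hA : artinian_ring A) (hAloc : local_ring A)
    (hB : standard_graded BB)
    (hM : graded_module BB MM) (hMfg : fin_gen_module M)
    (hn : dim_supp_pp BB M (mdeg n))
    (hzn : forall i, size (z i) = n i)
    (hzdeg : forall i x, x \in z i -> x \in BB U_(i)%MM) :
  let zs : seq B := flatten [seq z i | i <- enum 'I_r] in
  let L : lmodType B := quot_mod (seq_submod M zs) in
  let LL : {ffun 'I_r -> int} -> {pred L} :=
    quot_grading MM (seq_submod M zs) in
  let E : lmodType B := quot_mod (torsion L (irrelevant BB)) in
  let EE : {ffun 'I_r -> int} -> {pred E} :=
    quot_grading LL (torsion L (irrelevant BB)) in
  filter_regular_seq BB M zs ->
  exists e : rat,
    [/\ mixed_multiplicity MM n e,
        krull_dim E r ->
          exists2 q : int, total_multiplicity EE q & e = q%:~R &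
        ~ krull_dim E r -> e = 0].
Proof.
move=> zs L LL E EE hf; have [hBB _ hB0 [s [hs1 hs2]]] := hB.
have hMg : grading MM by case: hM.
have finM nu : fin_len [set m | m \in MM nu].
  exact: (fin_len_MM hBB hB0 hs1 hs2 hA hM hMfg).
pose w := word n; pose d := mdeg n; pose h0 := hilb MM [set 0].
have hall : all2 (fun (x : B) (i : 'I_r) => x \in BB U_(i)%MM) zs w.
  rewrite /zs /w /word; elim: (enum 'I_r) => //= i l IH.
  have all2_cat (t1 t2 : seq B) (u1 u2 : seq 'I_r) :
      all2 (fun (x : B) (i : 'I_r) => x \in BB U_(i)%MM) t1 u1 ->
      all2 (fun (x : B) (i : 'I_r) => x \in BB U_(i)%MM) t2 u2 ->
      all2 (fun (x : B) (i : 'I_r) => x \in BB U_(i)%MM) (t1 ++ t2) (u1 ++ u2).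
    elim: t1 u1 => [|x t1 IH1] [|y u1] //= /andP[-> h] h2; exact: IH1.
  apply: all2_cat => //; rewrite -hzn.
  have : forall x, x \in z i -> x \in BB U_(i)%MM by exact: hzdeg.
  elim: (z i) => //= x t IHt ht; rewrite ht ?mem_head //=.
  by apply: IHt => y yt; apply: ht; rewrite inE yt orbT.
have [Ng hev] := hilb_filter_seq hBB hB0 hs1 hs2 hA hM hMfg hall hf.
set N := mul_seq zs in Ng hev; pose T := tors BB N.
have Tg : gsub MM T by exact: gsub_tors.
have Tsat i m : (forall x, x \in gens BB s i -> T (x *: m)) -> T m.
  exact: (tors_saturated hBB hB0 hs1 hs2 hA hM hMfg Ng).
have hvan := vanish_of_dim hBB hB0 hs1 hs2 hA hM hMfg hn.
(* With s = d + 1 the interpolating polynomial, which is P_M, has no coefficient of degree above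
   d. *)
have [cf [cf0 hcf]] := newton (leqnn d.+1) (vanish_diff_intr hvan).
(* Since |n| = d is the top degree, the n-th difference of the expansion is the constant [cf n]. *)
have hcn : evz (fun nu => (diffs w h0 nu)%:~R - cf n : rat).
  have := evz_diffs w hcf; rewrite diffsB diffs_intr diffs_expansion ?size_word //.
  by rewrite content_word.
have hTN : evz (fun nu => hilb MM T nu - hilb MM N nu).
  have [c hc] := tors_eventually hBB hs2 hA hM hMfg Ng.
  exists c%:Z => nu hnu; apply/eqP; rewrite subr_eq0; apply/eqP.
  congr (Posz (len _ - len _)%N); apply/seteqP; split=> m [mF Tm]; split=> //.
    exact: hc mF Tm.
  by apply: sub_tors => //; case: Ng.
have [c0 hc0] : evz (fun nu => (hilb MM T nu)%:~R - cf n : rat).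
  have [c1 h1] := evzD hTN hev; have [c2 h2] := hcn.
  exists (Num.max c1 c2) => nu hnu.
  rewrite -(h2 nu) => [|i]; last by apply: le_trans (hnu i); rewrite le_max lexx orbT.
  congr (_%:~R - _); apply/eqP; rewrite -subr_eq0; apply/eqP; rewrite -[RHS](h1 nu).
    by rewrite addrA subrK.
  by move=> i; apply: le_trans (hnu i); rewrite le_max lexx.
(* Reading the eventual value at one large degree shows that [cf n] is an integer, as
   [total_multiplicity] requires. *)
pose c := hilb MM T [ffun=> c0].
have ec : cf n = c%:~R.
  by apply/esym/eqP; rewrite -subr_eq0; apply/eqP; apply: hc0 => i; rewrite ffunE.
have Tc : evz (fun nu => hilb MM T nu - c).
  exists c0 => nu /hc0; rewrite ec -rmorphB /= => /eqP; rewrite intr_eq0 => /eqP.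
  exact.
pose p : M -> E := quot_pi (torsion L (irrelevant BB)) \o quot_pi (seq_submod M zs).
have pl : blin p by move=> b u v; rewrite /p /= !blin_quot_pi.
have psurj y : exists x, y = p x.
  have [x ->] := quot_pi_surj y; have [m ->] := quot_pi_surj x.
  by exists m.
have pker m : p m = 0 <-> T m.
  rewrite /p /= quot_pi_eq0; exact: (torsion_tors hBB hB0 hs1 hs2 m Ng).
have pEE nu y : y \in EE nu <-> exists2 x, x \in MM nu & y = p x.
  split=> [/asboolP[_ /asboolP[m mF ->] ->]|[m mF ->]]; first by exists m.
  by apply/asboolP; exists (quot_pi (seq_submod M zs) m) => //; apply/asboolP; exists m.
exists (cf n); split.
- exists (\sum_(k <- mnm_upto r d) cf k *: \prod_(i < r) binomX i (k i)),
    (mnm_upto r d), cf; split=> //.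
  + have [c1 h1] := hcf; exists c1 => nu hnu.
    exists (len [set m | m \in MM nu]); first exact: base_lengthE.
    have := h1 nu hnu; rewrite /hilb rlen0 => [|]; last exact: fin_len_bsub.
    move=> /eqP; rewrite subr_eq0 => /eqP e; apply: (etrans _ (esym e)).
    rewrite rmorph_sum /=; apply: eq_bigr => k _; rewrite mevalZ rmorph_prod /=.
    by congr (_ * _); apply: eq_bigr => i _; rewrite meval_binomX.
  + exact: mnm_upto_uniq.
  by move=> k; rewrite mem_mnm_upto -ltnNge; exact: cf0.
- move=> hE; exists c => //.
  exact: (total_multiplicity_quotient hBB hB0 hs1 hs2 hA hM hMfg hr Tg Tsat Tc pl pker pEE).
(* By contraposition: a nonzero c forces dim E = r. *)
move=> nE; rewrite ec; apply/eqP; rewrite intr_eq0; apply/negPn/negP => c00; apply: nE.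
exact: (krull_dim_quotient hBB hB0 hs1 hs2 hA hM hMfg Tg Tsat Tc pl psurj pker c00).
Qed.
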